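(* Let $\Gamma$ be a non-empty finite connected graph, $\mathcal{L}(\Gamma)$ a labeled graph over $\Gamma$, $G$ the GBS-group defined by $\mathcal{L}(\Gamma)$, and $\Delta\colon G\to\mathbb{Q}^*$ its modular homomorphism. Let $G$ be not solvable and $\mathcal{L}(\Gamma)$ be reduced. 1. If $\operatorname{Im}\Delta=\{1\}$, then $G$ is residually nilpotent if and only if it is residually a finite $p$-group for some prime number $p$. 2. If $\operatorname{Im}\Delta=\{1,-1\}$, then the following statements are equivalent: a) $G$ is residually nilpotent; b) $G$ is residually a finite nilpotent $\{2,p\}$-group for some prime number $p$ (which can be equal to $2$); c) all the labels of $\mathcal{L}(\Gamma)$ are $p$-numbers for some prime number $p$, and if $p\neq 2$, then every elliptic element of $G$ that is conjugate to its inverse belongs to $C(G)$. 3. If $\operatorname{Im}\Delta\not\subseteq\{1,-1\}$, then $G$ is not residually nilpotent.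
   Context: For a class $\mathcal{C}$ of groups, a group $G$ is residually a $\mathcal{C}$-group if for every non-unit $g\in G$ there is a homomorphism $\sigma$ of $G$ onto a group of $\mathcal{C}$ with $g\sigma\neq 1$; residually nilpotent means this for the class of nilpotent groups. For a set $\rho$ of primes, a $\rho$-number is an integer all of whose prime divisors belong to $\rho$, and a $\rho$-group is a periodic group in which the orders of all elements are $\rho$-numbers; one writes $p$- instead of $\{p\}$-. $\mathrm{BS}(m,n)=\langle a,b;\ a^{-1}b^ma=b^n\rangle$ for non-zero integers $m,n$. Labeled graphs and GBS-groups. $\Gamma=(V,E)$ is a non-empty finite connected undirected graph (loops and multiple edges allowed). The ends of an edge $e$ are denoted $e(1),e(-1)$ (in a fixed order; they coincide if $e$ is a loop). A labeled graph $\mathcal{L}(\Gamma)$ is obtained by assigning to each $e\in E$ non-zero integers $\lambda(+e)$ (at $e(1)$) and $\lambda(-e)$ (at $e(-1)$), called labels; we write $\lambda(\varepsilon e)$, $\varepsilon=\pm1$. Fix a maximal subtree $T$ of $\Gamma$ with edge set $E_T$. The GBS-group defined by $\mathcal{L}(\Gamma)$ (the fundamental group of the corresponding graph of infinite cyclic groups) is the group $G=\pi_1(\mathcal{L}(\Gamma))$ with generators $g_v$ ($v\in V$), $t_e$ ($e\in E\setminus E_T$) and defining relations $g_{e(1)}^{\lambda(+e)}=g_{e(-1)}^{\lambda(-e)}$ ($e\in E_T$), $t_e^{-1}g_{e(1)}^{\lambda(+e)}t_e=g_{e(-1)}^{\lambda(-e)}$ ($e\in E\setminus E_T$); up to isomorphism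 it does not depend on $T$. The vertex groups are the subgroups $G_v=\langle g_v\rangle$, which are infinite cyclic. $\mathcal{L}(\Gamma)$ is reduced if for all $e\in E$, $\varepsilon=\pm1$, $|\lambda(\varepsilon e)|=1$ implies that $e$ is a loop. $G$ is elementary if it is isomorphic to $\mathbb{Z}$, $\mathrm{BS}(1,1)$ or $\mathrm{BS}(1,-1)$ (elementary groups are solvable). An element of $G$ is elliptic if it is conjugate to an element of some vertex group. Modular homomorphism. If $G$ is not elementary, $\Delta\colon G\to\mathbb{Q}^*$ is defined as follows: for $g\in G$ take any non-unit elliptic element $a$ and non-zero integers $m,n$ with $g^{-1}a^mg=a^n$ (they exist), and put $\Delta(g)=n/m$; this is a well-defined homomorphism independent of the choices. Cyclic radical. $C(G)$ denotes the largest cyclic normal subgroup of $G$; it exists whenever $G$ is not isomorphic to $\mathrm{BS}(1,1)$ or $\mathrm{BS}(1,-1)$. *)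

(* Defs.v *)
From HB Require Import structures.
From mathcomp Require Import all_boot all_order all_algebra generic_quotient.
From mathcomp Require Import boolp classical_sets functions cardinality.

Set Implicit Arguments.
Unset Strict Implicit.
Unset Printing Implicit Defensive.

Local Open Scope quotient_scope.
Local Open Scope classical_set_scope.
Local Open Scope group_scope.

Definition zexpg (G : groupType) (x : G) (k : int) : G :=
  match k with Posz n => x ^+ n | Negz n => x ^- n.+1 end.

Definition is_subgroup (G : groupType) (A : set G) : Prop :=
  A 1 /\ forall x y, A x -> A y -> A (x / y).

Definition generated (G : groupType) (A : set G) : set G :=
  smallest (@is_subgroup G) A.

Definition commutator (G : groupType) (A B : set G) : set G :=
  generated [set [~ x, y] | x in A & y in B].

Fixpoint lower_central (G : groupType) (n : nat) : set G :=
  if n is n'.+1 then commutator (@lower_central G n') [set: G] else [set: G].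

Fixpoint derived_series (G : groupType) (n : nat) : set G :=
  if n is n'.+1 then commutator (@derived_series G n') (@derived_series G n')
  else [set: G].

Definition nilpotent (G : groupType) : Prop :=
  exists n, @lower_central G n = [set 1].

Definition solvable (G : groupType) : Prop :=
  exists n, @derived_series G n = [set 1].

Definition has_order (G : groupType) (x : G) (n : nat) : Prop :=
  [/\ (0 < n)%N, x ^+ n = 1 & forall m, (0 < m < n)%N -> x ^+ m != 1].

Definition rho_group (rho : nat_pred) (G : groupType) : Prop :=
  forall x : G, exists2 n, has_order x n & rho.-nat n.

Definition finite_group (G : groupType) : Prop := finite_set [set: G].

Definition residually (C : groupType -> Prop) (G : groupType) : Prop :=
  forall g : G, g != 1 ->
    exists (H : groupType) (sigma : {multiplicative G -> H}),
      [/\ C H, range sigma = [set: H] & sigma g != 1].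

Definition conjugate (G : groupType) (x y : G) : Prop := exists z, y = x ^ z.

Definition cyclic_normal_subgroup (G : groupType) (N : set G) : Prop :=
  (exists a, N = range (zexpg a)) /\ (forall x g, N x -> N (x ^ g)).

Definition is_cyclic_radical (G : groupType) (N : set G) : Prop :=
  cyclic_normal_subgroup N /\
  forall M, cyclic_normal_subgroup M -> M `<=` N.

(* The default value [set 1] is only used when there is no largest cyclic
   normal subgroup. *)
Definition cyclic_radical (G : groupType) : set G :=
  xget [set 1] (@is_cyclic_radical G).
Arguments cyclic_radical : clear implicits.

(* Groups given by generators and relations: words in the letters (x, true),
   standing for x, and (x, false), standing for x^-1, modulo the least
   congruence that contains the relations and free cancellation. *)

Section Presentation.
Variable X : choiceType.

Definition word : Type := seq (X * bool).

Definition letterpow (x : X) (k : int) : word :=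
  match k with
  | Posz n => nseq n (x, true)
  | Negz n => nseq n.+1 (x, false)
  end.

Definition invw (w : word) : word := rev [seq (l.1, ~~ l.2) | l <- w].

Variable R : word -> word -> Prop.

Inductive wequiv : word -> word -> Prop :=
| wequiv_refl u : wequiv u u
| wequiv_sym u v : wequiv u v -> wequiv v u
| wequiv_trans u v w : wequiv u v -> wequiv v w -> wequiv u w
| wequiv_cat u u' v v' : wequiv u u' -> wequiv v v' -> wequiv (u ++ v) (u' ++ v')
| wequiv_cancel x b : wequiv [:: (x, b); (x, ~~ b)] [::]
| wequiv_rel u v : R u v -> wequiv u v.

Definition wequivb (u v : word) : bool := `[< wequiv u v >].

Lemma wequivb_equiv : equiv_class_of wequivb.
Proof.
split=> [u|u v|v u w].
- exact/asboolP/wequiv_refl.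
- by apply/asboolP/asboolP; apply: wequiv_sym.
- by move=> /asboolP uv /asboolP vw; apply/asboolP; apply: wequiv_trans uv vw.
Qed.

Canonical wequivb_rel := EquivRelPack wequivb_equiv.

Definition presented : Type := {eq_quot wequivb_rel}.
HB.instance Definition _ := Choice.on presented.

Definition classw (w : word) : presented := \pi_({eq_quot wequivb_rel}) w.
Definition reprw (g : presented) : word := @repr _ {eq_quot wequivb_rel} g.

Lemma classwP u v : classw u = classw v <-> wequiv u v.
Proof.
split=> [/eqP|uv]; first by rewrite /classw eqquotE => /asboolP.
by apply/eqP; rewrite /classw eqquotE; apply/asboolP.
Qed.

Lemma reprwK g : classw (reprw g) = g.
Proof. exact: reprK. Qed.

Lemma wequiv_repr w : wequiv (reprw (classw w)) w.
Proof. by apply/classwP; rewrite reprwK. Qed.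

Lemma invw_cat u v : invw (u ++ v) = invw v ++ invw u.
Proof. by rewrite /invw map_cat rev_cat. Qed.

Lemma invwK : involutive invw.
Proof.
move=> w; rewrite /invw map_rev revK -map_comp map_id_in // => -[x b] _ /=.
by rewrite negbK.
Qed.

Lemma wequiv_mulV w : wequiv (w ++ invw w) [::].
Proof.
elim: w => [|[x b] w IHw]; first exact: wequiv_refl.
rewrite -cat1s invw_cat catA -(catA [:: _]).
apply: wequiv_trans (wequiv_cancel x b).
rewrite -[[:: _; _]]/([:: (x, b)] ++ [:: (x, ~~ b)]).
apply: wequiv_cat (wequiv_refl _).
rewrite -[X in wequiv _ X]cats0; apply: wequiv_cat IHw; exact: wequiv_refl.
Qed.

Lemma wequiv_Vmul w : wequiv (invw w ++ w) [::].
Proof. by have := wequiv_mulV (invw w); rewrite invwK. Qed.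

Lemma wequiv_inv u v : wequiv u v -> wequiv (invw u) (invw v).
Proof.
move=> uv; have r := wequiv_refl.
apply: (@wequiv_trans _ (invw u ++ (v ++ invw v))).
  rewrite -[X in wequiv X _]cats0.
  by apply: wequiv_cat; [exact: r | apply: wequiv_sym; apply: wequiv_mulV].
rewrite catA -[X in wequiv _ X]cat0s; apply: wequiv_cat (r _).
apply: wequiv_trans (wequiv_Vmul u); apply: wequiv_cat (r _) _.
exact: wequiv_sym.
Qed.

Definition pres_mul (g h : presented) := classw (reprw g ++ reprw h).
Definition pres_one := classw [::].
Definition pres_inv (g : presented) := classw (invw (reprw g)).

Lemma pres_mulE u v : pres_mul (classw u) (classw v) = classw (u ++ v).
Proof. by apply/classwP/wequiv_cat; apply: wequiv_repr. Qed.

Lemma pres_invE u : pres_inv (classw u) = classw (invw u).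
Proof. by apply/classwP/wequiv_inv/wequiv_repr. Qed.

Lemma pres_mulA : associative pres_mul.
Proof.
move=> f g h; rewrite -(reprwK f) -(reprwK g) -(reprwK h).
by rewrite !pres_mulE catA.
Qed.

Lemma pres_mul1 : left_id pres_one pres_mul.
Proof. by move=> g; rewrite -(reprwK g) pres_mulE. Qed.

Lemma pres_mulr1 : right_id pres_one pres_mul.
Proof. by move=> g; rewrite -(reprwK g) pres_mulE cats0. Qed.

Lemma pres_mulV : left_inverse pres_one pres_inv pres_mul.
Proof.
move=> g; rewrite -(reprwK g) pres_invE pres_mulE.
exact/classwP/wequiv_Vmul.
Qed.

Lemma pres_mulVr : right_inverse pres_one pres_inv pres_mul.
Proof.
move=> g; rewrite -(reprwK g) pres_invE pres_mulE.
exact/classwP/wequiv_mulV.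
Qed.

HB.instance Definition _ :=
  isGroup.Build presented pres_mulA pres_mul1 pres_mulr1 pres_mulV pres_mulVr.

Definition presgen (x : X) : presented := classw [:: (x, true)].

Lemma classw_letterpow x k : classw (letterpow x k) = zexpg (presgen x) k.
Proof.
have powE (l : X * bool) n : classw (nseq n l) = classw [:: l] ^+ n.
  elim: n => // n IHn; rewrite expgS -IHn. exact/esym/(pres_mulE [:: l]).
have invE : (presgen x)^-1 = classw [:: (x, false)].
  exact: (pres_invE [:: (x, true)]).
by case: k => n; rewrite [LHS]powE //= -expVgn invE.
Qed.

Lemma presented_rel u v : R u v -> classw u = classw v.
Proof. by move=> Ruv; apply/classwP/wequiv_rel. Qed.

End Presentation.

Definition evalw (X : choiceType) (H : groupType) (f : X -> H) (w : word X) : H :=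
  foldr (fun l h => (if l.2 then f l.1 else (f l.1)^-1) * h) 1 w.

Lemma evalw_cat (X : choiceType) (H : groupType) (f : X -> H) (u v : word X) :
  evalw f (u ++ v) = evalw f u * evalw f v.
Proof.
by elim: u => [|l u IHu] /=; rewrite ?mul1g // -/(evalw _ _) IHu mulgA.
Qed.

Lemma evalw_hom (X : choiceType) (R : word X -> word X -> Prop)
    (H : groupType) (psi : {multiplicative presented R -> H}) (w : word X) :
  psi (classw R w) = evalw (fun x => psi (presgen R x)) w.
Proof.
have psi1 : psi (classw R [::]) = 1.
  by apply: (@mulgI _ (psi 1)); rewrite mulg1 -gmulfM mulg1.
elim: w => [//|[x b] w IHw] /=; rewrite -IHw.
have -> : classw R ((x, b) :: w) = classw R [:: (x, b)] * classw R w.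
  exact/esym/(pres_mulE _ [:: (x, b)]).
rewrite gmulfM; congr (_ * _); case: b => //.
apply: (@mulgI _ (psi (presgen R x))); rewrite -gmulfM mulgV -psi1.
by congr (psi _); rewrite [LHS]pres_mulE; apply/classwP/(wequiv_cancel R x true).
Qed.

(* The universal property of the presentation. *)
Lemma presented_lift (X : choiceType) (R : word X -> word X -> Prop)
    (H : groupType) (f : X -> H) :
  (forall u v, R u v -> evalw f u = evalw f v) ->
  exists phi : {multiplicative presented R -> H},
    (forall x, phi (presgen R x) = f x) /\
    (forall psi : {multiplicative presented R -> H},
       (forall x, psi (presgen R x) = f x) -> psi =1 phi).
Proof.
move=> fR.
have fE u v : wequiv R u v -> evalw f u = evalw f v.
  elim=> {u v} [//|//|u v w _ -> //|u u' v v' _ uu' _ vv'|x b|]; last exact: fR.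
    by rewrite !evalw_cat uu' vv'.
  by case: b; rewrite /= ?mulg1 ?mulgV ?mulVg.
pose phi (g : presented R) := evalw f (reprw g).
have phiM : {morph phi : g h / g * h >-> g * h}.
  by move=> g h; rewrite /phi -evalw_cat; apply: fE; apply: wequiv_repr.
pose Phi := HB.pack_for {multiplicative presented R -> H} phi
  (isMultiplicative.Build _ _ phi phiM).
exists Phi; split=> [x|psi psif g].
  by rewrite /= /phi (fE _ _ (wequiv_repr _ _)) /= mulg1.
rewrite -[g in LHS]reprwK evalw_hom /= /phi.
by congr evalw; apply/funext.
Qed.

(* Graphs (loops and multiple edges are allowed).  The Boolean [true] stands for
   the sign +1 and [false] for -1: the ends of e are [endpt e true] = e(1) and
   [endpt e false] = e(-1). *)

Record multigraph := Multigraph {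
  vertex : finType;
  edge : finType;
  endpt : edge -> bool -> vertex
}.

Section Graph.
Variable Gamma : multigraph.
Local Notation V := (vertex Gamma).
Local Notation E := (edge Gamma).

(* A pair (e, eps) is the edge e traversed from e(eps) to e(-eps). *)
Fixpoint walk (T : {set E}) (v : V) (s : seq (E * bool)) (w : V) : bool :=
  if s is (e, eps) :: s' then
    [&& e \in T, endpt e eps == v & walk T (endpt e (~~ eps)) s' w]
  else v == w.

Definition nonempty_graph : Prop := (0 < #|V|)%N.

Definition connected_graph : Prop :=
  forall v w : V, exists s, walk [set: E]%SET v s w.

(* No cycle: no non-empty closed walk without repeated edges. *)
Definition acyclic (T : {set E}) : Prop :=
  forall v s, walk T v s v -> uniq [seq o.1 | o <- s] -> s = [::].

Definition subtree (W : {set V}) (T : {set E}) : Prop :=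
  [/\ W != finset.set0,
      forall e eps, e \in T -> endpt e eps \in W,
      forall v w, v \in W -> w \in W -> exists s, walk T v s w
    & acyclic T].

Definition maximal_subtree (T : {set E}) : Prop :=
  exists2 W, subtree W T &
    forall W' T', subtree W' T' -> W \subset W' -> T \subset T' ->
      W' = W /\ T' = T.

Definition is_loop (e : E) : Prop := endpt e true = endpt e false.

End Graph.

Record labeled_graph (Gamma : multigraph) := LabeledGraph {
  label :> edge Gamma -> bool -> int;
  label_neq0 : forall e eps, label e eps != 0%R
}.

Definition reduced (Gamma : multigraph) (L : labeled_graph Gamma) : Prop :=
  forall e eps, `|L e eps|%N = 1%N -> is_loop e.

Section GBS.
Variables (Gamma : multigraph) (L : labeled_graph Gamma) (T : {set edge Gamma}).

(* [inl v] is the generator g_v, and [inr e] the generator t_e. *)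
Definition gbs_gen : choiceType :=
  (vertex Gamma + {e : edge Gamma | e \notin T})%type.

Definition vertexpow (e : edge Gamma) (eps : bool) : word gbs_gen :=
  letterpow (inl (endpt e eps) : gbs_gen) (L e eps).

Inductive gbs_rel : word gbs_gen -> word gbs_gen -> Prop :=
| gbs_rel_tree e : e \in T -> gbs_rel (vertexpow e true) (vertexpow e false)
| gbs_rel_stable (e : {e : edge Gamma | e \notin T}) :
    gbs_rel ([:: (inr e, false)] ++ vertexpow (val e) true ++ [:: (inr e, true)])
            (vertexpow (val e) false).

Definition gbs : groupType := presented gbs_rel.

Definition vertex_group (v : vertex Gamma) : set gbs :=
  range (zexpg (presgen gbs_rel (inl v) : gbs)).

Definition elliptic (a : gbs) : Prop :=
  exists v, exists2 b, vertex_group v b & conjugate b a.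

(* Meaningful when the group is not elementary; the default value 0, which is
   not in Q^*, is then never used. *)
Definition modular (g : gbs) : rat :=
  xget 0%R [set q | exists (a : gbs) (m n : int),
    [/\ elliptic a /\ a != 1, (m != 0 /\ n != 0)%R,
        zexpg a m ^ g = zexpg a n & q = (n%:~R / m%:~R)%R]].

End GBS.

Arguments modular {Gamma} L T g.

(* Main.v *)
(* Write g_v for the vertex generators.  A representation of the graph of groups
   by permutations of a set of states, in which every edge acts, also acts on
   vectors indexed by the edges of a given path, as in Magnus' proof that free
   groups are residually nilpotent: crossing an edge in a given state adds each
   coordinate to the next one if the edge and the state match.  A non-trivial
   reduced path moves the first basis vector to the last coordinate, hence is
   non-trivial.  With states in Q, on which g_v acts by a translation and an edge
   by the ratio of its labels, this gives Britton's lemma for G; with states in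
   Z/q, q a power of p, it gives finite p-groups as soon as the translation
   lengths chi_v satisfy lambda chi_v = +-mu chi_w modulo q along each edge, with
   only plus signs unless p = 2.

   If G is residually nilpotent and Delta(x) is not +-1, then g_v has finite
   order in each nilpotent quotient, so that a fixed power of g_v commutes with
   all its conjugates.  By Britton's lemma and reducedness all these conjugates
   lie in the vertex group, which forces Delta(x) = +-1 by minimality.  If Delta
   takes values in {1, -1}, then elements of coprime orders modulo a normal cyclic
   elliptic subgroup <z> commute in each nilpotent quotient, and Britton's lemma
   excludes two different primes in the labels.  An elliptic element conjugate to
   its inverse has order a power of 2 in each nilpotent quotient, hence generates
   a normal subgroup when the labels are powers of an odd prime.

   Conversely, if Delta takes the value -1 and p is odd, then elliptic elements
   are detected by 2-groups.  The signs of the chi_v can be chosen so that the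
   edges of less than maximal period satisfy the above congruence with a plus
   sign, since a closed path along such edges that reverses the sign would invert
   an elliptic element outside the cyclic radical; and for the edges of maximal
   period q both sides of the congruence vanish. *)
From mathcomp Require Import all_fingroup all_solvable.
Require Import Defs.
From HB Require Import structures.
From mathcomp Require Import all_boot all_order all_algebra.
From mathcomp Require Import boolp classical_sets functions cardinality.
From mathcomp Require Import zify ring lra.

Set Implicit Arguments.
Unset Strict Implicit.
Unset Printing Implicit Defensive.
Import GRing.Theory Num.Theory Order.TTheory.
Local Open Scope classical_set_scope.
Local Open Scope group_scope.

(** * Powers and permutations *)

Lemma dvdz_opp (d m : int) : (d %| (- m)%R)%Z = (d %| m)%Z.
Proof. by rewrite !dvdzE abszN. Qed.

Section Zexpg.
Variable G : groupType.
Implicit Types (x y : G) (i j : int).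

Lemma zexpg1 x : zexpg x 1 = x. Proof. by []. Qed.
Lemma zexpgS x i : zexpg x (i + 1)%R = zexpg x i * x.
Proof.
case: i => [n|[|n]]; first by rewrite -[(_ + 1)%R]/(Posz (n + 1)) addn1 /= expgSr.
  by rewrite /= mulVg.
have -> : (Negz n.+1 + 1 = Negz n)%R by lia.
by rewrite /= [in RHS]expgS invgM -mulgA mulVg mulg1.
Qed.

Lemma zexpgD x i j : zexpg x (i + j)%R = zexpg x i * zexpg x j.
Proof.
elim/int_ind: j => [|n IHn|n IHn]; first by rewrite addr0 mulg1.
  have -> : (i + n.+1%:Z = (i + n%:Z) + 1)%R by lia.
  have -> : (n.+1%:Z = n%:Z + 1)%R by lia.
  by rewrite !zexpgS IHn mulgA.
apply: (@mulIg _ x); rewrite -mulgA -!zexpgS.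
have -> : (i - n.+1%:Z + 1 = i - n%:Z)%R by lia.
by have -> : (- n.+1%:Z + 1 = - n%:Z)%R by lia.
Qed.

Lemma zexpgN x i : zexpg x (- i)%R = (zexpg x i)^-1.
Proof.
by apply: (@mulIg _ (zexpg x i)); rewrite -zexpgD mulVg addrC subrr.
Qed.

Lemma zexpgB x i j : zexpg x (i - j)%R = zexpg x i / zexpg x j.
Proof. by rewrite zexpgD zexpgN. Qed.

Lemma zexpg_comm x y i : commute x y -> commute x (zexpg y i).
Proof. by case: i => n xy /=; [|apply: commuteV]; apply: commuteX. Qed.

Lemma zexpg_comm2 x y i j : commute x y -> commute (zexpg x i) (zexpg y j).
Proof.
by move=> xy; apply/zexpg_comm/commute_sym/zexpg_comm/commute_sym.
Qed.

Lemma zexpgM x i j : zexpg x (i * j)%R = zexpg (zexpg x i) j.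
Proof.
elim/int_ind: j => [|n IHn|n IHn]; first by rewrite mulr0.
  have -> : (i * n.+1%:Z = i * n%:Z + i)%R by lia.
  have -> : (n.+1%:Z = n%:Z + 1)%R by lia.
  by rewrite zexpgS zexpgD IHn.
apply: (@mulIg _ (zexpg x i)); rewrite -zexpgD -zexpgS.
have -> : (i * - n.+1%:Z + i = i * - n%:Z)%R by lia.
by have -> : (- n.+1%:Z + 1 = - n%:Z)%R by lia.
Qed.

Lemma zexpg1n i : zexpg (1 : G) i = 1.
Proof. by case: i => n /=; rewrite expg1n ?invg1. Qed.

Lemma zexpgJ x y i : zexpg x i ^ y = zexpg (x ^ y) i.
Proof. by case: i => n /=; rewrite ?conjVg conjXg. Qed.

Lemma zexpgV x i : zexpg x^-1 i = (zexpg x i)^-1.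
Proof. by rewrite -zexpgN -mulN1r zexpgM. Qed.

End Zexpg.

Section Morphisms.
Variables (G H : groupType) (f : {multiplicative G -> H}).

Lemma hom1 : f 1 = 1.
Proof. by apply: (@mulgI _ (f 1)); rewrite mulg1 -gmulfM mulg1. Qed.

Lemma homV x : f x^-1 = (f x)^-1.
Proof. by apply: (@mulgI _ (f x)); rewrite -gmulfM !mulgV hom1. Qed.

Lemma homJ x y : f (x ^ y) = f x ^ f y.
Proof. by rewrite !conjgE !gmulfM homV. Qed.

Lemma homR x y : f [~ x, y] = [~ f x, f y].
Proof. by rewrite !commgEl gmulfM homV homJ. Qed.

Lemma homX x n : f (x ^+ n) = f x ^+ n.
Proof. by elim: n => [|n IHn]; rewrite ?hom1 // !expgS gmulfM IHn. Qed.

Lemma homZ x i : f (zexpg x i) = zexpg (f x) i.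
Proof. by case: i => n /=; rewrite ?homV homX. Qed.

End Morphisms.

(* Permutations compose from left to right. *)
Record sym (X : Type) := Sym {
  sym_fun :> X -> X;
  sym_inv : X -> X;
  sym_funK : cancel sym_fun sym_inv;
  sym_invK : cancel sym_inv sym_fun
}.

HB.instance Definition _ X := gen_eqMixin (sym X).
HB.instance Definition _ X := gen_choiceMixin (sym X).

Section Sym.
Variable X : Type.
Implicit Types p q : sym X.

Lemma sym_eq p q : p =1 q -> p = q.
Proof.
case: p q => [f f' fK f'K] [g g' gK g'K] /= /funext fg; subst g.
have fg' : f' = g' by apply/funext => x; rewrite -{1}(g'K x) fK.
by subst g'; rewrite (Prop_irrelevance fK gK) (Prop_irrelevance f'K g'K).
Qed.

Definition sym_mul p q : sym X :=
  Sym (can_comp (sym_funK q) (sym_funK p)) (can_comp (sym_invK p) (sym_invK q)).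
Definition sym_one : sym X := Sym (fun x => erefl (id x)) (fun x => erefl (id x)).
Definition sym_opp p : sym X := Sym (sym_invK p) (sym_funK p).

Lemma sym_mulA : associative sym_mul. Proof. by move=> p q r; apply: sym_eq. Qed.
Lemma sym_mul1 : left_id sym_one sym_mul. Proof. by move=> p; apply: sym_eq. Qed.
Lemma sym_mulr1 : right_id sym_one sym_mul. Proof. by move=> p; apply: sym_eq. Qed.
Lemma sym_mulV : left_inverse sym_one sym_opp sym_mul.
Proof. by move=> p; apply: sym_eq => x /=; rewrite sym_invK. Qed.
Lemma sym_mulVr : right_inverse sym_one sym_opp sym_mul.
Proof. by move=> p; apply: sym_eq => x /=; rewrite sym_funK. Qed.

HB.instance Definition _ :=
  isGroup.Build (sym X) sym_mulA sym_mul1 sym_mulr1 sym_mulV sym_mulVr.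

Lemma symM p q x : (p * q) x = q (p x). Proof. by []. Qed.
Lemma sym1 x : (1 : sym X) x = x. Proof. by []. Qed.
Lemma symVK p x : p^-1 (p x) = x. Proof. exact: (sym_funK p). Qed.
Lemma symKV p x : p (p^-1 x) = x. Proof. exact: (sym_invK p). Qed.

End Sym.


Section Subgroups.
Variables (G : groupType) (K : set G).
Hypothesis Ksub : is_subgroup K.

Lemma subg1 : K 1. Proof. by case: Ksub. Qed.
Lemma subgV x : K x -> K x^-1.
Proof. by case: Ksub => K1 KF Kx; rewrite -[x^-1]mul1g; apply: KF. Qed.
Lemma subgM x y : K x -> K y -> K (x * y).
Proof. by case: Ksub => _ KF Kx Ky; rewrite -[y]invgK; apply/KF/subgV. Qed.
Lemma subgX x n : K x -> K (x ^+ n).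
Proof.
by move=> Kx; elim: n => [|n IHn]; [exact: subg1 | rewrite expgS; apply: subgM].
Qed.
Lemma subgZ x i : K x -> K (zexpg x i).
Proof. by case: i => n Kx /=; [|apply: subgV]; apply: subgX. Qed.

End Subgroups.

(** * Oriented edges and maximal subtrees *)

Section OrientedEdges.
Variables (Gamma : multigraph) (L : labeled_graph Gamma).
Local Notation V := (vertex Gamma).
Local Notation E := (edge Gamma).

Definition oedge : Type := (E * bool)%type.
HB.instance Definition _ := Choice.on oedge.

Implicit Types (f : oedge) (s : seq oedge) (v w : V) (T : {set E}).

Definition src f : V := endpt f.1 f.2.
Definition tgt f : V := endpt f.1 (~~ f.2).
Definition bar f : oedge := (f.1, ~~ f.2).
Definition lab f : int := L f.1 f.2.

Lemma barK f : bar (bar f) = f. Proof. by case: f => e b; rewrite /bar negbK. Qed.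
Lemma src_bar f : src (bar f) = tgt f. Proof. by []. Qed.
Lemma tgt_bar f : tgt (bar f) = src f. Proof. by rewrite /tgt negbK. Qed.
Lemma bar_neq f : bar f != f.
Proof. by case: f => e b; rewrite /bar xpair_eqE eqxx; case: b. Qed.
Lemma lab_neq0 f : lab f != 0%R. Proof. exact: label_neq0. Qed.

Lemma walk_cons T v f s w :
  walk T v (f :: s) w = [&& f.1 \in T, src f == v & walk T (tgt f) s w].
Proof. by case: f. Qed.

Lemma walk_cat T v s1 s2 w :
  walk T v (s1 ++ s2) w <-> exists u, walk T v s1 u /\ walk T u s2 w.
Proof.
elim: s1 v => [|f s1 IHs] v.
  by split=> [vw|[u [/eqP-> //]]]; exists v; split; rewrite /=.
rewrite cat_cons walk_cons; split=> [/and3P[fT fv /IHs[u [s1u us2]]]|[u []]].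
  by exists u; split=> //; rewrite walk_cons fT fv.
rewrite walk_cons => /and3P[fT fv s1u] us2; rewrite fT fv.
by apply/IHs; exists u.
Qed.

Definition rev_walk s := rev [seq bar f | f <- s].

Lemma walk_rev T v s w : walk T v s w -> walk T w (rev_walk s) v.
Proof.
elim: s v => [|f s IHs] v; first by rewrite /= eq_sym.
rewrite walk_cons => /and3P[fT /eqP fv /IHs wf].
rewrite /rev_walk /= rev_cons -cats1; apply/walk_cat; exists (tgt f).
by split=> //; rewrite walk_cons tgt_bar fv /= fT !eqxx.
Qed.

Lemma walk_sub T T' v s w : T \subset T' -> walk T v s w -> walk T' v s w.
Proof.
move=> /fintype.subsetP TT'; elim: s v => [|f s IHs] v //.
by rewrite !walk_cons => /and3P[/TT'-> -> /IHs].
Qed.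

(** All edges of [T] at [x] are the edge of [f1], so a walk from [x] that avoids it has no first
    step. *)
Lemma walk_leaf T x v f1 s w :
  (forall f, f.1 \in T -> src f = x -> f.1 = f1.1) ->
  walk T v s w -> f1.1 \notin [seq f.1 | f <- s] -> v = x -> s = [::] /\ w = x.
Proof.
case: s => [|f s] leaf; first by move=> /eqP-> _ ->.
rewrite walk_cons => /and3P[fT /eqP fv _] /= + vx.
by rewrite inE (leaf f) ?eqxx // fv.
Qed.

(** If the subtree missed a vertex, some edge would leave it by connectedness; adding this edge and
    its far end gives a larger subtree. *)
Lemma maximal_subtree_spanning T :
  connected_graph Gamma -> maximal_subtree T ->
  acyclic T /\ forall v w, exists s, walk T v s w.
Proof.
move=> conn [W [Wn0 TW Wconn acyT] Tmax]; split=> // v w.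
suff WV u : u \in W by apply: Wconn.
apply/negPn/negP => uW; have /finset.set0Pn [v0 v0W] := Wn0.
have [f fW fNW] : exists2 f, src f \in W & tgt f \notin W.
  have [s] := conn v0 u; elim: s v0 v0W => [|f s IHs] v0 v0W.
    by move=> /eqP vu; rewrite -vu v0W in uW.
  rewrite walk_cons => /and3P[_ /eqP fv0 us].
  by case: (boolP (tgt f \in W)) => [/IHs/(_ us)//|]; exists f; rewrite // fv0.
have fT : f.1 \notin T.
  by apply: contra fNW => /TW; apply.
have leaf f' : f'.1 \in (f.1 |: T)%SET -> src f' = tgt f -> f'.1 = f.1.
  by case/setU1P => // /(TW _ f'.2) + f'f; rewrite -/(src f') f'f (negPf fNW).
have loopN : src f != tgt f by apply: contraNneq fNW => <-.
have [] := Tmax (tgt f |: W)%SET (f.1 |: T)%SET.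
- split.
  + by apply/finset.set0Pn; exists (tgt f); rewrite finset.setU11.
  + move=> e eps /setU1P[->|/TW eW]; rewrite in_setU1 ?eW ?orbT //.
    case: (eqVneq eps f.2) => [->|]; first by rewrite fW orbT.
    move=> epsN; have -> : eps = ~~ f.2 by case: eps (f.2) epsN => [] [].
    by rewrite eqxx.
  + have to_f u1 : u1 \in (tgt f |: W)%SET ->
        exists s, walk (f.1 |: T)%SET u1 s (tgt f).
      case/setU1P=> [->|u1W]; first by exists [::] => /=.
      have [s sw] := Wconn _ _ u1W fW; exists (s ++ [:: f]).
      apply/walk_cat; exists (src f); split; last first.
        by rewrite walk_cons finset.setU11 eqxx /=.
      by apply: walk_sub sw; rewrite finset.subsetUr.
    move=> u1 u2 /to_f[s1 s1w] /to_f[s2 /walk_rev s2w].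
    by exists (s1 ++ rev_walk s2); apply/walk_cat; exists (tgt f).
  (* A simple closed walk that avoids [f] lies in [T]. One that uses [f] does so once; the rest of
     it avoids [f], so it cannot move away from the leaf [tgt f], and [f] would be a loop. *)
  + move=> u1 s sw us; case: (boolP (f.1 \in [seq f0.1 | f0 <- s])); last first.
      have avoid u2 : f.1 \notin [seq f0.1 | f0 <- s] ->
          walk (f.1 |: T)%SET u1 s u2 -> walk T u1 s u2.
        elim: s u1 {sw us} => [//|f0 s IHs] u1.
        rewrite [map _ _]/= inE negb_or => /andP[f0f fs].
        rewrite !walk_cons in_setU1 eq_sym (negPf f0f) /= => /and3P[-> -> sw].
        exact: IHs.
      by move=> fs; apply: (acyT u1 s) => //; apply: avoid.
    case/mapP=> f' f's ff'; case/path.splitP: f's us sw => s1 s2.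
    rewrite map_cat map_rcons cat_rcons uniq_catC /= mem_cat negb_or -ff'.
    case/andP=> /andP[fs2 fs1] _.
    have fw : f' = f \/ f' = bar f.
      case: f' f ff' {leaf fW fNW fT loopN fs1 fs2} => [e b] [e' b'] /= ->.
      by case: b b' => [] []; [left|right|right|left].
    rewrite -cats1 -catA => /walk_cat[u2 [s1w]].
    rewrite cat1s walk_cons => /and3P[_ /eqP f'u2 s2w].
    have wl := walk_leaf leaf.
    have rl s0 : f.1 \notin [seq f0.1 | f0 <- rev_walk s0] =
        (f.1 \notin [seq f0.1 | f0 <- s0]).
      by rewrite /rev_walk map_rev mem_rev -map_comp.
    have s1r := walk_rev s1w; have s2r := walk_rev s2w.
    case: fw => f'E; subst f'.
      have [_ u1f] := wl _ _ _ s2w fs2 erefl.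
      have [_ u2f] := wl _ _ _ s1w fs1 u1f.
      by move: loopN; rewrite -u2f f'u2 eqxx.
    rewrite -rl in fs1; have [_ u1f] := wl _ _ _ s1r fs1 (esym f'u2).
    rewrite -rl in fs2; have [_ u2f] := wl _ _ _ s2r fs2 u1f.
    by move: loopN; rewrite -[src f]tgt_bar u2f eqxx.
- exact: finset.subsetUr.
- exact: finset.subsetUr.
by move=> _ TE; move: fT; rewrite -TE finset.setU11.
Qed.

Section WalkProduct.
Variables (Q : groupType) (B : E -> Q).

Definition stepg f : Q := if f.2 then B f.1 else (B f.1)^-1.

Lemma stepg_bar f : stepg (bar f) = (stepg f)^-1.
Proof. by case: f => e [] //=; rewrite /stepg /= invgK. Qed.

Definition walk_prod s : Q := foldr (fun f x => stepg f * x) 1 s.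

Lemma walk_prod_cat s1 s2 : walk_prod (s1 ++ s2) = walk_prod s1 * walk_prod s2.
Proof. by elim: s1 => [|f s1 IHs] /=; rewrite ?mul1g // IHs mulgA. Qed.

Lemma walk_prod_rev s : walk_prod (rev_walk s) = (walk_prod s)^-1.
Proof.
elim: s => [|f s IHs]; first by rewrite /= invg1.
rewrite /rev_walk /= rev_cons -cats1 walk_prod_cat IHs /= mulg1 stepg_bar.
by rewrite invgM.
Qed.

(** The repetition is chosen innermost: no edge occurs twice before [f'] in the segment starting at
    [f], so acyclicity applies to it. *)
Lemma nonuniq_split (t : seq oedge) : ~~ uniq [seq f.1 | f <- t] ->
  exists t1 f t2 f' t3, [/\ t = t1 ++ f :: t2 ++ f' :: t3, f.1 = f'.1
    & uniq [seq g.1 | g <- f :: t2]].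
Proof.
elim: t => [//|f t IHt] /=; rewrite negb_and negbK.
case: (boolP (uniq [seq f0.1 | f0 <- t])) => [ut|/IHt IH _].
  rewrite orbF => /mapP[f' f't ff']; case/path.splitP: f't ut => t2 t3.
  rewrite map_cat map_rcons cat_uniq rcons_uniq -ff' => /andP[/andP[ft2 ut2] _].
  by exists [::], f, t2, f', t3; rewrite /= cat_rcons ft2 ut2.
have [t1 [f1 [t2 [f' [t3 [-> ff u]]]]]] := IH.
by exists (f :: t1), f1, t2, f', t3.
Qed.

(** Induction on the length. At an innermost repetition, crossing the edge twice in the same
    direction would give a simple cycle; if the directions are opposite, the walk in between is
    closed and simple, hence empty, and the two factors cancel. *)
Lemma walk_prod_closed T v s : acyclic T -> walk T v s v -> walk_prod s = 1.
Proof.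
move=> acy; have [n] := ubnP (size s); elim: n s v => // n IHn s v sn sw.
case: (boolP (uniq [seq f.1 | f <- s])) => [/(acy _ _ sw)-> //|].
case/nonuniq_split => t1 [f [t2 [f' [t3 [sE ff' u]]]]]; move: sw sn.
rewrite {}sE => /walk_cat[u1 [t1w]]; rewrite walk_cons.
case/and3P=> fT /eqP fu1 /walk_cat[u2 [t2w]]; rewrite walk_cons.
case/and3P=> f'T /eqP f'u2 t3w sn.
have [f'E|f'E] : f' = f \/ f' = bar f.
  case: f' f ff' {u t1w fT f'T fu1 t2w f'u2 t3w sn} => [e b] [e' b'] /= ->.
  by case: b b' => [] []; [left|right|right|left].
  have /acy/(_ u) : walk T (src f) (f :: t2) (src f).
    by rewrite walk_cons fT eqxx /= -{2}f'E f'u2.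
  by [].
subst f'; have t20 : t2 = [::].
  by apply: (acy (tgt f)); [rewrite -{2}src_bar f'u2 | case/andP: u].
subst t2; rewrite walk_prod_cat /= stepg_bar mulKVg -walk_prod_cat.
apply: (IHn _ v); first by move: sn; rewrite !size_cat /=; lia.
by apply/walk_cat; exists u1; split=> //; rewrite -fu1 -tgt_bar.
Qed.

(** [tau v] is the product along a tree walk from a base vertex to [v]. It does not depend on the
    walk, as closed tree walks have product 1. *)
Lemma tree_potential T : nonempty_graph Gamma -> acyclic T ->
  (forall v w, exists s, walk T v s w) ->
  exists tau : V -> Q,
    (forall f, f.1 \in T -> tau (src f) * stepg f = tau (tgt f)) /\
    forall K, is_subgroup K -> (forall e, K (B e)) -> forall v, K (tau v).
Proof.
move=> /card_gt0P[v0 _] acy conn.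
have /choice [sw swP] := conn v0; exists (walk_prod \o sw); split=> [f fT|] /=.
  apply: (@mulIg _ (walk_prod (rev_walk (sw (tgt f))))).
  rewrite walk_prod_rev mulgV -walk_prod_rev.
  rewrite -[stepg f]mulg1 -[stepg f * 1]/(walk_prod [:: f]) -!walk_prod_cat.
  rewrite -catA; apply: (@walk_prod_closed T v0) => //.
  apply/walk_cat; exists (src f); split=> //; apply/walk_cat; exists (tgt f).
  by rewrite walk_cons fT !eqxx /=; split=> //; apply: walk_rev.
move=> K Ksub KB v; elim: (sw v) => [|[e b] s IHs] /=; first exact: subg1.
by apply: (subgM Ksub) => //; case: b; [|apply: (subgV Ksub)]; apply: KB.
Qed.

End WalkProduct.
End OrientedEdges.

(** * Homomorphisms from representations of the graph *)

Lemma evalw_letterpow (X : choiceType) (H : groupType) (f : X -> H) x k :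
  evalw f (letterpow x k) = zexpg (f x) k.
Proof.
have nseqE b n : evalw f (nseq n (x, b)) = (if b then f x else (f x)^-1) ^+ n.
  by elim: n => // n IHn; rewrite expgS -IHn.
by case: k => n /=; [exact: (nseqE true) | rewrite -expVgn; exact: (nseqE false n.+1)].
Qed.

Section Representations.
Variables (Gamma : multigraph) (L : labeled_graph Gamma).
Local Notation V := (vertex Gamma).
Local Notation E := (edge Gamma).
Variables (Q : groupType) (A : V -> Q) (B : E -> Q).

(** These are the relations with a letter for every edge, tree edges included, whose letters may be
    non-trivial. *)
Definition gbs_rep := forall e,
  zexpg (A (endpt e true)) (L e true) * B e
  = B e * zexpg (A (endpt e false)) (L e false).

Lemma stepg_rel (f : oedge Gamma) k : gbs_rep ->
  zexpg (A (src f)) (lab L f * k)%R * stepg B f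
  = stepg B f * zexpg (A (tgt f)) (lab L (bar f) * k)%R.
Proof.
move=> rel; have relJ (x y z : Q) : x * y = y * z ->
    zexpg x k * y = y * zexpg z k.
  by move=> xyz; rewrite [LHS]conjgC zexpgJ conjgE xyz mulKg.
case: f => e [] /=; rewrite /src /tgt /lab /stepg /= !zexpgM; apply: relJ.
  exact: rel.
by apply: (@mulgI _ (B e)); rewrite mulVKg mulgA -rel mulgK.
Qed.

End Representations.

Section GBSGroup.
Variables (Gamma : multigraph) (L : labeled_graph Gamma).
Variable T : {set edge Gamma}.
Local Notation V := (vertex Gamma).
Local Notation E := (edge Gamma).
Local Notation G := (gbs L T).
Local Notation rel := (@gbs_rel Gamma L T).

Definition vgen (v : V) : G := presgen rel (inl v).
(** The value 1 on tree edges gives the relations the same form for all edges. *)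
Definition egen (e : E) : G :=
  if insub e is Some u then presgen rel (inr u) else 1.
Definition estep (f : oedge Gamma) : G := stepg egen f.

Lemma egen_tree e : e \in T -> egen e = 1.
Proof. by move=> eT; rewrite /egen insubF ?eT. Qed.

Lemma estep_tree f : f.1 \in T -> estep f = 1.
Proof. by move=> fT; rewrite /estep /stepg egen_tree ?invg1 ?if_same. Qed.

Lemma egen_val (u : {e : E | e \notin T}) :
  egen (val u) = presgen rel (inr u).
Proof. by rewrite /egen valK. Qed.

Lemma estep_bar f : estep (bar f) = (estep f)^-1.
Proof. exact: stepg_bar. Qed.

Lemma presentedM u v : classw rel (u ++ v)
  = (classw rel u : G) * classw rel v.
Proof. exact/esym/pres_mulE. Qed.

Lemma presentedV x :
  classw rel [:: (x, false)] = (presgen rel x : G)^-1.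
Proof. exact/esym/pres_invE. Qed.

Lemma gbs_repP : gbs_rep L vgen egen.
Proof.
move=> e; case: (boolP (e \in T)) => eT.
  rewrite egen_tree // mulg1 mul1g.
  have := presented_rel (gbs_rel_tree L eT).
  by rewrite /vertexpow !classw_letterpow.
have := presented_rel (gbs_rel_stable L (Sub e eT)).
rewrite !presentedM presentedV -[classw _ [:: (_, true)]]/(presgen _ _ : G).
rewrite /vertexpow !classw_letterpow -egen_val SubK => relE.
by rewrite -[RHS]/(egen e * (zexpg (vgen _) _)) -relE mulVKg.
Qed.

Lemma estep_rel f k : zexpg (vgen (src f)) (lab L f * k)%R * estep f
  = estep f * zexpg (vgen (tgt f)) (lab L (bar f) * k)%R.
Proof. exact/stepg_rel/gbs_repP. Qed.

Lemma gbs_ind (P : G -> Prop) : P 1 ->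
  (forall v i x, P x -> P (zexpg (vgen v) i * x)) ->
  (forall f x, P x -> P (estep f * x)) -> forall x, P x.
Proof.
move=> P1 Pv Pe x; rewrite -[x]reprwK.
elim: (reprw x) => [//|[y b] w IHw]; rewrite -cat1s presentedM.
have -> : classw rel [:: (y, b)]
    = if b then presgen rel y else (presgen rel y : G)^-1.
  by case: b => //; rewrite presentedV.
case: y => [v|u].
  by case: b; [have := Pv v 1%R _ IHw | have := Pv v (-1)%R _ IHw].
by have := Pe (val u, b) _ IHw; rewrite /estep /stepg egen_val.
Qed.

Hypothesis Gamma_nonempty : nonempty_graph Gamma.
Hypothesis Gamma_connected : connected_graph Gamma.
Hypothesis T_maximal : maximal_subtree T.

(* Sending [vgen v] to [tau v * A v / tau v] turns a representation in which
   the edges of T need not act trivially into a homomorphism. *)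
Lemma gbs_rep_hom (Q : groupType) (A : V -> Q) (B : E -> Q) : gbs_rep L A B ->
  exists (tau : V -> Q) (phi : {multiplicative G -> Q}),
    [/\ forall v, phi (vgen v) = A v ^ (tau v)^-1,
      forall f, phi (estep f) = tau (src f) * stepg B f / tau (tgt f)
    & forall K, is_subgroup K -> (forall v, K (A v)) -> (forall e, K (B e)) ->
        forall x, K (phi x)].
Proof.
move=> repAB; have [acy conn] := maximal_subtree_spanning Gamma_connected T_maximal.
have [tau [tauT tauK]] := tree_potential B Gamma_nonempty acy conn; exists tau.
pose F (x : gbs_gen T) : Q := match x with
  | inl v => A v ^ (tau v)^-1
  | inr u => tau (endpt (val u) true) * B (val u) / tau (endpt (val u) false)
  end.
have Fpow e b : evalw F (vertexpow L T e b)
    = zexpg (A (endpt e b)) (L e b) ^ (tau (endpt e b))^-1.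
  by rewrite /vertexpow evalw_letterpow zexpgJ.
have [u v uv|phi [phiE _]] := @presented_lift _ rel Q F.
  case: {u v} uv => [e eT|u].
    rewrite !Fpow -(tauT (e, true)) //= /stepg /= -/(src (e, true)) /src /=.
    by rewrite invgM conjgM; congr (_ ^ _); rewrite conjgE invgK mulgA -repAB mulgK.
  rewrite !evalw_cat !Fpow /= !mulg1 !conjgE !invgK; set e := val u.
  rewrite !invgM !invgK !mulgA mulgVK; congr (_ / _).
  by rewrite -!mulgA repAB !mulKg.
exists phi; have phit e : phi (egen e)
    = tau (endpt e true) * B e / tau (endpt e false).
  case: (boolP (e \in T)) => eT.
    rewrite egen_tree // hom1; have := tauT (e, true) eT.
    by rewrite /stepg /src /tgt /= => ->; rewrite mulgV.
  by have := phiE (inr (Sub e eT)); rewrite -egen_val.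
have phiG v : phi (vgen v) = A v ^ (tau v)^-1 by exact: phiE.
have phiS f : phi (estep f) = tau (src f) * stepg B f / tau (tgt f).
  by case: f => e []; rewrite /estep /stepg /= ?homV phit ?invgM ?invgK ?mulgA.
split=> // K Ksub KA KB; have Ktau := tauK _ Ksub KB.
have KV x : K x -> K x^-1 by apply: subgV.
have KM x y : K x -> K y -> K (x * y) by apply: subgM.
apply: gbs_ind.
- by rewrite hom1; apply: subg1.
- move=> v i x Kx; rewrite gmulfM homZ phiG conjgE invgK.
  by apply/(KM) => //; apply/(subgZ Ksub)/(KM) => //; apply/(KM)/(KV).
- move=> f x Kx; rewrite gmulfM phiS; apply/(KM) => //; apply/(KM)/(KV) => //.
  by apply/(KM) => //; rewrite /stepg; case: f.2; [|apply: KV]; apply: KB.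
Qed.

End GBSGroup.

(** * Reduced paths *)

Section ReducedPaths.
Variables (Gamma : multigraph) (L : labeled_graph Gamma).
Local Notation V := (vertex Gamma).
Local Notation E := (edge Gamma).
Local Notation oedge := (oedge Gamma).

(** The excluded case is a pinch: a return along [f] after a power of the vertex generator that lies
    in the edge group. *)
Definition turn (f f' : oedge) (i : int) :=
  (tgt f == src f') && ~~ ((f' == bar f) && (lab L f' %| i)%Z).

Definition rstep (a b : int * oedge) := turn a.2 b.2 b.1.

(* The list [:: (i1, f1); ...; (in, fn)] stands for the path
   g^i1 f1 g^i2 f2 ... g^in fn, where each g is the vertex generator at the
   origin of the next oriented edge. *)
Definition path_val (Q : groupType) (A : V -> Q) (B : E -> Q) s : Q :=
  foldr (fun a x => zexpg (A (src a.2)) a.1 * (stepg B a.2 * x)) 1 s.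

Lemma path_val_cat (Q : groupType) (A : V -> Q) (B : E -> Q) s1 s2 :
  path_val A B (s1 ++ s2) = path_val A B s1 * path_val A B s2.
Proof. by elim: s1 => [|a s1 IHs] /=; rewrite ?mul1g // IHs !mulgA. Qed.

Lemma turn_bar f f' i : turn f f' i -> turn (bar f') (bar f) (- i).
Proof.
case/andP=> /eqP ff' nb; rewrite /turn tgt_bar src_bar ff' eqxx /=.
apply: contra nb => /andP[]; rewrite barK dvdz_opp => /eqP <- ->.
by rewrite eqxx.
Qed.

Section Normal.
Variable T : {set E}.
Local Notation G := (gbs L T).
Local Notation g := (@vgen _ L T).
Local Notation ed := (@estep _ L T).

(** The first exponent is 0, so that [x] starts and ends with an edge; outer powers of vertex
    generators are added where needed. *)
Definition red (f f' : oedge) (x : G) := exists s,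
  [/\ path rstep (0%R, f) s, (last (0%R, f) s).2 = f'
    & x = path_val g (egen L T) ((0%R, f) :: s)].

Lemma red1 f : red f f (ed f).
Proof. by exists [::]; split=> //=; rewrite mul1g mulg1. Qed.

Lemma redM f1 f2 f3 f4 x y i : red f1 f2 x -> red f3 f4 y -> turn f2 f3 i ->
  red f1 f4 (x * zexpg (g (src f3)) i * y).
Proof.
move=> [s [sp sl ->]] [s' [sp' sl' ->]] t23; exists (s ++ (i, f3) :: s').
rewrite cat_path sp last_cat /= /rstep /= {1}sl t23; split=> //.
- by case: s' sp' sl' => [|b s'] //=; rewrite /rstep.
- by case: s' sp' sl'.
by rewrite path_val_cat /= !mul1g !mulgA.
Qed.

Lemma redM0 f1 f2 f3 f4 x y : red f1 f2 x -> red f3 f4 y -> turn f2 f3 0 ->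
  red f1 f4 (x * y).
Proof. by move=> rx ry /(redM rx ry); rewrite mulg1. Qed.

Lemma redV f f' x : red f f' x -> red (bar f') (bar f) x^-1.
Proof.
case=> s [sp sl ->] {x}; elim: s f sp sl => [|[i f2] s IHs] f /=.
  by move=> _ <-; rewrite mul1g mulg1 -/(ed f) -estep_bar; apply: red1.
case/andP=> t2 sp sl; have sp2 : path rstep (0%R, f2) s.
  by case: s sp {IHs sl} => [|b s] //=; rewrite /rstep.
have sl2 : (last (0%R, f2) s).2 = f' by case: s sl {sp IHs sp2}.
have := IHs _ sp2 sl2 => /redM/(_ (red1 (bar f)) (turn_bar t2)).
rewrite src_bar estep_bar; case/andP: t2 => /eqP -> _.
by rewrite /= !mul1g !invgM zexpgN.
Qed.

Lemma red_cons f f' x : red f f' x -> (f' = f /\ x = ed f) \/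
  exists i f2 y, [/\ red f2 f' y, turn f f2 i & x = ed f * zexpg (g (src f2)) i * y].
Proof.
case=> -[|[i f2] s] [/= sp sl ->]; [left|right].
  by rewrite -sl mul1g mulg1.
case/andP: sp => t2 sp; exists i, f2, (path_val g (egen L T) ((0%R, f2) :: s)).
split=> //; last by rewrite /= !mul1g !mulgA.
exists s; split=> //; first by case: s sp {sl} => [|b s] //=; rewrite /rstep.
by case: s sl {sp}.
Qed.

Definition normal_form (v w : V) (x : G) :=
  (v = w /\ exists i, x = zexpg (g v) i) \/
  exists f f' y i j, [/\ red f f' y, src f = v, tgt f' = w
    & x = zexpg (g v) i * y * zexpg (g w) j].

Lemma normal_form_vgen v w i x :
  normal_form v w x -> normal_form v w (zexpg (g v) i * x).
Proof.
case=> [[vw [j ->]]|[f [f' [y [k [j [ry fv fw ->]]]]]]]; [left|right].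
  by split=> //; exists (i + j)%R; rewrite zexpgD.
by exists f, f', y, (i + k)%R, j; rewrite zexpgD !mulgA.
Qed.

(** Either the new edge makes a reduced turn, or there is a pinch; in the latter case the edge
    relation replaces the two edges by a power of the vertex generator and the path becomes
    shorter. *)
Lemma normal_form_estep f w x :
  normal_form (tgt f) w x -> normal_form (src f) w (ed f * x).
Proof.
case=> [[<- [j ->]]|[f2 [f' [y [i [j [ry fv fw ->]]]]]]].
  right; exists f, f, (ed f), 0%R, j; split=> //; first exact: red1.
  by rewrite mul1g.
case: (boolP (turn f f2 i)) => [t2|].
  right; exists f, f', (ed f * zexpg (g (tgt f)) i * y), 0%R, j; split=> //.
    by rewrite -fv; apply: redM t2 => //; apply: red1.
  by rewrite mul1g !mulgA.
rewrite /turn fv eqxx negbK => /andP[/eqP f2E /dvdzP[k iE]]; subst f2.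
have ff : ed f * zexpg (g (tgt f)) i * ed (bar f) = zexpg (g (src f)) (lab L f * k).
  by rewrite estep_bar iE mulrC -estep_rel mulgK.
case/red_cons: ry => [[f'2 yE]|[i' [f3 [z [rz t3 yE]]]]].
  left; rewrite -fw f'2 tgt_bar; split=> //.
  by exists (lab L f * k + j)%R; rewrite yE !mulgA ff zexpgD.
right; exists f3, f', z, (lab L f * k + i')%R, j.
have f3E : src f3 = src f by case/andP: t3 => /eqP <- _; rewrite tgt_bar.
by split=> //; rewrite yE !mulgA ff zexpgD f3E.
Qed.

Hypothesis T_spanning : forall v w, exists s, walk T v s w.

Lemma normal_form_tree v v' w x : normal_form v w x -> normal_form v' w x.
Proof.
have [s] := T_spanning v' v; elim: s v' => [|f s IHs] v'; first by move=> /eqP->.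
rewrite walk_cons => /and3P[fT /eqP <- sw] /(IHs _ sw)/normal_form_estep.
by rewrite estep_tree // mul1g.
Qed.

(** Tree edges represent 1, so the origin of a path can be moved along the tree to wherever the next
    generator has to be prepended. *)
Lemma normal_formP v w x : normal_form v w x.
Proof.
apply: (normal_form_tree (v := w)); move: x; apply: gbs_ind.
- by left; split=> //; exists 0%R.
- move=> u i x /(normal_form_tree u)/(normal_form_vgen i).
  exact: normal_form_tree.
move=> f x /(normal_form_tree (tgt f))/normal_form_estep.
exact: normal_form_tree.
Qed.

End Normal.
End ReducedPaths.

(** * Magnus representations *)

(* Magnus' argument, carried out over an arbitrary representation of the graph
   of groups: [l] lists the edges of a path together with the states in which
   they are crossed, and crossing the edge [e] in the state [w] adds to the
   i-th coordinate of a vector the preceding one when the i-th letter of [l]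
   matches [(e, w)].  Following the path itself moves the first basis vector
   along all the coordinates. *)
Section Magnus.
Variables (Gamma : multigraph) (L : labeled_graph Gamma).
Local Notation V := (vertex Gamma).
Local Notation E := (edge Gamma).
Local Notation oedge := (oedge Gamma).
Variables (S : Type) (A : V -> sym S) (B : E -> sym S) (m : E -> S -> S -> bool).
Variable R : nzRingType.

Definition hits (a : E * S) (e : E) (w : S) := (a.1 == e) && m e w a.2.

(** The state is recorded at e(1): before the crossing in the positive direction, after it in the
    negative one. *)
Definition letter (f : oedge) (w : S) : E * S :=
  (f.1, if f.2 then w else (B f.1)^-1 w).

(** [match_shift] makes the shears compatible with the edge relations. [match_turn] says that a
    crossing never matches two consecutive letters of a reduced path, which makes the shears
    invertible. *)
Record matching : Prop := Matching {
  match_rep : gbs_rep L A B;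
  match_refl : forall e w, m e w w;
  match_shift : forall e w w',
    m e (zexpg (A (endpt e true)) (L e true) w) w' = m e w w';
  match_turn : forall f f' i w, turn L f f' i -> forall e w',
    ~~ (hits (letter f w) e w' &&
        hits (letter f' (zexpg (A (src f')) i (stepg B f w))) e w')
}.

Section Vectors.
Variable l : seq (E * S).

(** Coordinate [i.+1] is governed by the letter of index [i]; coordinate 0 never changes. *)
Definition hit (i : nat) e w :=
  if i is i'.+1 then (if ohead (drop i' l) is Some a then hits a e w else false)
  else false.

Definition separated := forall i e w, ~~ (hit i e w && hit i.+1 e w).

Local Notation Y := {ffun 'I_(size l).+1 -> R}.

Definition shear (c : R) e w (y : Y) : Y :=
  [ffun i => (y i + (if hit i e w then c * y (inord i.-1) else 0))%R].

(** By separation, the coordinate [i.-1] that is used to change coordinate [i] is itself unchanged,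
    so the same multiple is taken back. *)
Lemma shearK c e w : separated -> cancel (shear c e w) (shear (- c)%R e w).
Proof.
move=> sep y; apply/ffunP => i; rewrite !ffunE.
case: ifP => [h|]; last by rewrite !addr0.
case: i h => [[|i] ilt] //= h; rewrite inordK ?(ltnW ilt) //.
case: ifP => [h'|_]; first by have := sep i e w; rewrite h' /= h.
by rewrite addr0 mulNr addrK.
Qed.

Definition extA v : sym (S * Y) :=
  @Sym (S * Y)%type (fun p => (A v p.1, p.2)) (fun p => ((A v)^-1 p.1, p.2))
    (fun p => let: (w, y) := p in congr1 (pair^~ y) (symVK (A v) w))
    (fun p => let: (w, y) := p in congr1 (pair^~ y) (symKV (A v) w)).

Lemma extA_zexpg v i p : zexpg (extA v) i p = (zexpg (A v) i p.1, p.2).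
Proof.
have extX n q : (extA v ^+ n) q = ((A v ^+ n) q.1, q.2).
  by elim: n => [|n IHn]; [case: q | rewrite !expgSr !symM IHn].
case: i => n; first exact: extX.
apply: (can_inj (symVK (extA v ^+ n.+1))).
by rewrite symKV extX /= symKV; case: p.
Qed.

Hypothesis sepl : separated.

Definition extB_fun e (p : S * Y) := (B e p.1, shear 1%R e p.1 p.2).
Definition extB_inv e (p : S * Y) :=
  let w := (B e)^-1 p.1 in (w, shear (- 1)%R e w p.2).

Lemma extB_funK e : cancel (extB_fun e) (extB_inv e).
Proof. by case=> w y; rewrite /extB_fun /extB_inv /= sym_funK shearK. Qed.

Lemma extB_invK e : cancel (extB_inv e) (extB_fun e).
Proof.
case=> w y; rewrite /extB_fun /extB_inv /= sym_invK.
by rewrite -{1}[1%R]opprK shearK.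
Qed.

Definition extB e : sym (S * Y) := Sym (extB_funK e) (extB_invK e).

Lemma ext_rep : matching -> gbs_rep L extA extB.
Proof.
move=> mat e; apply: sym_eq => -[w y]; rewrite !symM extA_zexpg.
rewrite /= /extB_fun extA_zexpg /= -!symM match_rep //; congr pair.
apply/ffunP => i; rewrite !ffunE; congr (_ + _)%R.
case: (val i) => //= j; case: (ohead _) => //= a.
by rewrite /hits match_shift.
Qed.

Fixpoint letters (w : S) (s : seq (int * oedge)) : seq (E * S) :=
  if s is a :: s' then
    let w1 := zexpg (A (src a.2)) a.1 w in
    letter a.2 w1 :: letters (stepg B a.2 w1) s'
  else [::].

Definition top_at (j : nat) (y : Y) :=
  y (inord j) != 0%R /\ forall i : 'I_(size l).+1, (j < i)%N -> y i = 0%R.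

(** All coordinates above [j] vanish, so the new coordinate [j.+1] is plus or minus coordinate [j],
    and nothing is carried further. *)
Lemma top_at_shear c j e w y : (c == 1)%R || (c == -1)%R ->
  (j < size l)%N -> hit j.+1 e w -> top_at j y -> top_at j.+1 (shear c e w y).
Proof.
move=> c1 jl h [yj y0]; split=> [|i ji]; rewrite ffunE.
  rewrite inordK // h /= y0 ?inordK // add0r.
  by case/orP: c1 => /eqP->; rewrite ?mul1r ?mulN1r ?oppr_eq0.
rewrite y0 1?ltnW // add0r; case: ifP => // _.
rewrite y0 ?mulr0 // inordK; first by case: (val i) ji.
by case: i {ji} => [[|i]] //= /ltnW.
Qed.

Lemma ext_path s w j y : matching -> drop j l = letters w s ->
  top_at j y -> top_at (j + size s) (path_val extA extB s (w, y)).2.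
Proof.
move=> mat; elim: s w j y => [|a s IHs] w j y; first by rewrite addn0.
rewrite [letters _ _]/=; set w1 := (zexpg (A _) _ w) => dl yj.
have jl : (j < size l)%N.
  by rewrite ltnNge; apply/negP => /drop_oversize; rewrite dl.
have dl' : drop j.+1 l = letters (stepg B a.2 w1) s.
  by rewrite -add1n -drop_drop dl drop1.
rewrite [path_val _ _ _]/= [size _]/= addnS -addSn !symM extA_zexpg -/w1.
have -> : stepg extB a.2 (w1, y) = (stepg B a.2 w1,
    shear (if a.2.2 then 1 else -1)%R a.2.1 (letter a.2 w1).2 y).
  by rewrite /stepg /letter; case: a.2.2.
apply: IHs => //; apply: top_at_shear => //; first by case: ifP; rewrite eqxx ?orbT.
by rewrite /hit dl /= /hits eqxx match_refl.
Qed.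

End Vectors.

Lemma separated_letters s w : matching -> sorted (rstep L) s ->
  separated (letters w s).
Proof.
move=> mat; elim: s w => [|a [|b s] IHs] w.
- by move=> _ [|[|i]] e w'.
- by move=> _ [|[|[|i]]] e w'; rewrite /hit //= andbF.
move=> /= /andP[ab bs] [|[|i]] e w' //.
  exact: (match_turn mat (zexpg (A (src a.2)) a.1 w) ab e w').
by have := IHs (stepg B a.2 (zexpg (A (src a.2)) a.1 w)) bs i.+1 e w'.
Qed.

Lemma magnus s (w : S) : matching -> sorted (rstep L) s -> s != [::] ->
  exists l (sepl : separated l), forall v v' i j,
    zexpg (extA l v) i * path_val (extA l) (extB sepl) s * zexpg (extA l v') j != 1.
Proof.
move=> mat ss s0; have sepl := separated_letters w mat ss.
exists (letters w s), sepl => v v' i j; set l := letters w s in sepl *.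
have sl : size l = size s by rewrite /l; elim: (s) (w) => //= a s' IHs w'; rewrite IHs.
pose y0 : {ffun 'I_(size l).+1 -> R} := [ffun i => if i == ord0 then 1 else 0]%R.
have top0 : top_at 0 y0.
  split=> [|k k0]; rewrite ffunE; last by rewrite -val_eqE /= gtn_eqF.
  by rewrite -val_eqE /= inordK // oner_eq0.
have [yn _] := ext_path sepl mat (drop0 l : drop 0 l = letters w s) top0.
 (* The start is shifted by [- i], so that the path is entered in the state [w]. The last coordinate
    of the image is non-zero, whereas that of [y0] is 0. *)
 apply/eqP => /(congr1 (fun p : sym _ => (p (zexpg (A v) (- i) w, y0)).2)).
rewrite sym1 !symM !extA_zexpg /= -symM zexpgN mulVg sym1 => yE.
move: yn; rewrite yE ffunE -val_eqE /= add0n inordK ?sl //.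
by case: (s) s0 => //= _ s' _; rewrite eqxx.
Qed.

End Magnus.

(** * Britton's lemma *)

Section Detection.
Variables (Gamma : multigraph) (L : labeled_graph Gamma).
Variable T : {set edge Gamma}.
Local Notation V := (vertex Gamma).
Local Notation E := (edge Gamma).
Local Notation G := (gbs L T).
Local Notation g := (@vgen _ L T).
Hypothesis Gamma_nonempty : nonempty_graph Gamma.
Hypothesis Gamma_connected : connected_graph Gamma.
Hypothesis T_maximal : maximal_subtree T.

Lemma rep_hom_path (Q : groupType) (A : V -> Q) (B : E -> Q) (tau : V -> Q)
    (phi : {multiplicative G -> Q}) :
  (forall v, phi (g v) = A v ^ (tau v)^-1) ->
  (forall f, phi (estep L T f) = tau (src f) * stepg B f / tau (tgt f)) ->
  forall a s, path (rstep L) a s -> phi (path_val g (egen L T) (a :: s))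
    = tau (src a.2) * path_val A B (a :: s) / tau (tgt (last a s).2).
Proof.
move=> phiA phiB a s; elim: s a => [|b s IHs] a.
  move=> _ /=; rewrite !mulg1 gmulfM homZ phiA phiB -zexpgJ conjgE invgK.
  by rewrite !mulgA mulgVK.
case/andP=> /andP[/eqP ab _] bs.
rewrite -[path_val g _ _]/(zexpg (g (src a.2)) a.1 *
  (estep L T a.2 * path_val g (egen L T) (b :: s))).
rewrite -[path_val A B _]/(zexpg (A (src a.2)) a.1 *
  (stepg B a.2 * path_val A B (b :: s))).
rewrite gmulfM [phi (_ * _)]gmulfM (IHs _ bs) homZ phiA phiB -zexpgJ conjgE invgK ab.
by rewrite !mulgA !mulgVK.
Qed.

Lemma red_detect (S : Type) (A : V -> sym S) (B : E -> sym S) m (R : nzRingType)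
    (w : S) f f' x : matching L A B m -> red f f' x -> src f = tgt f' ->
  exists l (sepl : separated m l) (phi : {multiplicative G -> sym _}),
    (forall i j, phi (zexpg (g (src f)) i * x * zexpg (g (src f)) j) != 1) /\
    (forall K, is_subgroup K -> (forall v, K (extA A R l v)) ->
       (forall e, K (extB B R sepl e)) -> forall y, K (phi y)).
Proof.
move=> mat [s [sp sl ->]] ff'.
have [l [sepl ext_neq]] := @magnus _ _ _ A B m R ((0%R, f) :: s) w mat sp isT.
exists l, sepl.
have [tau [phi [phiA phiB phiK]]] := gbs_rep_hom Gamma_nonempty Gamma_connected
  T_maximal (ext_rep R sepl mat).
exists phi; split=> // i j.
rewrite 2!gmulfM (rep_hom_path phiA phiB sp) !homZ phiA -!zexpgJ sl -ff' /=.
have := ext_neq (src f) (src f) i j.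
rewrite -(conjg_eq1 _ (tau (src f))^-1) !conjgE invgK !mulgA.
by rewrite !mulgVK.
Qed.

(** In a state (a, k, x), every vertex generator adds a to x; an edge multiplies a by the ratio of
    its labels and adds 1 to the counter k. *)
Definition scale_state : Type := ({a : rat | a != 0%R} * rat * rat)%type.

Lemma scale_neq0 e : (((L e true)%:~R / (L e false)%:~R)%R : rat) != 0%R.
Proof. by rewrite mulf_neq0 ?invr_eq0 ?intr_eq0 ?label_neq0. Qed.

Definition rescale (c : rat) (c0 : c != 0%R) (a : {a : rat | a != 0%R}) :
  {a : rat | a != 0%R} := exist _ (val a * c)%R (mulf_neq0 (valP a) c0).

Lemma rescaleK c (c0 : c != 0%R) (c0' : c^-1%R != 0%R) :
  cancel (rescale c0) (rescale c0').
Proof. by move=> a; apply: val_inj; rewrite /= mulfK. Qed.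

Lemma rescaleVK c (c0 : c != 0%R) (c0' : c^-1%R != 0%R) :
  cancel (rescale c0') (rescale c0).
Proof. by move=> a; apply: val_inj; rewrite /= mulfVK. Qed.

Lemma scale_neq0V e : (((L e true)%:~R / (L e false)%:~R)^-1%R : rat) != 0%R.
Proof. by rewrite invr_eq0 scale_neq0. Qed.

Definition scaleA (v : V) : sym scale_state.
Proof.
refine (@Sym scale_state (fun w => (w.1.1, w.1.2, w.2 + val w.1.1)%R)
  (fun w => (w.1.1, w.1.2, w.2 - val w.1.1)%R) _ _).
- by case=> -[a k] x /=; rewrite addrK.
- by case=> -[a k] x /=; rewrite subrK.
Defined.

Definition scaleB (e : E) : sym scale_state.
Proof.
refine (@Sym scale_state (fun w => (rescale (scale_neq0 e) w.1.1, w.1.2 + 1, w.2)%R)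
  (fun w => (rescale (scale_neq0V e) w.1.1, w.1.2 - 1, w.2)%R) _ _).
- by case=> -[a k] x /=; rewrite rescaleK addrK.
- by case=> -[a k] x /=; rewrite rescaleVK subrK.
Defined.

Lemma scaleA_zexpg v i (w : scale_state) :
  zexpg (scaleA v) i w = (w.1.1, w.1.2, w.2 + val w.1.1 * i%:~R)%R.
Proof.
have AX n (u : scale_state) :
    (scaleA v ^+ n) u = (u.1.1, u.1.2, u.2 + val u.1.1 * n%:R)%R.
  elim: n u => [|n IHn] u; first by rewrite mulr0 addr0; case: u => -[].
  by rewrite expgSr symM IHn /= mulrS mulrDr mulr1 -addrA [(val _ + _)%R]addrC.
case: i => n; first exact: AX.
apply: (can_inj (symVK (scaleA v ^+ n.+1))).
rewrite symKV AX /= NegzE mulrNz mulrN -addrA addNr addr0.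
by case: w => -[].
Qed.

(** Two states match when they lie in the same orbit of the edge group. *)
Definition scale_match (e : E) (w w' : scale_state) :=
  [&& w.1.1 == w'.1.1, w.1.2 == w'.1.2 &
      ((w.2 - w'.2) / (val w.1.1 * (L e true)%:~R))%R \is a Num.int].

Lemma scale_matching : matching L scaleA scaleB scale_match.
Proof.
split.
- move=> e; apply: sym_eq => w; rewrite !symM !scaleA_zexpg /=.
  congr (_, _, _); rewrite -mulrA divfK ?intr_eq0 ?label_neq0 //.
- by move=> e w; rewrite /scale_match !eqxx subrr mul0r rpred0.
- move=> e w w'; rewrite scaleA_zexpg /scale_match /=; congr [&& _, _ & _].
  rewrite addrAC mulrDl divff ?rpredDr ?rpred1 //.
  by rewrite mulf_neq0 ?(valP w.1.1) ?intr_eq0 ?label_neq0.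
have dvd_int (n d : int) : d != 0%R -> (n%:~R / d%:~R : rat)%R \is a Num.int ->
    (d %| n)%Z.
  move=> d0 /intrP[z /(canRL (divfK _))]; rewrite intr_eq0 => /(_ d0) /eqP.
  by rewrite -intrM eqr_int => /eqP ->; rewrite dvdz_mull.
have both e (w1 w2 w' : scale_state) : scale_match e w' w1 -> scale_match e w' w2 ->
    [/\ w1.1.1 = w2.1.1, w1.1.2 = w2.1.2
      & ((w2.2 - w1.2) / (val w1.1.1 * (L e true)%:~R))%R \is a Num.int].
  move=> /and3P[/eqP a1 /eqP k1 x1] /and3P[/eqP a2 /eqP k2 x2].
  split; rewrite -?a1 -?k1 //.
  have -> : (w2.2 - w1.2 = (w'.2 - w1.2) - (w'.2 - w2.2))%R by ring.
  by rewrite mulrBl rpredB.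
move=> [e1 b1] [e2 b2] i [[a k] x] t12 e w'; apply/negP => /andP[].
rewrite /hits /letter /= => /andP[/eqP e1E m1] /andP[/eqP e2E m2]; subst e1 e2.
have {m1 m2}[+ +] := both _ _ _ _ m1 m2.
(* Crossings in the same direction differ in the counter. For opposite directions, a match would
   force the label to divide [i], that is, a pinch. *)
case: b1 b2 t12 => [] [] t12; rewrite /stepg /= scaleA_zexpg /=.
- by move=> _ k1; exfalso; lra.
- move=> _ _; rewrite [(x + _ - x)%R]addrAC subrr add0r /=.
  move: t12; rewrite /turn /bar /lab /= eqxx /= => /andP[_ /negP nd] q; apply: nd.
  apply: dvd_int; first exact: label_neq0.
  move: q; congr (_ \is a Num.int).
  have a0 := valP a; have := label_neq0 L e true; have := label_neq0 L e false.
  rewrite -!(intr_eq0 rat) => m0 l0; field.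
  by rewrite a0 m0 l0.
- move=> _ _; rewrite [(x + _ - x)%R]addrAC subrr add0r /=.
  move: t12; rewrite /turn /bar /lab /= eqxx /= => /andP[_ /negP nd] q; apply: nd.
  apply: dvd_int; first exact: label_neq0.
  move: q; congr (_ \is a Num.int).
  have a0 := valP a; have := label_neq0 L e true; have := label_neq0 L e false.
  rewrite -!(intr_eq0 rat) => m0 l0; field.
  by rewrite a0 m0 l0.
- by move=> _ k1; exfalso; lra.
Qed.

Definition scale_state0 : scale_state := (exist _ 1%R (oner_neq0 rat), 0%R, 0%R).

(** Britton's lemma for closed reduced paths: the Magnus representation over the rational states
    separates them from the identity. *)
Lemma red_neq1 f f' x i j : red f f' x -> src f = tgt f' ->
  zexpg (g (src f)) i * x * zexpg (g (src f)) j != 1.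
Proof.
move=> rx ff'; have [l [sepl [phi [phi1 _]]]] :=
  red_detect rat scale_state0 scale_matching rx ff'.
by apply: contraNneq (phi1 i j) => ->; rewrite hom1.
Qed.

Lemma rep_zexpg_neq1 (Q : groupType) (A : V -> Q) (B : E -> Q) v i :
  gbs_rep L A B -> zexpg (A v) i != 1 ->
  exists phi : {multiplicative G -> Q}, phi (zexpg (g v) i) != 1 /\
    (forall K, is_subgroup K -> (forall v, K (A v)) -> (forall e, K (B e)) ->
      forall y, K (phi y)).
Proof.
move=> rep Ai; have [tau [phi [phiA _ phiK]]] := gbs_rep_hom Gamma_nonempty
  Gamma_connected T_maximal rep.
by exists phi; split=> //; rewrite homZ phiA -zexpgJ conjg_eq1.
Qed.

Lemma vgen_inj v i j : zexpg (g v) i = zexpg (g v) j -> i = j.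
Proof.
move=> ij; apply/eqP; rewrite -subr_eq0; apply/negPn/negP => n0.
have [|phi [phi1 _]] := @rep_zexpg_neq1 _ _ _ v (i - j)%R (match_rep scale_matching).
  apply/eqP => /(congr1 (fun p : sym _ => (p scale_state0).2)).
  by rewrite scaleA_zexpg /= add0r mul1r => /eqP; rewrite intr_eq0 (negPf n0).
by move: phi1; rewrite zexpgB ij mulgV hom1 eqxx.
Qed.

End Detection.

(** * Finite p-quotients *)

Section Image.
Variables (G H : groupType) (phi : {multiplicative G -> H}).

Definition in_image : {pred H} := fun y => `[< range phi y >].

Lemma in_image_group_closed : group_closed in_image.
Proof.
split; first by apply/asboolP; exists 1 => //; apply: hom1.
move=> _ _ /asboolP[x _ <-] /asboolP[y _ <-]; apply/asboolP.
by exists (x / y); rewrite // gmulfM homV.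
Qed.

Definition image_group := {y : H | in_image y}.
HB.instance Definition _ := SubChoice.on image_group.
HB.instance Definition _ :=
  SubChoice_isSubGroup.Build H in_image image_group in_image_group_closed.

Definition to_image (x : G) : image_group :=
  exist _ (phi x) (asboolT (imageT phi x)).

Lemma to_imageM : {morph to_image : x y / x * y}.
Proof. by move=> x y; apply: val_inj; rewrite valM /= gmulfM. Qed.

HB.instance Definition _ := isMultiplicative.Build G image_group to_image to_imageM.

Lemma range_to_image : range to_image = [set: image_group].
Proof.
rewrite eqEsubset; split=> // y _; have /asboolP[x _ xy] := valP y.
by exists x => //; apply: val_inj.
Qed.

End Image.

Lemma has_order_exists (G : groupType) (x : G) n : (0 < n)%N -> x ^+ n = 1 ->
  exists2 k, has_order x k & k %| n.
Proof.
move=> n0 xn; have exP : exists k, (0 < k)%N && (x ^+ k == 1).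
  by exists n; rewrite n0 xn eqxx.
case: (ex_minnP exP) => k /andP[k0 /eqP xk] kmin.
have small j : (j < k)%N -> x ^+ j = 1 -> j = 0%N.
  move=> jk xj; apply/eqP; rewrite -leqn0 leqNgt; apply/negP => j0.
  by have := kmin j; rewrite j0 xj eqxx leqNgt jk => /(_ isT).
exists k.
  split=> // j /andP[j0 jk]; apply/eqP => /(small j jk) jE.
  by rewrite jE in j0.
apply/eqP/small; first by rewrite ltn_mod.
rewrite (divn_eq n k) mulnC expgnDr expgnA xk expg1n mul1g in xn.
by rewrite -[RHS]xn.
Qed.

Lemma rho_group_pow p (G : groupType) : prime p ->
  (forall x : G, exists n, x ^+ (p ^ n) = 1) -> rho_group p G.
Proof.
move=> pp Gp x; have [n xn] := Gp x.
have pn0 : (0 < p ^ n)%N by rewrite expn_gt0 prime_gt0.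
have [k xk kn] := has_order_exists pn0 xn.
by exists k => //; apply: pnat_dvd kn _; rewrite pnatX pnat_id.
Qed.

(** * Triangular permutations and iterated wreath products *)

Section Triangular.
Variables (X : finType) (q n : nat) (coord : nat -> X -> 'Z_q).
Hypothesis q_gt1 : (1 < q)%N.
Hypothesis coord_inj : forall x y, (forall i, (i < n)%N -> coord i x = coord i y) ->
  x = y.

Definition agree i (x y : X) := forall j, (j < i)%N -> coord j x = coord j y.

(** If the coordinates identify [X] with all [n]-tuples, this is an iterated wreath product of
    cyclic groups of order [q]. *)
Definition triangular : set (sym X) := [set pi | forall i x y, agree i x y ->
  (coord i (pi x) - coord i x = coord i (pi y) - coord i y)%R].

Lemma agree_sub i j x y : (j <= i)%N -> agree i x y -> agree j x y.
Proof. by move=> ji xy k kj; apply: xy; apply: leq_trans ji. Qed.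

Lemma agree_triangular pi i x y : triangular pi -> agree i x y ->
  agree i (pi x) (pi y).
Proof.
move=> tpi xy j ji; have := tpi j x y (agree_sub (ltnW ji) xy).
by rewrite (xy j ji) => /addIr.
Qed.

Lemma agree_triangularV pi i x y : triangular pi -> agree i x y ->
  agree i (pi^-1 x) (pi^-1 y).
Proof.
move=> tpi; elim: i => [|i IHi] xy; first by [].
have xy' := IHi (agree_sub (leqnSn i) xy).
move=> j; rewrite ltnS leq_eqVlt => /orP[/eqP->|]; last exact: xy'.
have := tpi i _ _ xy'; rewrite !symKV (xy i (ltnSn i)).
by move=> /addrI /oppr_inj.
Qed.

Lemma triangular_subgroup : is_subgroup triangular.
Proof.
split=> [i x y _|pi rho tpi trho i x y xy]; first by rewrite !sym1 !subrr.
have xy' := agree_triangularV trho (agree_triangular tpi xy).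
have := trho i _ _ xy'; rewrite !symM !symKV => E.
rewrite -[LHS](subrKA (coord i (pi x))) -[RHS](subrKA (coord i (pi y))).
rewrite (tpi i x y xy); congr (_ + _)%R.
by rewrite -[LHS]opprB -[RHS]opprB E.
Qed.

(** A power that fixes the first [i] coordinates adds a constant to coordinate [i] along each of its
    orbits, so its [q]-th power fixes that coordinate too. *)
Lemma triangular_pow pi : triangular pi -> pi ^+ (q ^ n) = 1.
Proof.
move=> tpi; suff fix_below i x : agree i ((pi ^+ (q ^ i)) x) x.
  by apply: sym_eq => x; apply: coord_inj; apply: fix_below.
elim: i x => [//|i IHi] x; rewrite expnSr expgnA.
have := subgX triangular_subgroup (q ^ i) tpi.
move: (pi ^+ (q ^ i)) IHi => rho fix_below trho.
have powE k : agree i ((rho ^+ k) x) x /\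
    coord i ((rho ^+ k) x) = (coord i x + (coord i (rho x) - coord i x) *+ k)%R.
  elim: k => [|k [IHk Ek]]; first by rewrite addr0.
  rewrite expgSr symM; split=> [j ji|]; first by rewrite fix_below // IHk.
  have /eqP := trho i _ _ IHk; rewrite subr_eq Ek => /eqP ->.
  by rewrite mulrS addrCA.
move=> j; rewrite ltnS leq_eqVlt => /orP[/eqP->|].
  rewrite (powE q).2 -mulr_natr pchar_Zp //.
  by rewrite mulr0 addr0.
exact: (powE q).1.
Qed.

Lemma triangular_detect p (G : groupType) (phi : {multiplicative G -> sym X}) x :
  prime p -> p.-nat q -> (forall y, triangular (phi y)) -> phi x != 1 ->
  exists (H : groupType) (sigma : {multiplicative G -> H}),
    [/\ finite_group H /\ rho_group p H, range sigma = [set: H] & sigma x != 1].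
Proof.
move=> pp pq tphi phix; exists (image_group phi).
exists (HB.pack_for {multiplicative G -> image_group phi} (to_image phi)).
split; first split.
- pose f (y : image_group phi) : {ffun X -> X} := [ffun x => val y x].
  rewrite /finite_group -(preimage_setT f); apply: finite_preimage => //.
  move=> y z _ _ /ffunP fyz; apply/val_inj/sym_eq => u.
  by have := fyz u; rewrite !ffunE.
- apply: rho_group_pow => // y; have /asboolP[z _ yz] := valP y.
  have [k qk] := p_natP pq; exists (k * n)%N; apply: val_inj.
  have valX j : val (y ^+ j) = val y ^+ j.
    by elim: j => // j IHj; rewrite !expgS valM IHj.
  by rewrite valX expnM -qk -yz triangular_pow.
- exact: range_to_image.
- apply: contra phix => /eqP/(congr1 val) /= ->.
  by [].
Qed.

End Triangular.

Lemma intr_Zp_eq0 (q : nat) (n : int) : (1 < q)%N ->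
  ((n%:~R : 'Z_q) == 0)%R = (q %| n)%Z.
Proof.
move=> q1; have natE (k : nat) : ((k%:R : 'Z_q) == 0)%R = (q %| k)%N.
  by rewrite -val_eqE /= val_Zp_nat.
case: n => n; first exact: natE.
by rewrite NegzE mulrNz oppr_eq0 natE dvdzE abszN.
Qed.

Section PDetection.
Variables (Gamma : multigraph) (L : labeled_graph Gamma).
Variable T : {set edge Gamma}.
Local Notation V := (vertex Gamma).
Local Notation E := (edge Gamma).
Local Notation G := (gbs L T).
Local Notation g := (@vgen _ L T).
Hypothesis Gamma_nonempty : nonempty_graph Gamma.
Hypothesis Gamma_connected : connected_graph Gamma.
Hypothesis T_maximal : maximal_subtree T.

Variables (c : V -> int) (eps : E -> bool) (q p : nat).
Hypothesis p_prime : prime p.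
Hypothesis q_pnat : p.-nat q.
Hypothesis q_gt1 : (1 < q)%N.
Hypothesis eps_even : forall e, eps e -> 2 %| q.
Hypothesis c_rel : forall e,
  ((-1) ^+ eps e * (L e true * c (endpt e true))%:~R
   = (L e false * c (endpt e false))%:~R :> 'Z_q)%R.

(* A state (s, k, x): x moves by [c v], up to the sign given by the parity of
   s, and k counts the edges, so that consecutive edges never match. *)
Local Notation S := ('Z_q * 'Z_q * 'Z_q)%type.

Definition sgn_mod (s : 'Z_q) : 'Z_q := ((-1) ^+ (s : nat))%R.

Lemma sgn_mod2 s : (sgn_mod s * sgn_mod s = 1)%R.
Proof. by rewrite -expr2 sqrr_sign. Qed.

(** Parity survives reduction modulo [q], because [q] is even whenever [eps e] holds. *)
Lemma sgn_modD e s : (sgn_mod (s + (eps e)%:R) = sgn_mod s * (-1) ^+ eps e)%R.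
Proof.
case: (boolP (eps e)) => [/eps_even q2|_]; last by rewrite addr0 mulr1.
rewrite /sgn_mod -exprD -signr_odd -[RHS]signr_odd; congr (_ ^+ nat_of_bool _)%R.
rewrite -{1}(natr_Zp s) -natrD val_Zp_nat // oddD odd_mod ?oddD //.
by apply/negbTE; rewrite -dvdn2.
Qed.

Definition modA (v : V) : sym S.
Proof.
refine (@Sym S (fun w => (w.1.1, w.1.2, w.2 + sgn_mod w.1.1 * (c v)%:~R)%R)
  (fun w => (w.1.1, w.1.2, w.2 - sgn_mod w.1.1 * (c v)%:~R)%R) _ _).
- by case=> -[s k] x /=; rewrite addrK.
- by case=> -[s k] x /=; rewrite subrK.
Defined.

Definition modB (e : E) : sym S.
Proof.
refine (@Sym S (fun w => (w.1.1 + (eps e)%:R, w.1.2 + 1, w.2)%R)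
  (fun w => (w.1.1 - (eps e)%:R, w.1.2 - 1, w.2)%R) _ _).
- by case=> -[s k] x /=; rewrite !addrK.
- by case=> -[s k] x /=; rewrite !subrK.
Defined.

Lemma modA_zexpg v i (w : S) : zexpg (modA v) i w
  = (w.1.1, w.1.2, w.2 + sgn_mod w.1.1 * (i * c v)%:~R)%R.
Proof.
have AX n (u : S) : (modA v ^+ n) u
    = (u.1.1, u.1.2, u.2 + sgn_mod u.1.1 * (n%:Z * c v)%:~R)%R.
  elim: n u => [|n IHn] u; first by rewrite mul0r mulr0 addr0; case: u => -[].
  rewrite expgSr symM IHn /=; congr (_, _, _).
  rewrite -addrA -mulrDr -intrD; congr (_ + _ * _%:~R)%R.
  by rewrite intS mulrDl mul1r addrC.
case: i => n; first exact: AX.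
apply: (can_inj (symVK (modA v ^+ n.+1))).
rewrite symKV AX /= NegzE mulNr mulrNz mulrN -addrA addNr addr0.
by case: w => -[].
Qed.

Lemma mod_rep : gbs_rep L modA modB.
Proof.
move=> e; apply: sym_eq => w; rewrite !symM !modA_zexpg /= sgn_modD.
congr (_, _, (_ + _)%R); rewrite -mulrA -c_rel mulrA -mulrA; congr (_ * _)%R.
by rewrite mulrA -expr2 sqrr_sign mul1r.
Qed.

(** The coordinate moved by vertex generators comes after the one that gives the sign of the move,
    as triangularity requires. *)
Definition state_coord (X : finType) (st : X -> S) (i : nat) (x : X) : 'Z_q :=
  match i with 0%N => (st x).1.1 | 1%N => (st x).1.2 | _ => (st x).2 end.

Lemma state_coord_agree (X : finType) (st : X -> S) i x y :
  agree (state_coord st) i.+3 x y -> st x = st y.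
Proof.
move=> xy; have /= := xy 0%N isT; have /= := xy 1%N isT; have /= := xy 2%N isT.
by case: (st x) (st y) => -[? ?] ? [[? ?] ?] /= -> -> ->.
Qed.

Lemma modA_triangular v : triangular (state_coord (@id S)) (modA v).
Proof.
move=> [|[|[|i]]] x y xy /=; rewrite ?subrr //.
  by rewrite (addrC x.2) (addrC y.2) !addrK; have /= -> := xy 0%N isT.
by have -> := state_coord_agree xy.
Qed.

Lemma modB_triangular e : triangular (state_coord (@id S)) (modB e).
Proof.
move=> [|[|[|i]]] x y xy /=; rewrite ?subrr //.
- by rewrite (addrC x.1.1) (addrC y.1.1) !addrK.
- by rewrite (addrC x.1.2) (addrC y.1.2) !addrK.
Qed.

Definition finite_p_detects (x : G) :=
  exists (H : groupType) (sigma : {multiplicative G -> H}),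
    [/\ finite_group H /\ rho_group p H, range sigma = [set: H] & sigma x != 1].

Lemma p_detect_vgen v i : ~~ (q %| (i * c v)%R)%Z -> finite_p_detects (zexpg (g v) i).
Proof.
move=> qi; have [|phi [phi1 phiK]] := @rep_zexpg_neq1 _ L T Gamma_nonempty
  Gamma_connected T_maximal _ _ _ v i mod_rep.
  apply: contra qi => /eqP/(congr1 (fun pi : sym _ => (pi (0, 0, 0)%R).2)).
  rewrite modA_zexpg /= add0r /sgn_mod expr0 mul1r => /eqP.
  by rewrite intr_Zp_eq0.
have S_inj (x y : S) : (forall i, (i < 3)%N ->
    state_coord (@id S) i x = state_coord (@id S) i y) -> x = y.
  exact: state_coord_agree.
apply: (triangular_detect q_gt1 S_inj p_prime q_pnat _ phi1) => y.
apply: phiK; first exact: triangular_subgroup.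
- exact: modA_triangular.
- exact: modB_triangular.
Qed.

Local Notation period e := (L e true * c (endpt e true))%R.
Hypothesis c_neq0 : forall v, c v != 0%R.
Hypothesis period_abs : forall e,
  (`|period e| = `|(L e false * c (endpt e false))%R|)%N.
Hypothesis period_dvd : forall e, (period e %| q%:Z)%Z.

Definition mod_match (e : E) (w w' : S) :=
  [&& w.1.1 == w'.1.1, w.1.2 == w'.1.2 &
      [exists z : 'Z_q, w.2 - w'.2 == z * (period e)%:~R]]%R.

(** The sign is invertible, and a congruence modulo [q] implies one modulo the period, which divides
    [q]. *)
Lemma sgn_mod_dvd e (s : 'Z_q) n (z : 'Z_q) :
  (sgn_mod s * n%:~R = z * (period e)%:~R)%R -> (period e %| n)%Z.
Proof.
move/(congr1 ( *%R (sgn_mod s))); rewrite mulrA sgn_mod2 mul1r mulrA.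
set y := (_ * z)%R => /eqP; rewrite -(natr_Zp y) -subr_eq0.
rewrite -[((y : nat)%:R)%R]/((y : nat)%:Z%:~R)%R -intrM -intrB intr_Zp_eq0 //.
move=> /(dvdz_trans (period_dvd e)); rewrite rpredBr //.
by rewrite dvdz_mull.
Qed.

Lemma mod_matching : matching L modA modB mod_match.
Proof.
split.
- exact: mod_rep.
- move=> e w; rewrite /mod_match !eqxx; apply/existsP; exists 0%R.
  by rewrite subrr mul0r.
- move=> e w w'; rewrite modA_zexpg /mod_match /=; congr [&& _, _ & _].
  by apply/existsP/existsP => -[z /eqP zE]; [exists (z - sgn_mod w.1.1)%R |
    exists (z + sgn_mod w.1.1)%R]; apply/eqP; rewrite ?mulrBl ?mulrDl -zE; ring.
have both e (w1 w2 w' : S) : mod_match e w' w1 -> mod_match e w' w2 ->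
    w1.1.2 = w2.1.2 /\ exists z : 'Z_q, (w2.2 - w1.2 = z * (period e)%:~R)%R.
  move=> /and3P[_ /eqP k1 /existsP[z1 /eqP x1]].
  move=> /and3P[_ /eqP k2 /existsP[z2 /eqP x2]].
  split; rewrite -?k1 -?k2 //; exists (z1 - z2)%R.
  by rewrite mulrBl -x1 -x2; ring.
have one0 : (1%R : 'Z_q) != 0%R := oner_neq0 _.
move=> [e1 b1] [e2 b2] i [[s k] x] t12 e w'; apply/negP => /andP[].
rewrite /hits /letter /= => /andP[/eqP e1E m1] /andP[/eqP e2E m2]; subst e1 e2.
have {m1 m2}[+ [z +]] := both _ _ _ _ m1 m2.
case: b1 b2 t12 => [] [] t12; rewrite /stepg /= modA_zexpg /=.
- by move=> /eqP; rewrite -subr_eq0 opprD addNKr oppr_eq0 (negPf one0).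
- move=> _; rewrite [(x + _ - x)%R]addrAC subrr add0r => /sgn_mod_dvd.
  move: t12; rewrite /turn /src /bar /lab /= eqxx /= => /andP[_ /negP nd] pd.
  (* This backtrack takes place at e(-1), where the edge group has the same period up to sign. *)
  apply: nd; move: pd; rewrite dvdzE period_abs -dvdzE.
  by rewrite dvdz_mul2r.
- move=> _; rewrite [(x + _ - x)%R]addrAC subrr add0r => /sgn_mod_dvd.
  move: t12; rewrite /turn /src /bar /lab /= eqxx /= => /andP[_ /negP nd] pd.
  by apply: nd; move: pd; rewrite dvdz_mul2r.
- by move=> /eqP; rewrite -subr_eq0 opprB addrC subrK (negPf one0).
Qed.

Lemma p_detect_red f f' x i j : red f f' x -> src f = tgt f' ->
  finite_p_detects (zexpg (g (src f)) i * x * zexpg (g (src f)) j).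
Proof.
move=> rx ff'; have [l [sepl [phi [phi1 phiK]]]] :=
  red_detect Gamma_nonempty Gamma_connected T_maximal ('Z_q) (0, 0, 0)%R
    mod_matching rx ff'.
pose X : finType := (S * {ffun 'I_(size l).+1 -> 'Z_q})%type.
(* The state comes first and then the vector in its order: a shear adds to an entry at most the
   preceding one, by a rule that depends only on the state. *)
pose coord (i : nat) (u : X) : 'Z_q :=
  if i is j.+3 then u.2 (inord j) else state_coord (@fst S _) i u.
have state_eq u u' : coord 0%N u = coord 0%N u' -> coord 1%N u = coord 1%N u' ->
    coord 2%N u = coord 2%N u' -> u.1 = u'.1.
  by case: u u' => [[[? ?] ?] ?] [[[? ?] ?] ?] /= -> -> ->.
have X_inj (u u' : X) : (forall i, (i < (size l).+4)%N -> coord i u = coord i u') ->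
    u = u'.
  move=> uu; have : u.1 = u'.1 by apply: state_eq; apply: uu.
  have : u.2 = u'.2.
    by apply/ffunP => k; have := uu k.+3; rewrite /= inord_val; apply; apply: ltn_ord k.
  by case: u u' {uu} => [u1 u2] [u1' u2'] /= -> ->.
have st_agree k u u' : agree coord k.+3 u u' -> u.1 = u'.1.
  by move=> uu; apply: state_eq; apply: uu.
apply: (triangular_detect q_gt1 X_inj p_prime q_pnat _ (phi1 i j)) => y.
apply: phiK; first exact: triangular_subgroup.
- move=> v k u u' uu; case: k uu => [|[|[|k]]] uu /=; rewrite ?subrr //.
  by rewrite (addrC u.1.2) (addrC u'.1.2) !addrK; have /= -> := uu 0%N isT.
- move=> e k u u' uu; case: k uu => [|[|[|k]]] uu /=; rewrite ?subrr //.
  + by rewrite (addrC u.1.1.1) (addrC u'.1.1.1) !addrK.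
  + by rewrite (addrC u.1.1.2) (addrC u'.1.1.2) !addrK.
  rewrite !ffunE (addrC (u.2 _)) (addrC (u'.2 _)) !addrK (st_agree _ _ _ uu).
  case: ifP => // h; congr (_ * _)%R.
  (* Out of range, [inord k] is the index 0, which is never hit. *)
  case: (leqP k (size l)) => kl; last first.
    by move: h; rewrite /inord /insubd insubN //= -leqNgt.
  rewrite inordK // in h *; case: k h uu kl => [//|k] h uu kl.
  by have /= := uu k.+3; apply.
Qed.

End PDetection.

(** * Nilpotent and solvable groups *)

Section CentralSeries.
Variable G : groupType.
Implicit Types (x y c : G) (K A : set G).
Local Notation lc := (@lower_central G).

Lemma generated_subgroup A : is_subgroup (generated A).
Proof.
split=> [K [[K1 _] _]|x y Ax Ay K [Ksub AK]]; first by [].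
by case: (Ksub) => _; apply; [apply: Ax | apply: Ay].
Qed.

Lemma sub_generated A : A `<=` generated A.
Proof. by move=> x Ax K [_]; apply. Qed.

Lemma generated_sub A K : is_subgroup K -> A `<=` K -> generated A `<=` K.
Proof. by move=> Ksub AK x; apply. Qed.

Definition normal_subgroup K := is_subgroup K /\ forall x y, K x -> K (x ^ y).

Lemma lower_central_normal n : normal_subgroup (lc n).
Proof.
elim: n => [|n [_ Jn]]; first by [].
have Ksub := generated_subgroup [set [~ x, y] | x in lc n & y in [set: G]].
split=> // x y Kx.
have Jsub : is_subgroup [set x | lc n.+1 (x ^ y)].
  split=> [|u v Ku Kv] /=; first by rewrite conj1g; apply: subg1.
  by rewrite conjMg conjVg; apply: (proj2 Ksub).
apply: (generated_sub Jsub _ Kx) => _ [u Lu [v _ <-]] /=.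
by rewrite conjRg; apply: sub_generated; exists (u ^ y); [apply: Jn | exists (v ^ y)].
Qed.

Lemma lower_central_comm n x y : lc n x -> lc n.+1 [~ x, y].
Proof. by move=> Lx; apply: sub_generated; exists x => //; exists y. Qed.

Lemma expgM_mod K x c j : normal_subgroup K -> (forall z, K [~ c, z]) ->
  exists2 k, K k & (x * c) ^+ j = x ^+ j * c ^+ j * k.
Proof.
move=> [Ksub KJ] Kc; elim: j => [|j [k Kk IHj]].
  by exists 1; [apply: subg1 | rewrite !mulg1].
have := Kc (x ^+ j); have := commgC c (x ^+ j); move: [~ c, _] => d cx Kd.
exists (d ^ (c ^+ j) * k); first by apply: (subgM Ksub) => //; apply: KJ.
have := conjgC d (c ^+ j); move: (d ^ _) => e de.
rewrite expgS {}IHj -!mulgA (mulgA c) cx -!mulgA (mulgA d) de.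
by rewrite !expgS !mulgA.
Qed.

(** If [c] lies in a term of the lower central series, it is central modulo the next term. There
    [x ^+ m] and its conjugate by [y] differ by [c ^+ m], which is thus trivial, and so is [c ^+ n];
    by coprimality [c] lies in the next term. *)
Lemma nilpotent_coprime_comm x y m n : nilpotent G -> coprime m n ->
  [~ x ^+ m, y] = 1 -> [~ x, y ^+ n] = 1 -> [~ x, y] = 1.
Proof.
move=> [N LN] mn xmy xyn; set c := [~ x, y].
suff: lc N c by rewrite LN.
elim: N {LN} => [//|k ck]; have [Ksub KJ] := lower_central_normal k.+1.
have Kc z : lc k.+1 [~ c, z] by apply: lower_central_comm.
have KcV z : lc k.+1 [~ c^-1, z].
  by apply: lower_central_comm; apply: (subgV (lower_central_normal k).1).
have pow_in u d j : (forall z, lc k.+1 [~ d, z]) ->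
    (u * d) ^+ j = u ^+ j -> lc k.+1 (d ^+ j).
  move=> Kd; have [e Ke ->] := expgM_mod u j (conj Ksub KJ) Kd.
  rewrite -mulgA -[RHS]mulg1 => /mulgI dk.
  have -> : d ^+ j = e^-1 by rewrite -[e]mul1g -(mulVg (d ^+ j)) -mulgA dk mulg1 invgK.
  exact: (subgV Ksub Ke).
have cm : lc k.+1 (c ^+ m).
  apply: (pow_in x) => //; rewrite /c commgEl mulVKg -conjXg.
  by apply/eqP; rewrite conjg_fix xmy.
have cn : lc k.+1 (c ^+ n).
  rewrite -[_ ^+ n]invgK -expVgn; apply: (subgV Ksub); apply: (pow_in y) => //.
  rewrite /c invgR commgEl mulVKg -conjXg.
  by apply/eqP; rewrite conjg_fix commg1_sym xyn.
have [u [v uv]] := Bezoutz m%:Z n%:Z.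
have -> : c = zexpg (zexpg c m%:Z) u * zexpg (zexpg c n%:Z) v.
  rewrite -!zexpgM -zexpgD mulrC [(n%:Z * v)%R]mulrC uv.
  by rewrite /gcdz (eqP mn).
by apply: (subgM Ksub); apply: (subgZ Ksub).
Qed.

(** A commutator of a power of [x] with [y] descends one term of the lower central series and
    replaces a factor [m] of the exponent by [n - m]. *)
Lemma nilpotent_conj_exp x y m n : nilpotent G -> zexpg x m ^ y = zexpg x n ->
  exists k, zexpg x ((n - m) ^+ k)%R = 1.
Proof.
move=> [N LN] xmn; exists N.
suff: lc N (zexpg x ((n - m) ^+ N)%R) by rewrite LN.
elim: N {LN} => [//|k IHk].
set j := ((n - m) ^+ k)%R in IHk.
have -> : zexpg x ((n - m) ^+ k.+1)%R = [~ zexpg x (m * j)%R, y].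
  have xmj : zexpg x (m * j)%R ^ y = zexpg x (n * j)%R.
    by rewrite !zexpgM zexpgJ xmn.
  by rewrite commgEl xmj -zexpgN -zexpgD exprS -/j; congr zexpg; ring.
rewrite mulrC zexpgM; apply: lower_central_comm.
exact: (subgZ (lower_central_normal k).1).
Qed.

Definition abelian_normal K : Prop := normal_subgroup K /\
  forall x y, K x -> K y -> commute x y.

Lemma metabelian_solvable K : abelian_normal K -> (forall x y, K [~ x, y]) ->
  solvable G.
Proof.
move=> [[Ksub _] Kab] Kcomm; exists 2; rewrite eqEsubset; split=> [x|_ ->]; last first.
  exact: subg1 (generated_subgroup _).
have K1 : @derived_series G 1 `<=` K.
  by apply: generated_sub => // _ [y _ [z _ <-]]; apply: Kcomm.
have one_sub : is_subgroup [set (1 : G)].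
  by split=> // y z -> ->; rewrite mulgV.
apply: generated_sub => // _ [y /K1 Ky [z /K1 Kz <-]].
by apply/eqP/commgP/Kab.
Qed.

(** Modulo a normal subgroup, the elements commuting with a given one form a subgroup, so it
    suffices to test generators. *)
Lemma comm_in_normal K (A : set G) : normal_subgroup K ->
  (forall B, is_subgroup B -> A `<=` B -> forall x, B x) ->
  (forall x y, A x -> A y -> K [~ x, y]) -> forall x y, K [~ x, y].
Proof.
move=> [Ksub KJ] gen KA.
have cent x : is_subgroup [set y | K [~ x, y]].
  split=> [|y z /= Ky Kz]; first by rewrite /= commg1; apply: subg1.
  have zV : [~ x, z^-1] = [~ x, z]^-1 ^ z^-1.
    by rewrite !commgEl invgM !conjgE !invgM !invgK !mulgA mulgV mul1g.
  have -> : [~ x, y / z] = [~ x, z^-1] * [~ x, y] ^ z^-1.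
    by rewrite !commgEl !conjgE !invgM !invgK !mulgA mulgVK mulgK.
  apply: (subgM Ksub); last exact: KJ.
  by rewrite zV; apply/KJ/(subgV Ksub).
have Kswap x y : K [~ x, y] -> K [~ y, x].
  by move=> Kxy; rewrite -invgR; apply: (subgV Ksub).
have KAx x y : A x -> K [~ x, y].
  by move=> Ax; apply: (gen _ (cent x)) => z Az; apply: KA.
by move=> x y; apply: (gen _ (cent x)) => z Az; apply/Kswap/KAx.
Qed.

End CentralSeries.

(** * Nilpotence of finite p-groups *)

Section FiniteGroup.
Variables (H : groupType) (s : seq H).
Hypothesis sP : forall x, x \in s.

(** The enumeration is a phantom argument, so that the structure of a finite group can be attached
    to this copy of [H]. *)
Definition enum_group of (forall x, x \in s) : Type := H.
Local Notation FG := (enum_group sP).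

HB.instance Definition _ := Group.on FG.

Lemma enum_groupK : cancel (fun x : FG => index (x : H) s) (nth 1 s).
Proof. by move=> x; rewrite nth_index. Qed.

HB.instance Definition _ := Countable.copy FG (can_type enum_groupK).

Lemma enum_group_enumP : Finite.axiom (undup s : seq FG).
Proof. by move=> x; rewrite count_uniq_mem ?undup_uniq // mem_undup sP. Qed.

HB.instance Definition _ := isFinite.Build FG enum_group_enumP.

Local Notation FGT := [set: FG]%SET.

Lemma enum_group_pgroup p : prime p -> rho_group p H -> (p.-group FGT)%g.
Proof.
move=> pp pH; apply/pgroupP => r r_prime /Cauchy[] // x _ xr.
have [n [n0 xn _] pn] := pH x.
have : r %| n by rewrite -xr order_dvdn; apply/eqP.
by move/(pnatP _ n0)/(_ _ r_prime): pn => /[apply].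
Qed.

Lemma enum_group_lower_central n (x : H) : @lower_central H n x ->
  (x : FG) \in 'L_n.+1(FGT)%g.
Proof.
elim: n x => [|n IHn] x; first by rewrite lcn1 inE.
move=> Lx; pose K : set H := [set y : H | (y : FG) \in 'L_n.+2(FGT)%g].
have Ksub : is_subgroup K.
  by split=> [|y z Ky Kz]; [apply: group1 | apply: groupM => //; rewrite groupV].
apply: (generated_sub Ksub _ Lx) => _ [y /IHn yL [z _ <-]].
by rewrite /K /= lcnSn; apply: mem_commg; rewrite ?inE.
Qed.

Lemma enum_p_group_nilpotent p : prime p -> rho_group p H -> nilpotent H.
Proof.
move=> pp pH; have /lcnP[n Ln] := pgroup_nil (enum_group_pgroup pp pH).
exists n; rewrite eqEsubset; split=> [x /enum_group_lower_central|_ ->].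
  by rewrite Ln inE => /eqP.
exact: subg1 (lower_central_normal H n).1.
Qed.

End FiniteGroup.

Lemma finite_p_group_nilpotent p (H : groupType) : prime p -> finite_group H ->
  rho_group p H -> nilpotent H.
Proof.
move=> pp /finite_seqP[s sE].
have sP (x : H) : x \in s by have : [set: H] x by []; rewrite sE.
exact: (enum_p_group_nilpotent sP).
Qed.

(** * Solvability of quotients of BS(r,1) and of the Klein bottle group *)

Section SolvableGroups.
Variable G : groupType.
Implicit Types (a b t x y : G).

Definition generates (A : set G) := forall B, is_subgroup B -> A `<=` B -> forall x, B x.

Lemma normal_of_generators (A K : set G) : is_subgroup K -> generates A ->
  (forall y x, A y -> K x -> K (x ^ y) /\ K (x ^ y^-1)) -> normal_subgroup K.
Proof.
move=> Ksub gen AK; split=> // x y Kx.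
pose B := [set y | forall x, K x -> K (x ^ y) /\ K (x ^ y^-1)].
have Bsub : is_subgroup B.
  split=> [z Kz|u v Bu Bv z Kz]; first by rewrite invg1 conjg1.
  rewrite invgF !conjgM; split.
    by have [Ku _] := Bu _ Kz; have [_] := Bv _ Ku.
  by have [Kv _] := Bv _ Kz; have [_] := Bu _ Kv.
have /(gen _ Bsub)/(_ y)/(_ x Kx)[] // : A `<=` B.
by move=> z Az u Ku; apply: AK.
Qed.

(** The conjugates of the cyclic group of [a] by powers of [t] form an ascending chain. Its union is
    abelian and normal, and the quotient by it is generated by [t]. *)
Lemma ascending_solvable a t r : a = zexpg a r ^ t -> generates [set a; t] ->
  solvable G.
Proof.
move=> aE gen; pose lev k i : G := zexpg a i ^ (t ^+ k).
have lev_raise k i n : exists j, lev k i = lev (k + n)%N j.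
  elim: n => [|n [j ->]]; first by exists i; rewrite addn0.
  exists (r * j)%R; rewrite /lev addnS expgS conjgM; congr (_ ^ _).
  by rewrite zexpgM zexpgJ -aE.
pose K : set G := [set x | exists k i, x = lev k i].
have common x y : K x -> K y -> exists k i j, x = lev k i /\ y = lev k j.
  move=> [k [i ->]] [l [j ->]]; have [i' Ei] := lev_raise k i l.
  by have [j' Ej] := lev_raise l j k; exists (k + l)%N, i', j'; rewrite Ei Ej addnC.
have Ksub : is_subgroup K.
  split=> [|x y Kx Ky]; first by exists 0%N, 0%R; rewrite /lev conjg1.
  have [k [i [j [-> ->]]]] := common _ _ Kx Ky; exists k, (i - j)%R.
  by rewrite /lev zexpgB conjMg conjVg.
have Kab x y : K x -> K y -> commute x y.
  move=> Kx Ky; have [k [i [j [-> ->]]]] := common _ _ Kx Ky.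
  by rewrite /commute /lev -!conjMg -!zexpgD addrC.
have Ka : K a by exists 0%N, 1%R; rewrite /lev conjg1.
have Kt x : K x -> K (x ^ t).
  by move=> [k [i ->]]; exists k.+1, i; rewrite /lev expgSr conjgM.
have Knorm : normal_subgroup K.
  apply: (normal_of_generators Ksub gen) => y x [->|->] Kx.
    have xa : commute x a by apply: Kab.
    by split; rewrite conjgE ?invgK ?xa ?mulKg // mulgA -xa mulgK.
  split; first exact: Kt.
  case: Kx => k [i ->]; have [j ->] := lev_raise k i 1%N; exists k, j.
  by rewrite /lev addn1 expgSr conjgM conjgK.
apply: (metabelian_solvable (conj Knorm Kab)).
have Kat : K [~ a, t].
  by rewrite commgEl; apply: (subgM Ksub); [apply: (subgV Ksub)|apply: Kt].
apply: (comm_in_normal Knorm gen) => x y [->|->] [->|->] //.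
- by rewrite commgg; apply: (subg1 Ksub).
- by rewrite -invgR; apply: (subgV Ksub).
- by rewrite commgg; apply: (subg1 Ksub).
Qed.

(** [t] is inverted by both generators and [z] is central, so together they generate an abelian
    normal subgroup that contains all commutators. *)
Lemma klein_solvable a b : a ^+ 2 = b ^+ 2 -> generates [set a; b] ->
  solvable G.
Proof.
move=> ab gen; set t := a / b; set z := a ^+ 2.
have tb : t ^ b = t^-1.
  rewrite conjgE /t mulgVK invgM invgK; apply: (@mulgI _ b); rewrite mulVKg mulgA.
  by rewrite -expg2 -ab expg2 mulgK.
have ta : t ^ a = t^-1.
  have -> : a = t * b by rewrite /t mulgVK.
  by rewrite conjgM [t ^ t]conjgE mulKg.
have inv_of y : t ^ y = t^-1 -> t ^ y^-1 = t^-1.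
  by move=> ty; apply: (@conjg_inj _ y); rewrite conjgKV conjVg ty invgK.
have za : commute z a by apply/commute_sym/commuteX.
have zb : commute z b by rewrite /z ab; apply/commute_sym/commuteX.
have zt : commute z t by apply: commuteM; [|apply: commuteV].
pose K : set G := [set x | exists i j, x = zexpg t i * zexpg z j].
have KM i j k l : zexpg t i * zexpg z j * (zexpg t k * zexpg z l)
    = zexpg t (i + k) * zexpg z (j + l).
  rewrite !zexpgD -!mulgA; congr (_ * _); rewrite !mulgA; congr (_ * _).
  exact: zexpg_comm2.
have Ksub : is_subgroup K.
  split=> [|_ _ [i [j ->]] [k [l ->]]]; first by exists 0%R, 0%R; rewrite mulg1.
  exists (i - k)%R, (j - l)%R; rewrite invgM -!zexpgN.
  by rewrite -KM; congr (_ * _); apply: zexpg_comm2.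
have Kab x y : K x -> K y -> commute x y.
  move=> [i [j ->]] [k [l ->]].
  by rewrite /commute !KM [(i + _)%R]addrC [(j + _)%R]addrC.
have KJ y x : t ^ y = t^-1 -> commute z y -> K x -> K (x ^ y).
  move=> ty zy [i [j ->]]; exists (- i)%R, j; rewrite conjMg !zexpgJ ty.
  by rewrite conjgE zy mulKg -[t^-1]/(zexpg t (-1)) -zexpgM mulN1r.
have Knorm : normal_subgroup K.
  apply: (normal_of_generators Ksub gen) => y x [->|->] Kx; split; apply: KJ => //.
  - exact: inv_of.
  - exact: commuteV.
  - exact: inv_of.
  - exact: commuteV.
apply: (metabelian_solvable (conj Knorm Kab)).
have Kcomm : K [~ a, b].
  have tK : K t by exists 1%R, 0%R; rewrite mulg1.
  have -> : [~ a, b] = t * t; last exact: (subgM Ksub).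
  rewrite commgEl -{2}(mulgVK b a) -/t conjMg tb [b ^ b]conjgE mulKg.
  have bE : t^-1 * a = b by rewrite /t invgF mulgVK.
  have <- : (t^-1 * t^-1) ^ a = t * t by rewrite conjMg conjVg ta invgK.
  by rewrite conjgE -(mulgA t^-1) bE.
apply: (comm_in_normal Knorm gen) => x y [->|->] [->|->] //.
- by rewrite commgg; apply: (subg1 Ksub).
- by rewrite -invgR; apply: (subgV Ksub).
- by rewrite commgg; apply: (subg1 Ksub).
Qed.

End SolvableGroups.

(** * Reduced graphs *)

Section ReducedGraphs.
Variables (Gamma : multigraph) (L : labeled_graph Gamma).
Variable T : {set edge Gamma}.
Local Notation V := (vertex Gamma).
Local Notation E := (edge Gamma).
Local Notation oedge := (oedge Gamma).
Local Notation G := (gbs L T).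
Local Notation g := (@vgen _ L T).
Local Notation ed := (@estep _ L T).
Local Notation lab := (lab L).
Hypothesis Gamma_nonempty : nonempty_graph Gamma.
Hypothesis Gamma_connected : connected_graph Gamma.
Hypothesis T_maximal : maximal_subtree T.

Implicit Types (f : oedge) (v w : V).

Lemma gbs_generates : generates (range g `|` range ed).
Proof.
move=> B Bsub AB; apply: gbs_ind => [|v i x Bx|f x Bx]; first exact: subg1.
  by apply: (subgM Bsub) => //; apply: (subgZ Bsub); apply: AB; left; exists v.
by apply: (subgM Bsub) => //; apply: AB; right; exists f.
Qed.

Lemma gbs_generates_sub (A : set G) :
  (forall B : set G, is_subgroup B -> A `<=` B ->
     (forall v, B (g v)) /\ (forall f, B (ed f))) -> generates A.
Proof.
move=> AB B Bsub sAB; apply: gbs_generates => // x [|] [y _ <-].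
  by have [] := AB B Bsub sAB.
by have [] := AB B Bsub sAB.
Qed.

Lemma walk_closed_prop (P : V -> Prop) v : P v ->
  (forall f, P (src f) -> P (tgt f)) -> forall w, P w.
Proof.
move=> Pv Pf w; have [s] := Gamma_connected v w.
elim: s v Pv => [|f s IHs] v Pv; first by move=> /eqP <-.
by rewrite walk_cons => /and3P[_ /eqP fv]; apply: IHs; apply: Pf; rewrite fv.
Qed.

Lemma oedge_cases f f' : f'.1 = f.1 -> f' = f \/ f' = bar f.
Proof.
by case: f f' => [e b] [e' b'] /= ->; case: b b' => [] []; [left|right|right|left].
Qed.

Lemma no_edges_solvable v : (forall f : oedge, src f <> v) -> solvable G.
Proof.
move=> fv; have one_vertex : forall w, w = v.
  by apply: (@walk_closed_prop (fun w => w = v) v) => // f /fv.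
have no_edge (f : oedge) : False by apply: (fv f); apply: one_vertex.
(* The group is cyclic, a degenerate case with stable letter 1. *)
apply: (@ascending_solvable G (g v) 1 1%R); first by rewrite conjg1.
apply: gbs_generates_sub => B Bsub AB; split=> [w|f]; last by case: (no_edge f).
by rewrite (one_vertex w); apply: AB; left.
Qed.

Lemma single_loop_solvable f : tgt f = src f ->
  (forall f', src f' = src f -> f'.1 = f.1) -> `|lab (bar f)|%N = 1%N ->
  solvable G.
Proof.
move=> floop only labf; have one_vertex : forall w, w = src f.
  apply: (@walk_closed_prop (fun w => w = src f) (src f)) => // f' f'v.
  by case: (oedge_cases (only _ f'v)) => ->; rewrite ?tgt_bar // floop.
(* The sign [u] is its own inverse: raising the edge relation to the power [u] turns the label at
   the end of [f] into 1. *)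
pose u := lab (bar f); have uu : (u * u)%R = 1%R.
  by have [->|->] : u = 1%R \/ u = (-1)%R by move: labf; rewrite -/u; lia.
apply: (@ascending_solvable G (g (src f)) (ed f) (lab f * u)%R).
  have := estep_rel L T f u; rewrite -/u uu floop => E.
  by rewrite conjgE E mulKg.
apply: gbs_generates_sub => B Bsub AB; split=> [w|f'].
  by rewrite (one_vertex w); apply: AB; left.
have Bf : B (ed f) by apply: AB; right.
case: (oedge_cases (only f' (one_vertex _))) => -> //.
by rewrite estep_bar; apply: subgV.
Qed.

Hypothesis G_not_solvable : ~ solvable G.
Hypothesis L_reduced : reduced L.

Lemma loop_of_lab1 f : `|lab f|%N = 1%N -> tgt f = src f.
Proof. by case: f => e [] /L_reduced; rewrite /is_loop /src /tgt /= => ->. Qed.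

Lemma turn_back f : `|lab (bar f)|%N <> 1%N -> turn L f (bar f) 1.
Proof. by move=> /eqP l1; rewrite /turn src_bar !eqxx /= dvdz1. Qed.

Lemma turn_other f f' : tgt f = src f' -> f'.1 != f.1 -> turn L f f' 0.
Proof.
move=> ff' f1; rewrite /turn ff' eqxx /= negb_and; apply/orP; left.
by apply: contraNneq f1 => ->.
Qed.

(** If the far label is not 1 or -1, a turn with exponent 1 suffices. Otherwise [f] is a loop, and a
    second edge [f'] exists by non-solvability: either a return along [f'] is inserted, or [f'] is a
    loop too and the path f f' f followed by the reverses of f' and f is reduced. *)
Lemma red_return f : exists r : G, red f (bar f) r.
Proof.
have [l1|ln1] := eqVneq `|lab (bar f)|%N 1%N; last first.
  by eexists; apply: redM (red1 _ _ _) (red1 _ _ _) (turn_back _); apply/eqP.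
have floop : tgt f = src f by have := loop_of_lab1 l1; rewrite tgt_bar src_bar.
have [f' f'v f'f] : exists2 f', src f' = src f & f'.1 <> f.1.
  apply/not_exists2P => none; apply: G_not_solvable.
  by apply: (single_loop_solvable floop _ l1) => f' f'v; have [//|/contrapT] := none f'.
have f'n : f'.1 != f.1 by apply/eqP.
have fn : f.1 != f'.1 by rewrite eq_sym.
have t1 : turn L f f' 0 by apply: turn_other => //; rewrite floop.
have t2 : turn L (bar f') (bar f) 0.
  by apply: turn_other => //; rewrite tgt_bar src_bar floop.
have [l1'|ln1'] := eqVneq `|lab (bar f')|%N 1%N; last first.
  have r1 := redM (red1 L T f') (red1 L T (bar f')) (turn_back (elimN eqP ln1')).
  by eexists; apply: redM0 (redM0 (red1 L T f) r1 t1) (red1 L T _) t2.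
have f'loop : tgt f' = src f' by have := loop_of_lab1 l1'; rewrite tgt_bar src_bar.
have t3 : turn L f' f 0 by apply: turn_other => //; rewrite f'loop.
have t4 : turn L f (bar f') 0.
  by apply: turn_other => //; rewrite src_bar f'loop floop.
have r1 := redM0 (red1 L T f) (red1 L T f') t1.
have r2 := redM0 r1 (red1 L T f) t3; have r3 := redM0 r2 (red1 L T (bar f')) t4.
by eexists; apply: redM0 r3 (red1 L T _) t2.
Qed.

Definition comm_conj (u : G) := forall x, commute u (u ^ x).

Lemma comm_conjJ u x : comm_conj u -> comm_conj (u ^ x).
Proof.
move=> uc y; have := uc (x * y * x^-1); rewrite /commute => /(congr1 (conjg^~ x)).
by rewrite /= (conjMg u) (conjMg _ u) -!conjgM mulgVK.
Qed.

(* The key use of Britton's lemma: if [lab f] does not divide i, then the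
   commutator of g^i with its conjugate by a return along f is reduced. *)
Lemma comm_conj_dvd f i : comm_conj (zexpg (g (src f)) i) -> (lab f %| i)%Z.
Proof.
move=> uc; apply/negPn/negP => nd; have [r rr] := red_return f.
have rV : red f (bar f) r^-1 by have := redV rr; rewrite barK.
have turni j : ~~ (lab f %| j)%Z -> turn L (bar f) f j.
  by move=> nj; rewrite /turn tgt_bar eqxx barK eqxx.
have ndN : ~~ (lab f %| (- i)%R)%Z by rewrite dvdz_opp.
have r1 := redM rr rV (turni _ nd); have r1V := redV r1.
rewrite barK in r1V; have r2 := redM r1 r1V (turni _ ndN).
have := red_neq1 Gamma_nonempty Gamma_connected T_maximal i 0%R r2 (esym (tgt_bar f)).
rewrite mulg1 zexpgN; move: (zexpg _ i) uc => u uc.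
have uy : commute u (r * u * r^-1) by have := uc r^-1; rewrite conjgE invgK mulgA.
by move: (r * u / r) uy => y uy; rewrite !mulgA uy mulgK mulgV eqxx.
Qed.

Lemma vgen_tree v w i : (forall f : oedge, f.1 \in T -> forall j,
    zexpg (g (src f)) j = zexpg (g v) i -> (lab f %| j)%Z) ->
  exists j, zexpg (g v) i = zexpg (g w) j.
Proof.
move=> dvd; have [_ conn] := maximal_subtree_spanning Gamma_connected T_maximal.
have [s] := conn v w.
have: exists j, zexpg (g v) i = zexpg (g v) j by exists i.
move: {2 3}v; elim: s => [|f s IHs] u [j uj]; first by move=> /eqP <-; exists j.
rewrite walk_cons => /and3P[fT /eqP fu]; apply: IHs.
have /dvdzP[k jE] : (lab f %| j)%Z by apply: dvd; rewrite // fu.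
exists (lab (bar f) * k)%R; have := estep_rel L T f k.
by rewrite estep_tree // mulg1 mul1g => <-; rewrite mulrC -jE fu.
Qed.

(** By [comm_conj_dvd] such an element can be moved across every edge, so it lies in all vertex
    groups, and conjugation by a generator preserves this situation. *)
Lemma comm_conj_elliptic v w i x : comm_conj (zexpg (g v) i) ->
  exists j, zexpg (g v) i ^ x = zexpg (g w) j.
Proof.
pose P (u : G) := comm_conj u /\ exists v i, u = zexpg (g v) i.
have Pall u : P u -> forall w', exists j, u = zexpg (g w') j.
  move=> [uc [v' [i' uE]]] w'; rewrite uE; apply: vgen_tree => f _ j jE.
  by apply: comm_conj_dvd; rewrite jE -uE.
move=> uc; have: P (zexpg (g v) i) by split=> //; exists v, i.
move: (zexpg (g v) i) {uc} => u Pu; suff: P (u ^ x) by move/Pall.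
elim/gbs_ind: x u Pu => [|v' k x IHx|f x IHx] u Pu; first by rewrite conjg1.
  have [j uE] := Pall _ Pu v'; rewrite conjgM.
  have -> : u ^ zexpg (g v') k = u; last exact: IHx.
  by rewrite uE conjgE -!zexpgD -zexpgN -zexpgD addrC addrK.
rewrite conjgM; apply: IHx; split; first exact: comm_conjJ Pu.1.
have [j uE] := Pall _ Pu (src f).
have /dvdzP[k jE] : (lab f %| j)%Z by apply: comm_conj_dvd; rewrite -uE; case: Pu.
exists (tgt f), (lab (bar f) * k)%R.
by rewrite uE jE conjgE mulrC estep_rel mulKg.
Qed.

End ReducedGraphs.

(** * The cyclic radical *)

Section CyclicRadical.
Variables (Gamma : multigraph) (L : labeled_graph Gamma).
Variable T : {set edge Gamma}.
Local Notation V := (vertex Gamma).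
Local Notation oedge := (oedge Gamma).
Local Notation G := (gbs L T).
Local Notation g := (@vgen _ L T).
Local Notation lab := (lab L).
Hypothesis Gamma_nonempty : nonempty_graph Gamma.
Hypothesis Gamma_connected : connected_graph Gamma.
Hypothesis T_maximal : maximal_subtree T.
Hypothesis G_not_solvable : ~ solvable G.
Hypothesis L_reduced : reduced L.
Implicit Types (f : oedge) (v w : V).

(* The pair (f, i) stands for the edge g^i f of the Bass-Serre tree at the
   origin of f; two such pairs give the same edge when [same_dir] holds. *)
Definition same_dir (d d' : oedge * int) :=
  (d.1 == d'.1) && (lab d.1 %| (d.2 - d'.2)%R)%Z.

Lemma same_dir_sym d d' : same_dir d d' -> same_dir d' d.
Proof.
case/andP=> /eqP dd' h; rewrite /same_dir dd' eqxx /= -dd'.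
by rewrite -opprB dvdz_opp.
Qed.

Lemma same_dir_trans d d' d'' : same_dir d d' -> same_dir d' d'' -> same_dir d d''.
Proof.
case/andP=> /eqP dd' h /andP[/eqP dd'' h']; rewrite /same_dir dd' dd'' eqxx /=.
have -> : (d.2 - d''.2 = (d.2 - d'.2) + (d'.2 - d''.2))%R by ring.
by rewrite rpredD // -dd'' // -dd'.
Qed.

(** This says that at least three edges of the Bass-Serre tree leave the vertex. *)
Definition third_dir v := forall a b, exists f i,
  [/\ src f = v, ~~ same_dir (f, i) a & ~~ same_dir (f, i) b].

Lemma third_dir_of3 v d1 d2 d3 : src d1.1 = v -> src d2.1 = v -> src d3.1 = v ->
  ~~ same_dir d1 d2 -> ~~ same_dir d1 d3 -> ~~ same_dir d2 d3 -> third_dir v.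
Proof.
move=> v1 v2 v3 n12 n13 n23 a b.
have pick d : src d.1 = v -> (exists f i,
    [/\ src f = v, ~~ same_dir (f, i) a & ~~ same_dir (f, i) b]) \/
    same_dir d a \/ same_dir d b.
  move=> dv; case: (boolP (same_dir d a)) => [|na]; first by right; left.
  case: (boolP (same_dir d b)) => [|nb]; first by right; right.
  by left; exists d.1, d.2; rewrite -surjective_pairing.
have clash d d' c : ~~ same_dir d d' -> same_dir d c -> same_dir d' c -> False.
  by move=> n dc /same_dir_sym/(same_dir_trans dc); apply/negP.
case: (pick _ v1) => // s1; case: (pick _ v2) => // s2; case: (pick _ v3) => // s3.
exfalso; move: s1 s2 s3 => [s1|s1] [s2|s2] [s3|s3].
all: by [apply: (clash _ _ _ n12 s1 s2) | apply: (clash _ _ _ n13 s1 s3) |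
  apply: (clash _ _ _ n23 s2 s3)].
Qed.

Lemma third_dir_lab3 f : (2 < `|lab f|)%N -> third_dir (src f).
Proof.
move=> l3; apply: (@third_dir_of3 _ (f, 0%R) (f, 1%R) (f, 2%R)) => //;
  rewrite /same_dir eqxx /= dvdzE; apply/negP => /dvdn_leq; lia.
Qed.

Lemma third_dir_lab2 f f' : src f' = src f -> f' != f -> (1 < `|lab f|)%N ->
  third_dir (src f).
Proof.
move=> ff' nff' l2; apply: (@third_dir_of3 _ (f, 0%R) (f, 1%R) (f', 0%R)) => //;
  rewrite /same_dir /= ?eqxx /= ?[f == f']eq_sym ?(negPf nff') // dvdzE.
by apply/negP => /dvdn_leq; lia.
Qed.

Lemma third_dir_edges f f' f'' : src f' = src f -> src f'' = src f ->
  f' != f -> f'' != f -> f'' != f' -> third_dir (src f).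
Proof.
move=> v1 v2 n1 n2 n3.
by apply: (@third_dir_of3 _ (f, 0%R) (f', 0%R) (f'', 0%R)) => //;
  rewrite /same_dir /= eq_sym ?(negPf n1) ?(negPf n2) ?(negPf n3).
Qed.

(** Otherwise the Bass-Serre tree is a point or a line. The remaining graphs are a single vertex, a
    loop with labels 1 or -1, and a segment with labels 2 or -2; all of them give solvable
    groups. *)
Lemma third_dir_exists : exists v, third_dir v.
Proof.
apply: contrapT => none; have {}none v : ~ third_dir v by move=> h; apply: none; exists v.
have lab_le2 f : (`|lab f| <= 2)%N.
  by rewrite leqNgt; apply/negP => /third_dir_lab3/none.
have lab_gt0 f : (0 < `|lab f|)%N by rewrite absz_gt0 lab_neq0.
have lab2 f f' : src f' = src f -> f' <> f -> `|lab f|%N = 1%N.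
  move=> ff' nff'; apply/eqP; rewrite eqn_leq lab_gt0 andbT leqNgt; apply/negP.
  by move/(third_dir_lab2 ff'); rewrite (introN eqP nff') => /(_ isT)/none.
have /card_gt0P[v0 _] := Gamma_nonempty.
have [[f fv0]|] := pselect (exists f, src f = v0); last first.
  move=> nof; apply: G_not_solvable.
  by apply: (@no_edges_solvable _ _ _ Gamma_connected v0) => f fv; apply: nof; exists f.
have [l1|l1] := eqVneq `|lab f|%N 1%N.
  have floop := loop_of_lab1 L_reduced l1.
  apply: G_not_solvable; apply: (@single_loop_solvable _ _ _ Gamma_connected f) => //.
    move=> f' f'f; apply: contrapT => nf; apply: (none (src f)).
    apply: (@third_dir_edges f (bar f) f') => //; first exact: bar_neq.
      by apply: contra_notN nf => /eqP->.
    by apply: contra_notN nf => /eqP->.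
  by apply: (lab2 _ f); rewrite ?src_bar //; apply/eqP; rewrite eq_sym bar_neq.
have only f' : src f' = src f -> f' = f.
  move=> ff'; apply: contrapT => nf; move: l1; apply/negP/negPn/eqP.
  exact: lab2 ff' nf.
have nloop : tgt f <> src f.
  by move=> fl; have /eqP := only (bar f) fl; apply/negP/bar_neq.
have l1' : `|lab (bar f)|%N <> 1%N.
  by move=> /(loop_of_lab1 L_reduced); rewrite tgt_bar src_bar => /esym.
have only' f' : src f' = tgt f -> f' = bar f.
  by move=> ff'; apply: contrapT => nf; apply: l1'; apply: lab2 nf; rewrite src_bar.
have V2 w : w = src f \/ w = tgt f.
  apply: (@walk_closed_prop _ Gamma_connected (fun w => w = src f \/ w = tgt f) (src f)).
    by left.
  by move=> f' [/only->|/only'->]; [right | left; rewrite tgt_bar].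
have E1 f' : f'.1 = f.1 by case: (V2 (src f')) => [/only->|/only'->].
have fT : f.1 \in T.
  have [_ conn] := maximal_subtree_spanning Gamma_connected T_maximal.
  have [[|f' s]] := conn (src f) (tgt f); first by move=> /eqP/esym.
  by rewrite walk_cons E1 => /and3P[].
have abs2 (n : nat) : n <> 1%N -> (0 < n)%N -> (n <= 2)%N -> n = 2%N by lia.
have lf : `|lab f|%N = 2%N by apply: abs2; rewrite ?lab_le2 //; apply/eqP.
have lf' : `|lab (bar f)|%N = 2%N by apply: abs2; rewrite ?lab_le2.
have := estep_rel L T f 1; rewrite estep_tree // mulg1 mul1g !mulr1 => rel.
(* Inverting one generator when the labels have opposite signs makes the two squares equal. *)
pose b := if (lab f == lab (bar f))%R then g (tgt f) else (g (tgt f))^-1.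
apply: G_not_solvable; apply: (@klein_solvable G (g (src f)) b).
  have {rel}: zexpg (g (src f)) (lab f) = zexpg b (lab f).
    rewrite rel /b; case: eqP => [->//|ne].
    have -> : lab (bar f) = (- lab f)%R by move: lf lf' ne; lia.
    by rewrite zexpgN zexpgV.
  have [->//|->] : lab f = 2%R \/ lab f = (- 2)%R by move: lf; lia.
  by rewrite !zexpgN => /invg_inj.
apply: gbs_generates_sub => B Bsub AB; split=> [w|f'].
  case: (V2 w) => ->; first by apply: AB; left.
  have : B b by apply: AB; right.
  by rewrite /b; case: ifP => // _ /(subgV Bsub); rewrite invgK.
by rewrite estep_tree ?E1 //; apply: subg1.
Qed.

End CyclicRadical.

Section CyclicRadicalExists.
Variables (Gamma : multigraph) (L : labeled_graph Gamma).
Variable T : {set edge Gamma}.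
Local Notation V := (vertex Gamma).
Local Notation oedge := (oedge Gamma).
Local Notation G := (gbs L T).
Local Notation g := (@vgen _ L T).
Hypothesis Gamma_nonempty : nonempty_graph Gamma.
Hypothesis Gamma_connected : connected_graph Gamma.
Hypothesis T_maximal : maximal_subtree T.
Hypothesis G_not_solvable : ~ solvable G.
Hypothesis L_reduced : reduced L.
Implicit Types (f : oedge) (v w : V) (N : set G).

(** If [c] were given by a reduced path with edges, a return [y] in a direction different from its
    first and its reversed last one could be inserted without pinches. Then the commutator of [c]
    with its conjugate by the inverse of [y] would be a reduced path, hence non-trivial. *)
Lemma comm_conj_third_dir v (c : G) : third_dir L v -> comm_conj c ->
  exists i, c = zexpg (g v) i.
Proof.
move=> dir3 cc; have [_ conn] := maximal_subtree_spanning Gamma_connected T_maximal.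
case: (normal_formP conn v v c) => [[_ [i ->]]|]; first by exists i.
case=> f [f' [r [i [j [rr fv f'v cE]]]]]; exfalso.
have [f3 [k [f3v n1 n2]]] := dir3 (f, i) (bar f', (- j)%R).
have [R rR] := red_return Gamma_connected G_not_solvable L_reduced f3.
have RV : red f3 (bar f3) R^-1 by have := redV rR; rewrite barK.
have rV := redV rr.
have t1 : turn L f' f3 (j + k).
  rewrite /turn f'v f3v eqxx /=; apply: contra n2 => /andP[/eqP -> h].
  by rewrite /same_dir eqxx /= opprK addrC.
have t2 : turn L (bar f3) f (- k + i).
  rewrite /turn tgt_bar f3v fv eqxx barK /=; apply: contra n1 => /andP[/eqP ff3 h].
  by rewrite /same_dir /= -ff3 eqxx -dvdz_opp opprB addrC.
have t3 : turn L (bar f3) (bar f') (- k - j).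
  rewrite /turn tgt_bar src_bar f3v f'v eqxx barK /=.
  apply: contra n2 => /andP[/eqP ff3 h].
  by rewrite /same_dir /= -ff3 eqxx -dvdz_opp opprB addrC.
have t4 : turn L (bar f) f3 (- i + k).
  rewrite /turn tgt_bar f3v fv eqxx barK /=; apply: contra n1 => /andP[/eqP -> h].
  by rewrite /same_dir eqxx /= addrC.
have w1 := redM rr rR t1; have w2 := redM w1 rr t2; have w3 := redM w2 RV t1.
have w4 := redM w3 rV t3; have w5 := redM w4 rR t4; have w6 := redM w5 rV t3.
have w7 := redM w6 RV t4.
have := red_neq1 Gamma_nonempty Gamma_connected T_maximal i (- k)%R w7.
rewrite tgt_bar fv f3v => /(_ erefl); rewrite !src_bar f'v.
pose y : G := zexpg (g v) k * R * zexpg (g v) (- k).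
have yV : y^-1 = zexpg (g v) k * R^-1 * zexpg (g v) (- k).
  by rewrite /y !invgM -!zexpgN opprK mulgA.
have cV : c^-1 = zexpg (g v) (- j) * r^-1 * zexpg (g v) (- i).
  by rewrite cE !invgM -!zexpgN mulgA.
have cy : commute c (y * c * y^-1) by have := cc y^-1; rewrite conjgE invgK mulgA.
move/negP; apply; apply/eqP.
transitivity (c * (y * c * y^-1) * c^-1 * (y * c^-1 * y^-1)).
  by rewrite yV cV cE /y !zexpgD !mulgA.
by move: (y) cy => z cz; rewrite cz mulgK !mulgA mulgVK mulgK mulgV.
Qed.

Lemma cyclic_normal_comm_conj N c : cyclic_normal_subgroup N -> N c -> comm_conj c.
Proof.
move=> [[a NE] NJ] Nc x; have := NJ _ x Nc; move: Nc; rewrite NE => -[i _ <-] [j _ <-].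
exact/zexpg_comm2.
Qed.

Definition self_inverse_conj (u : G) := forall x, u ^ x = u \/ u ^ x = u^-1.

Lemma self_inverse_normal u : self_inverse_conj u ->
  cyclic_normal_subgroup (range (zexpg u)).
Proof.
move=> uJ; split; first by exists u.
move=> _ x [i _ <-]; rewrite zexpgJ; have [->|->] := uJ x; first by exists i.
by exists (- i)%R; rewrite // zexpgN zexpgV.
Qed.

(** The generator [a] is a power of [g v]. If it is non-trivial, it has infinite order, and its
    conjugates by [x] and by the inverse of [x] have exponents [k] and [l] with product 1. *)
Lemma cyclic_normal_self_inverse N v i : cyclic_normal_subgroup N ->
  N (zexpg (g v) i) -> third_dir L v -> self_inverse_conj (zexpg (g v) i).
Proof.
move=> cN Ni dir3; have [[a NE] NJ] := cN.
have Na : N a by rewrite NE; exists 1%R.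
have [d aE] := comm_conj_third_dir dir3 (cyclic_normal_comm_conj cN Na).
have aJ x : exists k, a ^ x = zexpg a k.
  by have := NJ _ x Na; rewrite NE => -[k _ <-]; exists k.
move: Ni; rewrite NE => -[m _ <-] x.
have [k ak] := aJ x; have [l al] := aJ x^-1.
have [d0|d0] := eqVneq d 0%R; first by left; rewrite zexpgJ aE d0 conj1g.
have kl : (k * l = 1)%R.
  apply: (mulfI d0); rewrite mulr1; apply: (@vgen_inj _ L T Gamma_nonempty Gamma_connected
    T_maximal v).
  by rewrite zexpgM -aE mulrC zexpgM -al -zexpgJ -ak -conjgM mulgV conjg1.
have : (k %| 1)%Z by apply/dvdzP; exists l; rewrite mulrC.
rewrite dvdz1 => /eqP k1; have : k = 1%R \/ k = (- 1)%R by lia.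
by case=> kE; rewrite zexpgJ ak kE; [left | right; rewrite zexpgN zexpgV].
Qed.

(** At a vertex with three directions, every cyclic normal subgroup lies in the vertex group. The
    exponents satisfying [J] form an ideal of the integers, and its generator gives the radical. *)
Lemma cyclic_radicalP : is_cyclic_radical (cyclic_radical G).
Proof.
have [v dir3] := third_dir_exists Gamma_nonempty Gamma_connected T_maximal
  G_not_solvable L_reduced.
have ginj := @vgen_inj _ L T Gamma_nonempty Gamma_connected T_maximal v.
pose J i := self_inverse_conj (zexpg (g v) i).
have Jsub i k q : J i -> J k -> J (i - q * k)%R.
  move=> Ji Jk x.
  have sgn m e : zexpg (g v) m ^ x = zexpg (g v) (e * m)%R -> forall m',
      zexpg (g v) (m' * m)%R ^ x = zexpg (g v) (e * (m' * m))%R.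
    by move=> mx m'; rewrite [(m' * m)%R]mulrC (zexpgM _ m) zexpgJ mx -zexpgM mulrA.
  have Je m : J m -> exists2 e : int, e = 1%R \/ e = (- 1)%R &
      zexpg (g v) m ^ x = zexpg (g v) (e * m)%R.
    by move=> Jm; case: (Jm x) => ->; [exists 1%R | exists (- 1)%R]; auto;
      rewrite ?mul1r ?mulN1r ?zexpgN.
  have [e1 e1E ix] := Je _ Ji; have [e2 e2E kx] := Je _ Jk.
  (* If both exponents are non-zero, their signs can be compared on the power with exponent [i * k],
     so they agree. *)
  have [e eE [ix' kx']] : exists2 e : int, e = 1%R \/ e = (- 1)%R &
      zexpg (g v) i ^ x = zexpg (g v) (e * i)%R /\
      zexpg (g v) k ^ x = zexpg (g v) (e * k)%R.
    have [i0|i0] := eqVneq i 0%R.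
      by exists e2; rewrite // kx i0 mulr0 conj1g.
    have [k0|k0] := eqVneq k 0%R.
      by exists e1; rewrite // ix k0 mulr0 conj1g.
    exists e1 => //; split=> //; rewrite kx; congr zexpg; congr (_ * _)%R.
    have := sgn _ _ kx i; rewrite [(i * k)%R]mulrC (sgn _ _ ix k).
    by move=> /ginj /mulIf e12; apply/esym/e12; rewrite mulf_neq0.
  have -> : zexpg (g v) (i - q * k)%R ^ x = zexpg (g v) (e * (i - q * k))%R.
    by rewrite zexpgB conjMg conjVg ix' (sgn _ _ kx') -zexpgB mulrBr.
  by case: eE => ->; [left; rewrite mul1r | right; rewrite mulN1r zexpgN].
have J0 : J 0%R by move=> x; left; rewrite conj1g.
have [d [Jd dmin]] : exists d : int, J d /\ forall j, J j -> (d %| j)%Z.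
  have [[n0 [n0_gt0 Jn0]]|nex] := pselect (exists n, (0 < n)%N /\ J (Posz n)).
    have exP : exists n, (0 < n)%N && `[< J (Posz n) >].
      by exists n0; rewrite n0_gt0; apply/asboolP.
    case: (ex_minnP exP) => d /andP[d_gt0 /asboolP Jd] dmin; exists (Posz d); split=> // j Jj.
    have Jr : J (j %% d)%Z by rewrite /modz; apply: Jsub.
    apply/dvdz_mod0P; apply/eqP/negPn/negP => r0.
    have d0 : (d%:Z != 0)%R by case: (d) d_gt0.
    have rE := gez0_abs (modz_ge0 j d0).
    have := dmin `|(j %% d)%Z|%N; rewrite absz_gt0 r0 rE /=.
    move/(_ (asboolT Jr)); rewrite leqNgt => /negP; apply.
    by rewrite -ltz_nat rE ltz_pmod.
  (* In this case the radical is trivial. *)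
  exists 0%R; split=> // j Jj; rewrite dvd0z; apply/negPn/negP => j0; apply: nex.
  exists `|j|%N; rewrite absz_gt0 j0; split=> //.
  have [->//|->] : Posz `|j|%N = j \/ Posz `|j|%N = (0 - 1 * j)%R by lia.
  exact: Jsub.
rewrite /cyclic_radical; case: xgetP => [N -> //|/(_ (range (zexpg (zexpg (g v) d))))].
case; split; first exact: self_inverse_normal.
move=> M cM u Mu; have [j uE] := comm_conj_third_dir dir3 (cyclic_normal_comm_conj cM Mu).
have /dmin/dvdzP[k jE] : J j by apply: (cyclic_normal_self_inverse cM); rewrite -?uE.
by exists k; rewrite // -zexpgM mulrC -jE uE.
Qed.

Lemma self_inverse_radical (u : G) : self_inverse_conj u -> cyclic_radical G u.
Proof.
move=> /self_inverse_normal uN; have [_ /(_ _ uN)] := cyclic_radicalP.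
by apply; exists 1%R.
Qed.

Lemma cyclic_radical_comm_conj (u : G) : cyclic_radical G u -> comm_conj u.
Proof. by apply: cyclic_normal_comm_conj; have [] := cyclic_radicalP. Qed.

End CyclicRadicalExists.

(** * The modular homomorphism *)

Section Modular.
Variables (Gamma : multigraph) (L : labeled_graph Gamma).
Variable T : {set edge Gamma}.
Local Notation V := (vertex Gamma).
Local Notation oedge := (oedge Gamma).
Local Notation G := (gbs L T).
Local Notation g := (@vgen _ L T).
Local Notation ed := (@estep _ L T).
Local Notation lab := (lab L).
Hypothesis Gamma_nonempty : nonempty_graph Gamma.
Hypothesis Gamma_connected : connected_graph Gamma.
Hypothesis T_maximal : maximal_subtree T.
Implicit Types (f : oedge) (v w : V) (x : G).

Section Commensurable.
Variable P : int -> Prop.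
Hypothesis P1 : P 1%R.
Hypothesis PM : forall i j, P i -> P j -> P (i * j)%R.
Hypothesis Plab : forall f, P (lab f).

(** Each tree edge contributes its two labels to the exponents. Keeping track of [P] yields
    p-numbers when all labels are p-numbers. *)
Lemma vgen_commensurable v w : exists i j,
  [/\ P i, P j & zexpg (g v) i = zexpg (g w) j].
Proof.
have [_ conn] := maximal_subtree_spanning Gamma_connected T_maximal.
have [s] := conn v w; elim: s v => [|f s IHs] v.
  by move=> /eqP->; exists 1%R, 1%R.
rewrite walk_cons => /and3P[fT /eqP <- /IHs[i [j [Pi Pj ij]]]].
exists (lab f * i)%R, (j * lab (bar f))%R; split; [exact: PM | exact: PM |].
have := estep_rel L T f i; rewrite estep_tree // mulg1 mul1g => ->.
by rewrite mulrC (zexpgM _ i) ij -zexpgM.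
Qed.

End Commensurable.

Lemma vgen_commensurable0 v w : exists i j,
  [/\ i != 0%R, j != 0%R & zexpg (g v) i = zexpg (g w) j].
Proof.
apply: (@vgen_commensurable (fun i => i != 0%R)) => // [i j i0 j0|f].
  exact: mulf_neq0.
exact: lab_neq0.
Qed.

Let ginj v := @vgen_inj _ L T Gamma_nonempty Gamma_connected T_maximal v.

Lemma vgen_conj v x : exists m n,
  [/\ m != 0%R, n != 0%R & zexpg (g v) m ^ x = zexpg (g v) n].
Proof.
move: x; apply: gbs_ind => [|w i x|f x] ; first by exists 1%R, 1%R; rewrite conjg1.
  move=> [m [n [m0 n0 xmn]]].
  have [k [l [k0 l0 kl]]] := vgen_commensurable0 v w.
  exists (k * m)%R, (k * n)%R; rewrite !mulf_neq0 //; split=> //.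
  rewrite conjgM zexpgM kl zexpgJ.
  have -> : zexpg (g w) l ^ zexpg (g w) i = zexpg (g w) l.
    by rewrite conjgE -!zexpgD -zexpgN -zexpgD addrC addrK.
  by rewrite -kl -zexpgM [(k * m)%R]mulrC (zexpgM _ m) zexpgJ xmn -zexpgM mulrC.
move=> [m [n [m0 n0 xmn]]].
have [i [j [i0 j0 ij]]] := vgen_commensurable0 v (src f).
have [k [l [k0 l0 kl]]] := vgen_commensurable0 (tgt f) v.
exists (i * (lab f * k) * m)%R, (l * (lab (bar f) * j) * n)%R.
rewrite !mulf_neq0 ?lab_neq0 //; split=> //; rewrite conjgM !zexpgM ij.
have -> : zexpg (zexpg (zexpg (zexpg (g (src f)) j) (lab f)) k) m ^ ed f =
    zexpg (g (tgt f)) (k * (lab (bar f) * j) * m).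
  rewrite conjgE.
  have -> : zexpg (zexpg (zexpg (zexpg (g (src f)) j) (lab f)) k) m =
      zexpg (g (src f)) (lab f * (j * k * m))%R.
    by rewrite -!zexpgM; congr zexpg; ring.
  by rewrite estep_rel mulKg; congr zexpg; ring.
rewrite -mulrA zexpgM kl -zexpgM.
have -> : (l * (lab (bar f) * j * m) = m * (l * (lab (bar f) * j)))%R by ring.
by rewrite zexpgM zexpgJ xmn -!zexpgM; congr zexpg; ring.
Qed.

Lemma vgen_neq1 v i : i != 0%R -> zexpg (g v) i != 1.
Proof. by apply: contraNneq => i1; apply/eqP/(@ginj v). Qed.

Lemma elliptic_commensurable v a : elliptic a -> a != 1 -> exists s t,
  [/\ s != 0%R, t != 0%R & zexpg a s = zexpg (g v) t].
Proof.
move=> [w [_ [i _ <-] [y ->]]] a1.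
have i0 : i != 0%R by apply: contraNneq a1 => ->; rewrite conj1g.
have [k [l [k0 l0 kl]]] := vgen_conj w y.
have [k' [l' [k0' l0' kl']]] := vgen_commensurable0 w v.
exists (k * k')%R, (l' * (l * i))%R; rewrite !mulf_neq0 //; split=> //.
rewrite -[presgen _ _]/(g w) -zexpgJ -zexpgM.
have -> : (i * (k * k') = k * (i * k'))%R by ring.
rewrite zexpgM zexpgJ kl -zexpgM.
have -> : (l * (i * k') = k' * (l * i))%R by ring.
by rewrite zexpgM kl' -zexpgM.
Qed.

Lemma modularP v x m n : m != 0%R -> n != 0%R ->
  zexpg (g v) m ^ x = zexpg (g v) n -> modular L T x = (n%:~R / m%:~R)%R.
Proof.
move=> m0 n0 xmn; rewrite /modular; case: xgetP => [q -> |]; last first.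
  move=> /(_ (n%:~R / m%:~R)%R); case; exists (g v), m, n; split=> //; split.
    by exists v, (g v); [exists 1%R | exists 1; rewrite conjg1].
  exact: (@vgen_neq1 v 1%R).
move=> [a [m' [n' [[aell a1] [m0' n0'] xmn' ->]]]].
have [s [t [s0 t0 st]]] := elliptic_commensurable v aell a1.
have : (t * n' * m = n * t * m')%R.
  apply: (@ginj v).
  have -> : (t * n' * m = t * (n' * m))%R by ring.
  rewrite (zexpgM _ t) -st -zexpgM.
  have -> : (s * (n' * m) = n' * (s * m))%R by ring.
  rewrite (zexpgM _ n') -xmn' -zexpgJ -zexpgM.
  have -> : (m' * (s * m) = s * (m' * m))%R by ring.
  rewrite (zexpgM _ s) st -zexpgM.
  have -> : (t * (m' * m) = m * (t * m'))%R by ring.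
  by rewrite (zexpgM _ m) zexpgJ xmn -zexpgM mulrA.
rewrite -mulrA mulrC [(n * t)%R]mulrC -[(t * n * m')%R]mulrA [(t * _)%R]mulrC.
move=> /(mulIf t0) E; apply/eqP; rewrite eqr_div ?intr_eq0 //.
by rewrite -!intrM eqr_int E.
Qed.

Lemma modular_conj v x : exists m n, [/\ m != 0%R, n != 0%R,
  zexpg (g v) m ^ x = zexpg (g v) n & modular L T x = (n%:~R / m%:~R)%R].
Proof.
have [m [n [m0 n0 xmn]]] := vgen_conj v x.
by exists m, n; split=> //; apply: modularP xmn.
Qed.

(** [z] is a common power of all vertex generators, centralised or inverted according to the modular
    homomorphism. [chi v] is the translation length of [g v] in the scale in which [z] has length
    [D]. *)
Record unimodular_data (P : int -> Prop) (chi n : V -> int) (D : int) (z : G) : Prop := {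
  ud_P : forall v, P (chi v) /\ P (n v);
  ud_PD : P D;
  ud_D : forall v, (chi v * n v = D)%R;
  ud_z : forall v, z = zexpg (g v) (n v);
  ud_lab : forall f, (lab f %| n (src f))%Z;
  ud_conj1 : forall x, modular L T x = 1%R -> z ^ x = z;
  ud_conjN1 : forall x, modular L T x = (-1)%R -> z ^ x = z^-1;
  ud_rel1 : forall f, modular L T (ed f) = 1%R ->
    (lab f * chi (src f) = lab (bar f) * chi (tgt f))%R;
  ud_relN1 : forall f, modular L T (ed f) = (-1)%R ->
    (lab f * chi (src f) = - (lab (bar f) * chi (tgt f)))%R
}.

Lemma unimodular_data_exists (P : int -> Prop) : P 1%R ->
  (forall i j, P i -> P j -> P (i * j)%R) -> (forall f, P (lab f)) ->
  (forall i, P i -> i != 0%R) ->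
  (forall x, modular L T x = 1%R \/ modular L T x = (-1)%R) ->
  exists chi n D z, unimodular_data P chi n D z.
Proof.
move=> P1 PM Plab P0 uni; have /card_gt0P[v0 _] := Gamma_nonempty.
have /choice[i] := fun v => vgen_commensurable P1 PM Plab v v0.
move=> /choice[j ijP].
have Pprod (I : finType) (Q : pred I) (F : I -> int) :
    (forall k, P (F k)) -> P (\prod_(k | Q k) F k)%R.
  by move=> PF; elim/big_ind: _.
(* Completing each [j v] by the other factors leads to a common power of the vertex generators; the
   factor [Lam] makes every label divide the exponents. *)
pose Lam := (\prod_(f : oedge) lab f)%R.
pose J v := (\prod_(w | w != v) j w)%R.
pose n v := (i v * (J v * Lam))%R.
pose D := (\prod_v n v)%R; pose chi v := (\prod_(w | w != v) n w)%R.
pose z := zexpg (g v0) ((\prod_w j w) * Lam)%R.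
have Pn v : P (n v).
  by have [Pi _ _] := ijP v; apply/(PM) => //; apply/(PM); apply/(Pprod) => // w;
    have [] := ijP w.
have n0 v : n v != 0%R by apply: P0.
have chiD v : (chi v * n v = D)%R by rewrite /D (bigD1 v) //= mulrC.
have zE v : z = zexpg (g v) (n v).
  have [_ _ ij] := ijP v; rewrite /n zexpgM ij -zexpgM /z (bigD1 v) //=.
  by rewrite mulrA.
have labn f : (lab f %| n (src f))%Z.
  by rewrite /n /Lam (bigD1 f) //=; apply/dvdz_mull/dvdz_mull/dvdz_mulr.
have zed f : exists2 e : int, modular L T (ed f) = e%:~R%R &
    z ^ ed f = zexpg z e /\
    (lab f * chi (src f) = e * (lab (bar f) * chi (tgt f)))%R.
  have /dvdzP[k nk] := labn f.
  have k0 : k != 0%R by apply: contraNneq (n0 (src f)) => k0; rewrite nk k0 mul0r.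
  have zf : z ^ ed f = zexpg (g (tgt f)) (lab (bar f) * k).
    by rewrite (zE (src f)) nk mulrC conjgE estep_rel mulKg.
  have := @modularP (tgt f) (ed f) _ _ (n0 (tgt f)) (mulf_neq0 (lab_neq0 L (bar f)) k0).
  rewrite -zE => /(_ zf) modE.
  have [e eE] : exists2 e : int, modular L T (ed f) = e%:~R%R & (e * e = 1)%R.
    by case: (uni (ed f)) => ->; [exists 1%R | exists (-1)%R].
  move=> ee; have kn : (lab (bar f) * k = e * n (tgt f))%R.
    move: modE; rewrite eE => /eqP; rewrite eq_sym.
    rewrite (can2_eq (mulfVK _) (mulfK _)) ?intr_eq0 //.
    by rewrite -intrM eqr_int => /eqP.
  exists e => //; split; first by rewrite zf kn mulrC zexpgM -zE.
  apply: (mulIf k0); transitivity D.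
    by rewrite -(chiD (src f)) nk; ring.
  rewrite -(chiD (tgt f)) -[n (tgt f)]mul1r -ee -mulrA -kn; ring.
have zconj x : exists2 e : int, e = 1%R \/ e = (-1)%R & z ^ x = zexpg z e.
  move: x; apply: gbs_ind => [|v k x [e eE ze]|f x [e eE ze]].
  - by exists 1%R; [left | rewrite conjg1].
  - exists e => //; rewrite conjgM -ze; congr (_ ^ _); rewrite (zE v).
    by rewrite conjgE -!zexpgD -zexpgN -zexpgD addrC addrK.
  have [e' eM [ze' _]] := zed f; exists (e * e')%R.
    have [e1|e1] : e' = 1%R \/ e' = (-1)%R.
      by case: (uni (ed f)); rewrite eM => /eqP; [rewrite (eqr_int _ _ 1) |
        rewrite (eqr_int _ _ (-1))] => /eqP; [left | right].
      by rewrite e1 mulr1.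
    by rewrite e1; case: eE => ->; [right | left].
  by rewrite conjgM ze' zexpgJ ze -zexpgM.
have zmod x e : z ^ x = zexpg z e -> e != 0%R -> modular L T x = e%:~R%R.
  move=> ze e0; have := @modularP v0 x _ _ (n0 v0) (mulf_neq0 (n0 v0) e0).
  rewrite (zexpgM _ (n v0)) -zE => /(_ ze) ->.
  by rewrite intrM mulrC mulKf ?intr_eq0.
exists chi, n, D, z; split=> //.
- by move=> v; split=> //; apply: Pprod.
- exact: Pprod.
- move=> x x1; have [e eE ze] := zconj x; case: eE => eE; rewrite ze eE //.
  by have := zmod x e ze; rewrite x1 eE => /(_ isT)/eqP.
- move=> x x1; have [e eE ze] := zconj x; case: eE => eE; rewrite ze eE //.
  by have := zmod x e ze; rewrite x1 eE => /(_ isT)/eqP.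
- move=> f f1; have [e eM [_ ->]] := zed f.
  have -> : e = 1%R by apply/eqP; rewrite -(eqr_int rat) -eM f1.
  by rewrite mul1r.
- move=> f f1; have [e eM [_ ->]] := zed f.
  have -> : e = (-1)%R by apply/eqP; rewrite -(eqr_int rat) -eM f1.
  by rewrite mulN1r.
Qed.

End Modular.

(** * Consequences of residual nilpotence *)

Lemma residually_eq1 (C : groupType -> Prop) (G : groupType) (x : G) :
  residually C G ->
  (forall (H : groupType) (sigma : {multiplicative G -> H}), C H -> sigma x = 1) ->
  x = 1.
Proof.
move=> res triv; apply/eqP/negPn/negP => /res[H [sigma [CH _ /eqP]]]; apply.
exact: triv.
Qed.

Lemma has_order_dvd (H : groupType) (a : H) o j : has_order a o -> zexpg a j = 1 ->
  (o %| j)%Z.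
Proof.
move=> [o0 ao omin] aj; have oz : (o%:Z != 0)%R by case: (o) o0.
apply/dvdz_mod0P/eqP/negPn/negP => r0.
have rE := gez0_abs (modz_ge0 j oz).
have := omin `|(j %% o)%Z|%N; rewrite absz_gt0 r0 /= -ltz_nat rE ltz_pmod //.
move=> /(_ isT) /eqP; apply; rewrite -[LHS]/(zexpg a _%:Z) rE.
have := aj; rewrite {1}(divz_eq j o) zexpgD mulrC zexpgM.
by rewrite [zexpg a o]ao zexpg1n mul1g.
Qed.

(** With [d] the gcd of [m] and the order of [a], the order of the first power, hence of its
    conjugate, divides [o']. So [d] divides [n], and the powers of exponents [d] and [m] generate
    the same subgroup. *)
Lemma conj_powers_same_subgroup (H : groupType) (a y : H) N m n : N != 0%R ->
  zexpg a N = 1 -> zexpg a m ^ y = zexpg a n -> exists k, zexpg a n = zexpg (zexpg a m) k.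
Proof.
move=> N0 aN amn; have aN' : a ^+ `|N| = 1.
  by case: N N0 aN => k _ aN //; apply: invg_inj; rewrite invg1.
have [|o ao _] := has_order_exists _ aN'; first by rewrite absz_gt0.
have [o0 ao1 _] := ao; pose d := gcdz m o.
have [/dvdzP[m' mE] /dvdzP[o' oE]] : (d %| m)%Z /\ (d %| Posz o)%Z.
  by rewrite dvdz_gcdl dvdz_gcdr.
have [u [t ut]] := Bezoutz m o; rewrite -/d in ut.
have o'0 : o' != 0%R.
  by apply: contraTneq o0 => o'0; move/eqP: oE; rewrite o'0 mul0r eqz_nat => /eqP->.
have /dvdzP[e nE] : (d %| n)%Z.
  rewrite -(dvdz_mul2l o'0) -oE; apply: (has_order_dvd ao).
  rewrite mulrC zexpgM -amn -zexpgJ -zexpgM mE.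
  have -> : (m' * d * o' = Posz o * m')%R by rewrite oE; ring.
  by rewrite zexpgM [zexpg a (Posz o)]ao1 zexpg1n conj1g.
exists (u * e)%R; rewrite -zexpgM.
have -> : n = (m * (u * e) + Posz o * (t * e))%R by rewrite nE -ut; ring.
by rewrite zexpgD [X in _ * X]zexpgM [zexpg a (Posz o)]ao1 zexpg1n mulg1.
Qed.

Section ResiduallyNilpotent.
Variables (Gamma : multigraph) (L : labeled_graph Gamma).
Variable T : {set edge Gamma}.
Local Notation V := (vertex Gamma).
Local Notation oedge := (oedge Gamma).
Local Notation G := (gbs L T).
Local Notation g := (@vgen _ L T).
Local Notation ed := (@estep _ L T).
Hypothesis Gamma_nonempty : nonempty_graph Gamma.
Hypothesis Gamma_connected : connected_graph Gamma.
Hypothesis T_maximal : maximal_subtree T.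
Hypothesis G_not_solvable : ~ solvable G.
Hypothesis L_reduced : reduced L.
Hypothesis G_rn : residually nilpotent G.
Implicit Types (f : oedge) (v w : V) (x : G).

Let ginj v := @vgen_inj _ L T Gamma_nonempty Gamma_connected T_maximal v.

Lemma commute_of_rn x y :
  (forall (H : groupType) (sigma : {multiplicative G -> H}), nilpotent H ->
    commute (sigma x) (sigma y)) -> commute x y.
Proof.
move=> com; apply/commgP/eqP/(residually_eq1 G_rn) => H sigma Hn.
by rewrite homR; apply/eqP/commgP/com.
Qed.

(** In nilpotent quotients [g v] has finite order. For a suitable exponent, the same in all
    quotients, the corresponding power of [g v] generates a subgroup that is stable under all
    generators. *)
Lemma rn_comm_conj v x m n : m != n -> zexpg (g v) m ^ x = zexpg (g v) n ->
  exists2 R, R != 0%R & comm_conj (zexpg (g v) R).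
Proof.
move=> mn xmn.
have /choice[mf mfP] : forall f, exists m', m' != 0%R /\ exists n',
    zexpg (g v) m' ^ ed f = zexpg (g v) n'.
  move=> f; have [m' [n' [m'0 _ E]]] :=
    vgen_conj Gamma_connected T_maximal v (ed f).
  by exists m'; split=> //; exists n'.
have /choice[kw kwP] : forall w, exists k, k != 0%R /\ exists l,
    zexpg (g v) k = zexpg (g w) l.
  move=> w; have [k [l [k0 _ E]]] :=
    vgen_commensurable0 L Gamma_connected T_maximal v w.
  by exists k; split=> //; exists l.
(* Powers of [g v] with exponent divisible by [mf f] are conjugated by [ed f] into the same vertex
   group; those with exponent divisible by [kw w] commute with [g w]. *)
pose Rf := (\prod_(f : oedge) mf f)%R; pose Rw := (\prod_w kw w)%R.
exists (Rf * Rw)%R.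
  rewrite mulf_neq0 //; apply/prodf_neq0 => i _; [by have [] := mfP i | by have [] := kwP i].
move=> y; apply: commute_of_rn => H sigma Hn; rewrite homJ homZ.
set a := sigma (g v); set c := zexpg a _.
have [N aN] : exists N, zexpg a ((n - m) ^+ N)%R = 1.
  apply: (@nilpotent_conj_exp _ _ (sigma x)) => //.
  by rewrite -!homZ -homJ xmn.
have nm0 : ((n - m) ^+ N)%R != 0%R by rewrite expf_neq0 // subr_eq0 eq_sym.
suff stable u : range (zexpg c) u -> range (zexpg c) (u ^ sigma y).
  have [|k _ <-] := stable c; first by exists 1%R.
  exact: zexpg_comm.
elim/gbs_ind: y u => [|w i y IHy|f y IHy] u cu; first by rewrite hom1 conjg1.
  rewrite gmulfM conjgM; apply: IHy; suff -> : u ^ sigma (zexpg (g w) i) = u by [].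
  case: cu => k _ <-; rewrite zexpgJ; congr zexpg.
  have [_ [l kl]] := kwP w; rewrite /c /Rw (bigD1 w) //= mulrA [(Rf * _)%R]mulrC.
  rewrite -mulrA zexpgM zexpgJ /a -homZ kl -homJ; congr (zexpg (sigma _) _).
  by rewrite conjgE -!zexpgD -zexpgN -zexpgD addrC addrK.
rewrite gmulfM conjgM; apply: IHy.
case: cu => k _ <-; rewrite zexpgJ.
have [_ [n' mn']] := mfP f.
have [l lE] : exists l, zexpg a n' = zexpg (zexpg a (mf f)) l.
  apply: (conj_powers_same_subgroup nm0 aN (y := sigma (ed f))).
  by rewrite -!homZ -homJ mn'.
pose r := (\prod_(f' | f' != f) mf f' * Rw)%R.
have cE : c = zexpg (zexpg a (mf f)) r by rewrite /c /Rf (bigD1 f) //= -mulrA zexpgM.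
exists (l * k)%R => //; rewrite zexpgM; congr zexpg.
rewrite cE zexpgJ -[zexpg a _ in RHS]homZ -homJ mn' homZ -/a lE -!zexpgM.
by congr zexpg; ring.
Qed.

Lemma rn_modular x : modular L T x = 1%R \/ modular L T x = (-1)%R.
Proof.
have /card_gt0P[v _] := Gamma_nonempty.
have [m [n [m0 n0 xmn ->]]] :=
  modular_conj Gamma_nonempty Gamma_connected T_maximal v x.
suff mn : (`|n| = `|m|)%N.
  have [->|->] : n = m \/ n = (- m)%R by lia.
    by left; rewrite divff ?intr_eq0.
  by right; rewrite mulrNz mulNr divff ?intr_eq0.
have [->//|nm] := eqVneq m n.
have [R R0 Rcc] := rn_comm_conj nm xmn.
have ell y := comm_conj_elliptic Gamma_nonempty Gamma_connected T_maximal
  G_not_solvable L_reduced v y Rcc.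
(* Among the exponents of the conjugates, one of least absolute value is taken; conjugating further
   by [x] and by its inverse gives the two inequalities between the absolute values of [m] and
   [n]. *)
pose conjs i := exists y, zexpg (g v) R ^ y = zexpg (g v) i.
have exP : exists k, `[< exists2 i, conjs i & `|i|%N = k >].
  by exists `|R|%N; apply/asboolP; exists R => //; exists 1; rewrite conjg1.
case: (ex_minnP exP) => k /asboolP[i [y yi] ik] kmin.
have i0 : i != 0%R.
  apply: contraNneq R0 => i0; apply/eqP/(@ginj v).
  by apply: (@conjg_inj _ y); rewrite yi i0 conj1g.
have i_min j : conjs j -> (`|i| <= `|j|)%N.
  by move=> cj; rewrite ik; apply: kmin; apply/asboolP; exists j.
have [j xj] := ell (y * x); have [j' xj'] := ell (y * x^-1).
have ij : (`|i| <= `|j|)%N by apply: i_min; exists (y * x).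
have ij' : (`|i| <= `|j'|)%N by apply: i_min; exists (y * x^-1).
have ratio a b : zexpg (g v) a ^ x = zexpg (g v) b -> (b * m = a * n)%R.
  move=> ab; apply: (@ginj v); rewrite (zexpgM _ b) -ab -zexpgJ -zexpgM.
  by rewrite [(a * m)%R]mulrC (zexpgM _ m) zexpgJ xmn -zexpgM mulrC.
have E : (j * m = i * n)%R by apply: ratio; rewrite -yi -conjgM.
have E' : (i * m = j' * n)%R by apply: ratio; rewrite -xj' -conjgM mulgVK.
have m0' : (0 < `|m|)%N by rewrite absz_gt0.
have n0' : (0 < `|n|)%N by rewrite absz_gt0.
have i0' : (0 < `|i|)%N by rewrite absz_gt0.
have E1 : (`|j| * `|m| = `|i| * `|n|)%N by rewrite -!abszM E.
have E2 : (`|i| * `|m| = `|j'| * `|n|)%N by rewrite -!abszM E'.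
apply/eqP; rewrite eqn_leq; apply/andP; split.
  by rewrite -(leq_pmul2l i0') E2 leq_mul2r ij' orbT.
by rewrite -(leq_pmul2l i0') -E1 leq_mul2r ij orbT.
Qed.

End ResiduallyNilpotent.

Lemma prime_part (N : int) p : prime p -> N != 0%R ->
  exists X k, N = (X * Posz (p ^ k))%R /\ ~~ (p %| X)%Z.
Proof.
move=> pp N0; have [m pm Nm] := pfactor_coprime pp (etrans (absz_gt0 _) N0).
have pm' : ~~ (p %| m)%N by rewrite -prime_coprime.
have [NE|NE] : N = Posz `|N| \/ N = (- Posz `|N|)%R by lia.
  by exists (Posz m), (logn p `|N|); split; first by rewrite {1}NE {1}Nm PoszM.
exists (- Posz m)%R, (logn p `|N|); split; last by rewrite dvdzE abszN.
by rewrite {1}NE {1}Nm PoszM mulNr.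
Qed.

(** * Labels and inverted elements under residual nilpotence *)

Section Labels.
Variables (Gamma : multigraph) (L : labeled_graph Gamma).
Variable T : {set edge Gamma}.
Local Notation V := (vertex Gamma).
Local Notation oedge := (oedge Gamma).
Local Notation G := (gbs L T).
Local Notation g := (@vgen _ L T).
Local Notation ed := (@estep _ L T).
Local Notation lab := (lab L).
Hypothesis Gamma_nonempty : nonempty_graph Gamma.
Hypothesis Gamma_connected : connected_graph Gamma.
Hypothesis T_maximal : maximal_subtree T.
Hypothesis G_not_solvable : ~ solvable G.
Hypothesis L_reduced : reduced L.
Hypothesis G_rn : residually nilpotent G.
Implicit Types (f : oedge) (v w : V) (x : G).

Let uni := rn_modular Gamma_nonempty Gamma_connected T_maximal G_not_solvable
  L_reduced G_rn.

(* Modulo a normal cyclic subgroup <z>, powers of [g] at the two ends of the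
   path h have orders that are powers of p and q, so they commute in every
   nilpotent quotient, while their commutator along h is reduced. *)
Lemma rn_labels_along f f' (h : G) p q : red f (bar f') h -> prime p -> prime q ->
  (p %| lab f)%Z -> (q %| lab f')%Z -> p = q.
Proof.
move=> rh pp qp pf qf'; apply/eqP/negPn/negP => npq.
have [chi [n [D [z ud]]]] := unimodular_data_exists Gamma_nonempty Gamma_connected
  T_maximal (P := fun i => i != 0%R) isT (fun i j => @mulf_neq0 _ i j)
  (fun f => lab_neq0 L f) (fun i i0 => i0) uni.
have [_ n0] := ud_P ud (src f); have [_ n0'] := ud_P ud (src f').
have [X [k [nX pX]]] := prime_part pp n0.
have [Y [l [nY qY]]] := prime_part qp n0'.
set v := src f in n0 nX; set w := src f' in n0' nY.
(* [p] divides [lab f] but not [X], so a turn with exponent [X] is no pinch; and [x] has p-power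
   order modulo [z]. *)
have fX : ~~ (lab f %| X)%Z by apply: contra pX; apply: dvdz_trans.
have fY : ~~ (lab f' %| Y)%Z by apply: contra qY; apply: dvdz_trans.
pose x := zexpg (g v) X; pose y := zexpg (g w) Y.
have xz : x ^+ (p ^ k) = z by rewrite (ud_z ud v) nX zexpgM.
have yz : y ^+ (q ^ l) = z by rewrite (ud_z ud w) nY zexpgM.
have zJ u : exists e : int, z ^ u = zexpg z e.
  have [/(ud_conj1 ud)->|/(ud_conjN1 ud)->] := uni u; first by exists 1%R.
  by exists (-1)%R; rewrite zexpgN.
have xyh : commute x (y ^ h^-1).
  apply: (commute_of_rn G_rn) => H sigma Hn.
  apply/commgP/eqP/(nilpotent_coprime_comm (m := p ^ k) (n := q ^ l)) => //.
  - by rewrite coprimeXl // coprimeXr // prime_coprime // dvdn_prime2.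
  - rewrite -homX xz -homR -[RHS](hom1 sigma); congr (sigma _); apply/eqP/commgP.
    have [e zE] := zJ h; have -> : z = (z ^ h) ^ h^-1 by rewrite conjgK.
    rewrite /commute -!conjMg; congr (_ ^ _); rewrite zE -yz.
    exact/commute_sym/zexpg_comm/commuteX.
  - rewrite -homX -homR -[RHS](hom1 sigma); congr (sigma _); apply/eqP/commgP.
    have [e zE] := zJ h^-1; rewrite -conjXg yz zE -xz.
    exact/zexpg_comm/commuteX.
have ndN d j : ~~ (d %| j)%Z -> ~~ (d %| (- j)%R)%Z by rewrite dvdz_opp.
have rhV := redV rh; rewrite barK in rhV.
have t1 j : ~~ (lab f' %| j)%Z -> turn L (bar f') f' j.
  by move=> nj; rewrite /turn tgt_bar eqxx barK eqxx.
have t2 j : ~~ (lab f %| j)%Z -> turn L (bar f) f j.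
  by move=> nj; rewrite /turn tgt_bar eqxx barK eqxx.
have w1 := redM rh rhV (t1 _ fY); have w2 := redM w1 rh (t2 _ (ndN _ _ fX)).
have w3 := redM w2 rhV (t1 _ (ndN _ _ fY)).
have := red_neq1 Gamma_nonempty Gamma_connected T_maximal X 0%R w3 (esym (tgt_bar f)).
rewrite mulg1 -/v -/w !zexpgN -/x -/y => /eqP; apply.
move: xyh; rewrite conjgE invgK mulgA => xyh.
transitivity (x * (h * y * h^-1) * x^-1 * (h * y * h^-1)^-1).
  by rewrite !invgM invgK !mulgA.
by rewrite xyh mulgK mulgV.
Qed.

(** Returns along [f] and along [f'] in succession form a reduced path from [f] to [bar f']; if they
    coincide, one return is enough. *)
Lemma rn_labels_at f f' p q : src f = src f' -> prime p -> prime q ->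
  (p %| lab f)%Z -> (q %| lab f')%Z -> p = q.
Proof.
move=> ff' pp qp pf qf'.
have [r rr] := red_return (T := T) Gamma_connected G_not_solvable L_reduced f.
have [f'E|nff'] := eqVneq f' f.
  by apply: (rn_labels_along rr pp qp pf); rewrite -f'E.
have [r' rr'] := red_return (T := T) Gamma_connected G_not_solvable L_reduced f'.
apply: (rn_labels_along (redM0 rr rr' _) pp qp pf qf').
by rewrite /turn tgt_bar ff' eqxx barK (negPf nff').
Qed.

Lemma rn_labels_edge f p q : prime p -> prime q ->
  (p %| lab f)%Z -> (q %| lab (bar f))%Z -> p = q.
Proof.
move=> pp qp pf qf; apply: (@rn_labels_along f (bar f) (ed f)) => //.
by rewrite barK; apply: red1.
Qed.

Lemma rn_labels : exists2 p, prime p & forall e eps, p.-nat `|L e eps|%N.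
Proof.
have pdivf f : `|lab f|%N <> 1%N -> prime (pdiv `|lab f|) /\ (pdiv `|lab f| %| lab f)%Z.
  move=> f1; split; last by rewrite dvdzE pdiv_dvd.
  by apply: pdiv_prime; rewrite ltn_neqAle absz_gt0 lab_neq0 eq_sym andbT; apply/eqP.
(* If all labels are 1 or -1, they are p-numbers for every prime; 2 is taken. *)
have [[f f1]|all1] := pselect (exists f, `|lab f|%N <> 1%N); last first.
  exists 2 => // e eps; have -> : `|L e eps|%N = 1%N.
    by apply: contrapT => ne; apply: all1; exists (e, eps).
  by [].
have [pp pf] := pdivf _ f1; set p := pdiv _ in pp pf; exists p => // e eps.
(* The prime spreads along walks: a label 1 or -1 only occurs on a loop, which does not change the
   vertex, and otherwise labels at one vertex, or on one edge, share their prime. *)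
have all_v : forall v, exists2 f', src f' = v & (p %| lab f')%Z.
  apply: (walk_closed_prop Gamma_connected (v := src f)); first by exists f.
  move=> f' [f2 f2v pf2].
  have [l1|l1] := eqVneq `|lab f'|%N 1%N.
    by rewrite (loop_of_lab1 L_reduced l1); exists f2.
  have [q1p q1f] := pdivf _ (elimN eqP l1).
  have pq1 := rn_labels_at f2v pp q1p pf2 q1f.
  have [l2|l2] := eqVneq `|lab (bar f')|%N 1%N.
    have := loop_of_lab1 L_reduced l2; rewrite tgt_bar src_bar => <-.
    by exists f2.
  have [q2p q2f] := pdivf _ (elimN eqP l2).
  rewrite -pq1 in q1f; exists (bar f') => //.
  by rewrite (rn_labels_edge pp q2p q1f q2f).
have [f2 f2v pf2] := all_v (src (e, eps)).
have l0 : (0 < `|L e eps|)%N by rewrite absz_gt0 label_neq0.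
apply/(pnatP _ l0) => q qp ql.
by rewrite inE /=; apply/eqP/esym/(rn_labels_at f2v pp qp pf2).
Qed.

(** In a nilpotent quotient the image of [a] becomes a power of the image of [z], so every [x] acts
    on it by the same sign as on [z]; by residual nilpotence this holds in the group itself. *)
Lemma rn_inverted_radical p : prime p -> p <> 2 -> (forall e eps, p.-nat `|L e eps|%N) ->
  forall a : G, elliptic a -> conjugate a a^-1 -> cyclic_radical G a.
Proof.
move=> pp p2 pL a [w [_ [i _ <-] [y aE]]] [u aV].
pose P (j : int) := p.-nat `|j|%N.
have P0 j : P j -> j != 0%R by rewrite /P -absz_gt0 => /andP[].
have PM j k : P j -> P k -> P (j * k)%R by rewrite /P abszM pnatM => -> ->.
have [chi [n [D [z ud]]]] := unimodular_data_exists Gamma_nonempty Gamma_connected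
  T_maximal (P := P) isT PM (fun f => pL f.1 f.2) P0 uni.
have [_ nw] := ud_P ud w; have z0 := ud_z ud w.
have an : zexpg a (n w) = zexpg z i ^ y.
  by rewrite aE -zexpgJ z0 -!zexpgM mulrC.
have zJ x : exists2 e : int, e = 1%R \/ e = (-1)%R & z ^ x = zexpg z e.
  have [/(ud_conj1 ud)->|/(ud_conjN1 ud)->] := uni x; first by exists 1%R; [left|].
  by exists (-1)%R; [right | rewrite zexpgN].
have aJ x (e : int) : z ^ x = zexpg z e -> a ^ x = zexpg a e.
  move=> zx; apply/(divg1_eq)/(residually_eq1 G_rn) => H sigma Hn.
  have [k ak] : exists k, zexpg (sigma a) ((-1 - 1) ^+ k)%R = 1.
    apply: (@nilpotent_conj_exp _ _ (sigma u)) => //.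
    by rewrite -!homZ -homJ zexpg1 -aV zexpgN.
  (* The p-number [n w] is odd while the order of [sigma a] divides a power of 2, so [sigma a] is a
     power of its own power with exponent [n w], which is conjugate to a power of [sigma z]. *)
  have [c [d cd]] := Bezoutz (n w) ((-1 - 1) ^+ k)%R.
  have g1 : gcdz (n w) ((-1 - 1) ^+ k)%R = 1%R.
    rewrite /gcdz abszX; congr Posz; apply/eqP; apply: coprimeXr.
    have n0 : (0 < `|n w|)%N by rewrite absz_gt0 P0.
    rewrite coprime_sym prime_coprime //; apply/negP => d2.
    by have := pnatP _ n0 nw 2 isT d2; rewrite inE => /eqP/esym.
  have [e' _ zy] := zJ y.
  have sa : sigma a = zexpg (sigma z) (e' * i * c)%R.
    have E1 : (1 = n w * c + (-1 - 1) ^+ k * d)%R.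
      by rewrite [(n w * c)%R]mulrC [(_ * d)%R]mulrC cd g1.
    rewrite -[LHS]zexpg1 E1 zexpgD !(zexpgM (sigma a)) ak zexpg1n mulg1 -homZ an.
    by rewrite zexpgJ zy -zexpgM homZ -zexpgM.
  rewrite gmulfM homV homJ homZ sa zexpgJ -homJ zx homZ -!zexpgM.
  by rewrite mulrC mulgV.
apply: self_inverse_radical => // x; have [e eE zx] := zJ x; rewrite (aJ x e zx).
by case: eE => ->; [left | right; rewrite zexpgN].
Qed.

End Labels.

(** * Residual finiteness by p-groups *)

Section ResiduallyP.
Variables (Gamma : multigraph) (L : labeled_graph Gamma).
Variable T : {set edge Gamma}.
Local Notation V := (vertex Gamma).
Local Notation E := (edge Gamma).
Local Notation oedge := (oedge Gamma).
Local Notation G := (gbs L T).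
Local Notation g := (@vgen _ L T).
Local Notation ed := (@estep _ L T).
Local Notation lab := (lab L).
Hypothesis Gamma_nonempty : nonempty_graph Gamma.
Hypothesis Gamma_connected : connected_graph Gamma.
Hypothesis T_maximal : maximal_subtree T.
Implicit Types (f : oedge) (v w : V) (x : G).
Variable p : nat.
Hypothesis p_prime : prime p.
Hypothesis labels_p : forall e eps, p.-nat `|L e eps|%N.
Hypothesis uni : forall x, modular L T x = 1%R \/ modular L T x = (-1)%R.

Local Notation pnumber := (fun i : int => is_true (p.-nat `|i|%N)).

Lemma pnumber_data : exists chi n D (z : G), unimodular_data pnumber chi n D z.
Proof.
apply: unimodular_data_exists => //.
- by move=> i j; rewrite abszM pnatM => -> ->.
- by move=> f; apply: labels_p.
- by move=> i; rewrite -absz_gt0 => /andP[].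
Qed.

Variables (chi n : V -> int) (D : int) (z : G).
Hypothesis ud : unimodular_data pnumber chi n D z.

Lemma chi_neq0 v : chi v != 0%R.
Proof. by have [] := ud_P ud v; rewrite -absz_gt0 => /andP[]. Qed.

Definition flips (e : E) : bool := modular L T (ed (e, true)) == (-1)%R.

Lemma flips_rel e : (L e true * chi (endpt e true)
  = (-1) ^+ flips e * (L e false * chi (endpt e false)))%R.
Proof.
rewrite /flips; case: eqP => [/(ud_relN1 ud)|ne].
  by rewrite /lab /src /tgt /= mulN1r.
case: (uni (ed (e, true))) => // /(ud_rel1 ud).
by rewrite /lab /src /tgt /= mul1r.
Qed.

Lemma label_chi_abs e : (`|(L e true * chi (endpt e true))%R|
  = `|(L e false * chi (endpt e false))%R|)%N.
Proof. by rewrite flips_rel; case: (flips e); rewrite ?mul1r ?mulN1r ?abszN. Qed.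

Lemma flips_rel_mod e (q : nat) : ((-1) ^+ flips e * (L e true * chi (endpt e true))%:~R
   = (L e false * chi (endpt e false))%:~R :> 'Z_q)%R.
Proof.
rewrite flips_rel; case: (flips e); rewrite ?mul1r ?mulN1r // rmorphN /=.
by rewrite opprK.
Qed.

(** The exponent makes this exceed [i] in absolute value, and makes it a multiple of [D] when [r] is
    the prime of which [D] is a power. *)
Definition large_power r (i : int) := (r ^ (`|i| + `|D|).+1)%N.

Lemma large_power_gt1 r i : (1 < r)%N -> (1 < large_power r i)%N.
Proof.
move=> r1; rewrite /large_power expnS; apply: (leq_trans r1).
by apply: leq_pmulr; rewrite expn_gt0 ltnW.
Qed.

Lemma large_power_ndvd r i : (1 < r)%N -> i != 0%R -> ~~ (large_power r i %| i)%Z.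
Proof.
move=> r1 i0; rewrite dvdzE; apply/negP => /dvdn_leq; rewrite absz_gt0 i0 => /(_ isT).
rewrite leqNgt => /negP; apply; apply: leq_trans (ltn_expl _ r1).
by rewrite ltnS leqW // leq_addr.
Qed.

(** The prime [r] may differ from [p]: a vertex generator acts by a translation, and only the
    congruences along the edges are required, which hold for every modulus up to sign. *)
Lemma finite_p_detects_vgen r v i : prime r -> (r = 2 \/ forall e, ~~ flips e) ->
  i != 0%R -> finite_p_detects r (zexpg (g v) i).
Proof.
move=> rp r2 i0; have r1 := prime_gt1 rp.
have ic0 : (i * chi v)%R != 0%R by rewrite mulf_neq0 ?chi_neq0.
apply: (@p_detect_vgen _ L T Gamma_nonempty Gamma_connected T_maximal chi flips
  (large_power r (i * chi v)) r rp) => //.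
- by rewrite pnatX pnat_id.
- exact: large_power_gt1.
- by move=> e fe; case: r2 => [->|/(_ e)/negP//]; rewrite dvdn_exp.
- by move=> e; apply: flips_rel_mod.
- exact: large_power_ndvd.
Qed.

Lemma label_chi_dvd f : (lab f * chi (src f) %| D)%Z.
Proof.
rewrite -(ud_D ud (src f)) [(lab f * _)%R]mulrC dvdz_mul2l ?chi_neq0 //.
exact: ud_lab ud f.
Qed.

(** All periods divide [D], hence the chosen power of [p]. *)
Lemma finite_p_detects_red f f' x i j : (p = 2 \/ forall e, ~~ flips e) ->
  red f f' x -> src f = tgt f' ->
  finite_p_detects p (zexpg (g (src f)) i * x * zexpg (g (src f)) j).
Proof.
move=> p2 rx ff'; have p1 := prime_gt1 p_prime.
have pq : p.-nat (large_power p 0) by rewrite pnatX pnat_id.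
apply: (@p_detect_red _ L T Gamma_nonempty Gamma_connected T_maximal chi flips
  (large_power p 0) p p_prime pq (large_power_gt1 _ p1) _ _ chi_neq0 label_chi_abs
  _ f f') => //.
- by move=> e fe; case: p2 => [->|/(_ e)/negP//]; rewrite dvdn_exp.
- by move=> e; apply: flips_rel_mod.
move=> e; apply: (dvdz_trans (label_chi_dvd (e, true))).
rewrite dvdzE /=; have [k Dk] := p_natP (ud_PD ud); rewrite Dk /large_power.
rewrite dvdn_exp2l // Dk add0n; apply/leqW/ltnW/ltn_expl => //.
Qed.

Lemma nontrivial_cases v x : x != 1 -> (exists2 i, i != 0%R & x = zexpg (g v) i) \/
  exists f f' y i j, [/\ red f f' y, src f = v, tgt f' = v
    & x = zexpg (g v) i * y * zexpg (g v) j].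
Proof.
have [_ conn] := maximal_subtree_spanning Gamma_connected T_maximal => x1.
case: (normal_formP conn v v x) => [[_ [i xE]]|]; [left|by right].
by exists i => //; apply: contraNneq x1 => i0; rewrite xE i0.
Qed.

Lemma residually_finite_p : (p = 2 \/ forall e, ~~ flips e) ->
  forall x, x != 1 -> finite_p_detects p x.
Proof.
move=> p2 x x1; have /card_gt0P[v _] := Gamma_nonempty.
have [[i i0 ->]|[f [f' [y [i [j [ry fv f'v ->]]]]]]] := nontrivial_cases v x1.
  exact: finite_p_detects_vgen.
by rewrite -fv; apply: finite_p_detects_red ry _; rewrite // fv.
Qed.

(** * Orientation signs and reduced paths for odd primes *)

Section OddPrime.
Hypothesis G_not_solvable : ~ solvable G.
Hypothesis L_reduced : reduced L.
Hypothesis inverted_radical : forall a : G, elliptic a -> conjugate a a^-1 ->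
  cyclic_radical G a.

(* Signs for which all edges of less than maximal period preserve the
   orientation: two vertices have the same sign when the elements [half v], of
   order p modulo the elements of maximal period, are conjugate in G. *)
Variable f0 : oedge.
Local Notation chi' v := (chi v * Posz p)%R.
Local Notation period f := (lab f * chi' (src f))%R.
Hypothesis f0_max : forall f, (`|period f| <= `|period f0|)%N.
Let q := `|period f0|%N.

Lemma period_pnat f : p.-nat `|period f|%N.
Proof.
have [chip _] := ud_P ud (src f).
by rewrite !abszM !pnatM labels_p chip pnat_id.
Qed.

(** The extra factor [p] in the translation lengths makes every period divisible by [p]. *)
Lemma q_gt1 : (1 < q)%N.
Proof.
have /dvdn_leq : p %| q by rewrite /q !abszM dvdn_mull // dvdn_mull.
have q0 : (0 < q)%N by have /andP[] := period_pnat f0.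
by move=> /(_ q0); apply: leq_trans (prime_gt1 p_prime).
Qed.

Lemma period_dvd_q f : (period f %| Posz q)%Z.
Proof.
rewrite dvdzE /=; have [k kE] := p_natP (period_pnat f).
have [l lE] := p_natP (period_pnat f0); have := f0_max f.
by rewrite /q kE lE leq_exp2l ?prime_gt1 // => kl; rewrite dvdn_exp2l.
Qed.

Lemma period_dvd_qp f : `|period f|%N != q -> (period f %| Posz (q %/ p))%Z.
Proof.
rewrite dvdzE /=; have [k kE] := p_natP (period_pnat f).
have [l lE] := p_natP (period_pnat f0); have := f0_max f.
have q1 := q_gt1; rewrite /q in q1 *; rewrite kE lE in q1 *.
rewrite leq_exp2l ?prime_gt1 // => kl nkl.
have {nkl} kl' : (k < l)%N by rewrite ltn_neqAle kl andbT; apply: contraNneq nkl => ->.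
case: l kl' {lE q1 kl} => // l kl; rewrite expnSr mulnK ?prime_gt0 //.
by rewrite dvdn_exp2l.
Qed.

(** When the length of [g v] divides [q %/ p], this is its power of length [q %/ p]. *)
Definition half v : G := zexpg (g v) (Posz (q %/ p) %/ chi' v)%Z.

Lemma half_exp v : (chi' v %| Posz (q %/ p))%Z -> forall j, half v = zexpg (g v) j ->
  (j * chi' v = Posz (q %/ p))%R.
Proof.
move=> dv j; rewrite /half.
by move=> /(vgen_inj Gamma_nonempty Gamma_connected T_maximal) <-; rewrite divzK.
Qed.

(** Otherwise this element would lie in the cyclic radical, hence in the edge group of [f0], and its
    length [q %/ p] would be a multiple of the period [q]. *)
Lemma half_not_inverted v : (chi' v %| Posz (q %/ p))%Z ->
  ~ conjugate (half v) (half v)^-1.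
Proof.
move=> dv inv; have uell : elliptic (half v).
  by exists v, (half v); [eexists | exists 1; rewrite conjg1].
have ucc := cyclic_radical_comm_conj Gamma_nonempty Gamma_connected T_maximal
  G_not_solvable L_reduced (inverted_radical uell inv).
have [j] := comm_conj_elliptic Gamma_nonempty Gamma_connected T_maximal
  G_not_solvable L_reduced (src f0) 1 ucc; rewrite conjg1 -/(half v) => uj.
have /dvdzP[k jE] : (lab f0 %| j)%Z.
  apply: (comm_conj_dvd Gamma_nonempty Gamma_connected T_maximal G_not_solvable L_reduced).
  by rewrite -uj.
set i := (Posz (q %/ p) %/ chi' v)%Z in uj.
have iE : (i * chi' v = Posz (q %/ p))%R by apply: half_exp.
have zw := ud_z ud (src f0); have zv := ud_z ud v.
have n0 : n v != 0%R by have [_] := ud_P ud v; rewrite -absz_gt0 => /andP[].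
have D0 : D != 0%R by rewrite -(ud_D ud v) mulf_neq0 // chi_neq0.
have ij : (i * n (src f0) = j * n v)%R.
  apply: (mulfI n0); apply: (@vgen_inj _ L T Gamma_nonempty Gamma_connected T_maximal v).
  have -> : (n v * (i * n (src f0)) = i * (n v * n (src f0)))%R by ring.
  rewrite (zexpgM _ i) [zexpg (g v) i]uj -zexpgM.
  have -> : (j * (n v * n (src f0)) = n (src f0) * (j * n v))%R by ring.
  by rewrite (zexpgM _ (n (src f0))) -zw zv -zexpgM.
have jE' : (j * chi' (src f0) = Posz (q %/ p))%R.
  rewrite -iE; apply: (mulIf D0).
  rewrite -{1}(ud_D ud v) -(ud_D ud (src f0)).
  transitivity (j * n v * (chi (src f0) * chi v * Posz p))%R; first by ring.
  by rewrite -ij; ring.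
have q0 : (0 < q)%N := ltnW q_gt1.
have : (Posz q %| Posz (q %/ p))%Z.
  rewrite -jE' jE dvdzE -mulrA abszM /=; apply: dvdn_mull.
  by rewrite /q.
rewrite dvdzE /= => /dvdn_leq; rewrite divn_gt0 ?prime_gt0 //.
have pq : (p <= q)%N.
  by apply: dvdn_leq => //; rewrite /q !abszM dvdn_mull // dvdn_mull.
by rewrite pq leqNgt ltn_Pdiv ?prime_gt1 // => /(_ isT).
Qed.

Lemma conjugate_sym (x y : G) : conjugate x y -> conjugate y x.
Proof. by move=> [u ->]; exists u^-1; rewrite conjgK. Qed.

Lemma conjugate_trans (x y t : G) : conjugate x y -> conjugate y t -> conjugate x t.
Proof. by move=> [u ->] [r ->]; exists (u * r); rewrite conjgM. Qed.

Lemma conjugateV (x y : G) : conjugate x y -> conjugate x^-1 y^-1.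
Proof. by move=> [u ->]; exists u; rewrite conjVg. Qed.

Definition conj_pm (x y : G) := conjugate x y \/ conjugate x y^-1.

Lemma conj_pm_sym x y : conj_pm x y -> conj_pm y x.
Proof.
case=> [|/conjugateV]; rewrite ?invgK => /conjugate_sym; first by left.
by right.
Qed.

Lemma conj_pm_trans x y t : conj_pm x y -> conj_pm y t -> conj_pm x t.
Proof.
case=> [xy|xy] [yt|/conjugateV yt].
- by left; apply: conjugate_trans xy yt.
- by right; have := conjugateV yt; rewrite !invgK => /(conjugate_trans xy).
- by right; have /(conjugate_trans xy) := conjugateV yt.
- by left; move: yt; rewrite invgK => /(conjugate_trans xy).
Qed.

(** The result of [pick] depends only on the predicate, so all vertices of a class get the same
    representative. *)
Definition root v : V := odflt v [pick w | `[< conj_pm (half v) (half w) >]].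

Definition half_sign v : bool := ~~ `[< conjugate (half (root v)) (half v) >].

Lemma half_edge e : `|period (e, true)|%N != q ->
  conjugate (half (endpt e true))
    (zexpg (half (endpt e false)) ((-1) ^+ flips e)%R).
Proof.
move=> eq; have /dvdzP[k kE] := period_dvd_qp eq.
exists (ed (e, true)); set f := (e, true).
have chi'0 w : (chi' w)%R != 0%R.
  by rewrite mulf_neq0 ?chi_neq0 // -absz_gt0 prime_gt0.
have -> : half (endpt e true) = zexpg (g (src f)) (lab f * k)%R.
  congr zexpg; rewrite kE; rewrite /src /lab /=.
  have -> : (k * (L e true * chi' (endpt e true)) = L e true * k * chi' (endpt e true))%R
    by ring.
  by rewrite mulzK.
rewrite conjgE estep_rel mulKg -zexpgM; congr zexpg.
rewrite kE [period _](_ : _ = ((-1) ^+ flips e * L e false) * chi' (endpt e false))%R.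
  rewrite mulrA mulzK // /lab /=.
  by case: (flips e); rewrite ?expr0 ?expr1 /=; ring.
by rewrite /lab /src /= mulrA flips_rel !mulrA.
Qed.

(** The edge conjugates the element [half] at one end to the one at the other end or to its inverse,
    according to [flips]. The signs are consistent because these elements are not conjugate to their
    inverses. *)
Lemma half_sign_edge e : `|period (e, true)|%N != q ->
  half_sign (endpt e true) = half_sign (endpt e false) (+) flips e.
Proof.
move=> eq; have he := half_edge eq; set v := endpt e true in he *.
set w := endpt e false in he *.
have dw : (chi' w %| Posz (q %/ p))%Z.
  apply: dvdz_trans (period_dvd_qp eq); rewrite /lab /src /= mulrA flips_rel.
  by rewrite -/w !mulrA -[(_ * chi w * _)%R]mulrA dvdz_mull.
have wN := half_not_inverted dw.
have wv : conj_pm (half v) (half w).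
  by move: he; case: (flips e) => /= he; [right | left]; rewrite // -[_^-1]zexpg1 zexpgV -zexpgN.
have rootE : root v = root w.
  rewrite /root; have -> : [pick u | `[< conj_pm (half v) (half u) >]]
      = [pick u | `[< conj_pm (half w) (half u) >]].
    apply: eq_pick => u; apply/asboolP/asboolP; last exact: conj_pm_trans.
    exact/conj_pm_trans/conj_pm_sym.
  (* [w] itself satisfies the predicate, so the default of [odflt] is not reached. *)
  by case: pickP => // /(_ w) /asboolP; case; left; exists 1; rewrite conjg1.
have wr : conj_pm (half w) (half (root w)).
  rewrite /root; case: pickP => [u /asboolP//|_]; left; exists 1; by rewrite conjg1.
rewrite /half_sign rootE; move: (root w) wr => r wr.
case: (flips e) he => he; rewrite ?addbF ?addbT; last first.
  congr (~~ _); apply/asboolP/asboolP => h; first exact: conjugate_trans h he.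
  exact: conjugate_trans h (conjugate_sym he).
rewrite negbK; apply/idP/idP => [|/asboolP rw].
  move=> /asboolP rv; apply/asboolP; case: (conj_pm_sym wr) => // rw.
  by case: rv; apply: conjugate_trans rw _; apply: conjugate_sym.
apply/asboolP => rv; apply: wN; apply: conjugate_trans (conjugate_sym rw) _.
exact: conjugate_trans rv he.
Qed.

(** The signs are absorbed into the lengths [c], so no sign twist is left along the edges and [q]
    need not be even. *)
Lemma odd_detects_red f f' x i j : red f f' x -> src f = tgt f' ->
  finite_p_detects p (zexpg (g (src f)) i * x * zexpg (g (src f)) j).
Proof.
move=> rx ff'; pose c v := ((-1) ^+ half_sign v * chi' v)%R.
have absc (k : int) v : `|(k * c v)%R|%N = `|(k * chi' v)%R|%N.
  by rewrite /c; case: half_sign; rewrite ?mul1r ?mulN1r ?mulrN ?abszN.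
have abs_e e : `|(L e true * chi' (endpt e true))%R|%N
    = `|(L e false * chi' (endpt e false))%R|%N.
  by rewrite !mulrA !(abszM (_ * chi _)) label_chi_abs.
apply: (@p_detect_red _ L T Gamma_nonempty Gamma_connected T_maximal c
  (fun=> false) q p p_prime (period_pnat f0) q_gt1 _ _ _ _ _ f f') => //.
- move=> e; rewrite mul1r; have [eq|ne] := eqVneq `|period (e, true)|%N q.
    (* At maximal period both sides vanish modulo [q], whatever the signs. *)
    have /eqP -> : ((L e true * c (endpt e true))%:~R : 'Z_q)%R == 0%R.
      by rewrite intr_Zp_eq0 ?q_gt1 // dvdzE absc -eq.
    apply/esym/eqP; rewrite intr_Zp_eq0 ?q_gt1 // dvdzE absc -abs_e.
    by rewrite -eq.
  (* Below the maximal period, the change of sign between the two ends cancels the one coming from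
     [flips]. *)
  congr (_%:~R)%R; rewrite /c (half_sign_edge ne) signr_addb.
  have : ((-1) ^+ flips e * (L e true * chi (endpt e true))
      = L e false * chi (endpt e false))%R.
    by rewrite flips_rel mulrA -expr2 sqrr_sign mul1r.
  move: ((-1) ^+ flips e)%R ((-1) ^+ half_sign _)%R => a b E.
  transitivity (b * (a * (L e true * chi (endpt e true))) * Posz p)%R; first by ring.
  by rewrite E; ring.
- move=> v; rewrite /c mulf_neq0 ?signr_eq0 //.
  by rewrite mulf_neq0 ?chi_neq0 // -absz_gt0 prime_gt0.
- by move=> e; rewrite !absc.
- by move=> e; have := period_dvd_q (e, true); rewrite !dvdzE absc.
Qed.

End OddPrime.

(** Powers of a vertex generator are detected by 2-groups, where sign twists are allowed; reduced
    paths with edges are detected by p-groups. *)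
Lemma odd_residually : ~ solvable G -> reduced L ->
  (forall a : G, elliptic a -> conjugate a a^-1 -> cyclic_radical G a) ->
  forall x, x != 1 -> finite_p_detects 2 x \/ finite_p_detects p x.
Proof.
move=> Gns Lred inv x x1; have /card_gt0P[v _] := Gamma_nonempty.
have [[i i0 ->]|[f [f' [y [i [j [ry fv f'v ->]]]]]]] := nontrivial_cases v x1.
  by left; apply: finite_p_detects_vgen => //; left.
right; pose per (h : oedge) := `|(lab h * (chi (src h) * Posz p))%R|%N.
have [f0 _ f0_max] := @arg_maxnP _ f xpredT per isT.
rewrite -fv; apply: (odd_detects_red Gns Lred inv (f0 := f0)) ry _; last by rewrite fv.
by move=> h; apply: f0_max.
Qed.

End ResiduallyP.

(** * Equivalence of the residual properties *)

Section Equivalences.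
Variables (Gamma : multigraph) (L : labeled_graph Gamma).
Variable T : {set edge Gamma}.
Local Notation G := (gbs L T).
Hypothesis Gamma_nonempty : nonempty_graph Gamma.
Hypothesis Gamma_connected : connected_graph Gamma.
Hypothesis T_maximal : maximal_subtree T.
Hypothesis G_not_solvable : ~ solvable G.
Hypothesis L_reduced : reduced L.

Lemma residually_p_nilpotent p : prime p ->
  residually (fun H => finite_group H /\ rho_group p H) G -> residually nilpotent G.
Proof.
move=> pp res x /res[H [sigma [[Hfin Hp] sur sx]]].
by exists H, sigma; split=> //; apply: finite_p_group_nilpotent Hp.
Qed.

Lemma detects_nilpotent_2p p r (x : G) : prime p -> prime r -> (r = 2 \/ r = p) ->
  finite_p_detects r x -> exists (H : groupType) (sigma : {multiplicative G -> H}),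
    [/\ [/\ finite_group H, nilpotent H & rho_group (pred2 2 p) H],
        range sigma = [set: H] & sigma x != 1].
Proof.
move=> pp rp r2p [H [sigma [[Hfin Hr] sur sx]]]; exists H, sigma; split=> //.
split=> //; first exact: finite_p_group_nilpotent Hr.
move=> y; have [n yn rn] := Hr y; exists n => //; apply: sub_in_pnat rn => q _.
by rewrite !inE => /eqP ->; case: r2p => ->; rewrite eqxx ?orbT.
Qed.

Lemma unimodular_p : (forall x, modular L T x = 1%R) -> residually nilpotent G ->
  exists2 p : nat, prime p & residually (fun H => finite_group H /\ rho_group p H) G.
Proof.
move=> mod1 rn; have [p pp pL] := rn_labels Gamma_nonempty Gamma_connected T_maximal
  G_not_solvable L_reduced rn.
have uni x : modular L T x = 1%R \/ modular L T x = (-1)%R by left.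
have [chi [n [D [z ud]]]] := pnumber_data Gamma_nonempty Gamma_connected T_maximal pL uni.
exists p => // x x1.
have noflip : p = 2 \/ forall e, ~~ flips L T e by right=> e; rewrite /flips mod1.
exact: (residually_finite_p Gamma_nonempty Gamma_connected T_maximal pp uni ud noflip x1).
Qed.

Lemma labels_residually p : prime p -> (forall e eps, p.-nat `|L e eps|%N) ->
  (forall x, modular L T x = 1%R \/ modular L T x = (-1)%R) ->
  (p <> 2 -> forall a : G, elliptic a -> conjugate a a^-1 -> cyclic_radical G a) ->
  residually (fun H => [/\ finite_group H, nilpotent H & rho_group (pred2 2 p) H]) G.
Proof.
move=> pp pL uni inv x x1.
have [chi [n [D [z ud]]]] := pnumber_data Gamma_nonempty Gamma_connected T_maximal pL uni.
have [p2|p2] := eqVneq p 2.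
  apply: (@detects_nilpotent_2p p p) => //; first by right.
  exact: (residually_finite_p Gamma_nonempty Gamma_connected T_maximal pp uni ud
    (or_introl p2) x1).
have [d2|dp] := odd_residually Gamma_nonempty Gamma_connected T_maximal pp pL uni ud
  G_not_solvable L_reduced (inv (elimN eqP p2)) x1.
  by apply: (@detects_nilpotent_2p p 2) => //; left.
by apply: (@detects_nilpotent_2p p p) => //; right.
Qed.

End Equivalences.

Theorem theorem5 (Gamma : multigraph) (L : labeled_graph Gamma)
    (T : {set edge Gamma})
    (Gamma_nonempty : nonempty_graph Gamma)
    (Gamma_connected : connected_graph Gamma)
    (T_maximal : maximal_subtree T)
    (G_not_solvable : ~ solvable (gbs L T))
    (L_reduced : reduced L) :
  [/\ (* 1 *)
      range (modular L T) = [set (1%R : rat)] ->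
        (residually nilpotent (gbs L T) <->
         exists2 p : nat, prime p &
           residually (fun H => finite_group H /\ rho_group p H) (gbs L T)),
      (* 2 *)
      range (modular L T) = [set (1%R : rat); (-1)%R] ->
        [<-> (* a *) residually nilpotent (gbs L T);
             (* b *) exists2 p : nat, prime p &
               residually (fun H => [/\ finite_group H, nilpotent H
                                      & rho_group (pred2 2 p) H]) (gbs L T);
             (* c *) exists2 p : nat, prime p &
               (forall e eps, p.-nat `|L e eps|%N) /\
               (p <> 2 -> forall a : gbs L T,
                  elliptic a -> conjugate a (a^-1)%g ->
                  cyclic_radical (gbs L T) a)]
    & (* 3 *)
      ~ (range (modular L T) `<=` [set (1%R : rat); (-1)%R]) ->
        ~ residually nilpotent (gbs L T)].
Proof.
split=> [mod1|mod1N1|modN rn].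
- have mod1' x : modular L T x = 1%R.
    by have : range (modular L T) (modular L T x) by []; rewrite mod1.
  split; first exact: unimodular_p.
  by move=> [p pp]; apply: residually_p_nilpotent.
- have uni x : modular L T x = 1%R \/ modular L T x = (-1)%R.
    by have : range (modular L T) (modular L T x) by []; rewrite mod1N1.
  have a_c : residually nilpotent (gbs L T) -> exists2 p : nat, prime p &
      (forall e eps, p.-nat `|L e eps|%N) /\
      (p <> 2 -> forall a : gbs L T, elliptic a -> conjugate a (a^-1)%g ->
         cyclic_radical (gbs L T) a).
    move=> rn; have [p pp pL] := rn_labels Gamma_nonempty Gamma_connected T_maximal
      G_not_solvable L_reduced rn.
    exists p => //; split=> // p2.
    exact: (rn_inverted_radical Gamma_nonempty Gamma_connected T_maximal
      G_not_solvable L_reduced rn pp p2 pL).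
  have c_b p : prime p -> (forall e eps, p.-nat `|L e eps|%N) ->
      (p <> 2 -> forall a : gbs L T, elliptic a -> conjugate a (a^-1)%g ->
         cyclic_radical (gbs L T) a) ->
      residually (fun H => [/\ finite_group H, nilpotent H
                             & rho_group (pred2 2 p) H]) (gbs L T).
    by move=> pp pL inv; apply: labels_residually inv.
  have b_a p : residually (fun H => [/\ finite_group H, nilpotent H
      & rho_group (pred2 2 p) H]) (gbs L T) -> residually nilpotent (gbs L T).
    by move=> res x /res[H [sigma [[_ Hn _] sur sx]]]; exists H, sigma.
  tfae.
  + by move=> /a_c[p pp [pL inv]]; exists p => //; apply: c_b.
  (* This passes through a), so the prime in c) is found anew. *)
  + by move=> [p _ /b_a/a_c].
  + by move=> [p pp [pL inv]]; apply: (b_a p); apply: c_b.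
apply: modN => _ [x _ <-]; exact: rn_modular.
Qed.
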